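(* Let $\sigma,\tau>-1/2$. Suppose that one of the following two sets of hypotheses holds. (Concave case) $\Gamma$ is concave and strictly decreasing, with $$\max\Big\{f\Big(\frac{1-\sigma^-}{2-\sigma^-}L\Big),\ g\Big(\frac{1-\tau^-}{2-\tau^-}L\Big)\Big\}<2\Big(\frac12-\sigma^--\tau^-\Big)L ,$$ and for some point $(\alpha,\beta)\in\Gamma$ with $\alpha,\beta>0$: (i) $f\in C^2(0,\alpha]$, $f'<0$ and $f''<0$ on $(0,\alpha]$, and a partition $0=\alpha_0<\alpha_1<\dots<\alpha_l=\alpha$ exists such that $f''$ is monotonic on $(\alpha_{i-1},\alpha_i)$ for each $i=1,\dots,l$; (ii) $g\in C^2(0,\beta]$, $g'<0$ and $g''<0$ on $(0,\beta]$, and a partition $0=\beta_0<\beta_1<\dots<\beta_m=\beta$ exists such that $g''$ is monotonic on $(\beta_{i-1},\beta_i)$ for each $i=1,\dots,m$; (iii) positive functions $\delta(r)$ and $\epsilon(r)$ exist such that, as $r\to\infty$, $$\delta(r)=O(r^{-2a_1}),\quad f''(\delta(r))^{-1}=O(r^{1-4a_2}),\quad \epsilon(r)=O(r^{-2b_1}),\quad g''(\epsilon(r))^{-1}=O(r^{1-4b_2}),$$ for some numbers $a_1,a_2,b_1,b_2>0$; (iv) and define $a_3=b_3=1/2$. (Convex case) $\Gamma$ is convex and strictly decreasing, with $$\min\Big\{(1-\sigma^-)f\Big(\frac{1-\sigma^-}{2-\sigma^-}L\Big),\ (1-\tau^-)g\Big(\frac{1-\tau^-}{2-\tau^-}L\Big)\Big\}>2(\sigma^-+\tau^-)L,$$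 $$\mu_f(\sigma)=\min\Big\{(1+\sigma)f\Big(\frac{1+\sigma}{2+\sigma}x\Big)-f(x):\ \frac{1+\sigma}{2+\sigma}L\le x\le L\Big\}>0,$$ $$\mu_g(\tau)=\min\Big\{(1+\tau)g\Big(\frac{1+\tau}{2+\tau}y\Big)-g(y):\ \frac{1+\tau}{2+\tau}L\le y\le L\Big\}>0 ,$$ and for some point $(\alpha,\beta)\in\Gamma$ with $\alpha,\beta>0$: (i) $f\in C^2[\alpha,L)$, $f'<0$ and $f''>0$ on $[\alpha,L)$, and a partition $\alpha=\alpha_0<\alpha_1<\dots<\alpha_l=L$ exists such that $f''$ is monotonic on $(\alpha_{i-1},\alpha_i)$ for each $i=1,\dots,l$; (ii) $g\in C^2[\beta,L)$, $g'<0$ and $g''>0$ on $[\beta,L)$, and a partition $\beta=\beta_0<\beta_1<\dots<\beta_m=L$ exists such that $g''$ is monotonic on $(\beta_{i-1},\beta_i)$ for each $i=1,\dots,m$; (iii) positive functions $\delta(r)$ and $\epsilon(r)$ exist such that, as $r\to\infty$, $$\delta(r)=O(r^{-2a_1}),\quad f''(L-\delta(r))^{-1}=O(r^{1-4a_2}),\quad \epsilon(r)=O(r^{-2b_1}),\quad g''(L-\epsilon(r))^{-1}=O(r^{1-4b_2}),$$ for some numbers $a_1,a_2,b_1,b_2>0$; (iv) $f(x)=L+O(x^{2a_3})$ as $x\to0$ and $g(y)=L+O(y^{2b_3})$ as $y\to0$, for some numbers $a_3,b_3>0$. Then the stretch factors maximizing $N(r,s)$ approach $$s^*=\sqrt{\frac{\tau+1/2}{\sigma+1/2}}$$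 as $r\to\infty$, with $$S(r)\subset\big[s^*-O(r^{-\mathcal E}),\ s^*+O(r^{-\mathcal E})\big],$$ where $$\mathcal E=\min\{\tfrac16,a_1,a_2,a_3,b_1,b_2,b_3\}.$$ Further, the maximal lattice count has the asymptotic formula $$\max_{s>0}N(r,s)=r^2\operatorname{Area}(\Gamma)-2rL\sqrt{(\sigma+1/2)(\tau+1/2)}+O(r^{1-2\mathcal E}).$$
   Context: Let $L>0$ and let $\Gamma$ be a strictly decreasing curve in the first quadrant with $x$- and $y$-intercepts both equal to $L$: $\Gamma$ is the graph of $y=f(x)$, where $f:[0,L]\to[0,L]$ is a strictly decreasing bijection (so $f(0)=L$, $f(L)=0$), and $g:[0,L]\to[0,L]$ is the inverse function of $f$. $\Gamma$ is called concave (respectively convex) if $f$ is concave (respectively convex). $\operatorname{Area}(\Gamma)=\int_0^Lf(x)\,dx$ is the area under $\Gamma$ in the first quadrant. For $r,s>0$, $r\Gamma(s)$ denotes the graph of $x\mapsto rsf(sx/r)$, $0\le x\le rL/s$. Write $\mathbb N=\{1,2,3,\dots\}$. For shift parameters $\sigma,\tau>-1$, the counting function $$N(r,s)=\#\{(j,k)\in\mathbb N\times\mathbb N:\ (j+\sigma)s/r\le L,\ k+\tau\le rsf((j+\sigma)s/r)\}$$ is the number of points of the shifted lattice $(\mathbb N+\sigma)\times(\mathbb N+\tau)$ lying inside or on $r\Gamma(s)$. The set $S(r)=\operatorname{arg\,max}_{s>0}N(r,s)$ is the set of all $s>0$ at which $s\mapsto N(r,s)$ attains its maximum. The negative part is $x^-=0$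 if $x\ge0$ and $x^-=|x|$ if $x<0$. The $O(\cdot)$ statements in the conclusion are as $r\to\infty$, with constants that may depend on everything except $r$ and $s$; the inclusion $S(r)\subset[s^*-O(r^{-e}),s^*+O(r^{-e})]$ means that there are constants $C,R>0$ with $|s-s^*|\le Cr^{-e}$ for all $s\in S(r)$ and all $r\ge R$. *)

(* Defs.v *)
From HB Require Import structures.
From mathcomp Require Import all_boot all_order all_algebra.
From mathcomp Require Import finmap.
From mathcomp Require Import all_classical all_reals all_analysis.
Import Order.TTheory GRing.Theory Num.Theory.
Import numFieldNormedType.Exports.

Set Implicit Arguments.
Unset Strict Implicit.
Unset Printing Implicit Defensive.

Local Open Scope classical_set_scope.
Local Open Scope ring_scope.

Definition neg_part {R : realType} (x : R) : R := if 0 <= x then 0 else `|x|.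

(* Derivatives are taken along [D], hence one-sided at an end point belonging
   to [D]: a curve satisfying the hypotheses below may have a corner at the
   point (alpha, beta), where [f] has no two-sided derivative. *)
Definition diff_quotient {R : realType} (f : R -> R) (x : R) : R -> R :=
  fun y => (f y - f x) / (y - x).

Definition derivable_on {R : realType} (D : set R) (f : R -> R) : Prop :=
  forall x, D x -> cvg (diff_quotient f x @ within D x^').

Definition deriv_on {R : realType} (D : set R) (f : R -> R) : R -> R :=
  fun x => lim (diff_quotient f x @ within D x^').

Definition deriv2_on {R : realType} (D : set R) (f : R -> R) : R -> R :=
  deriv_on D (deriv_on D f).

Definition C2_on {R : realType} (D : set R) (f : R -> R) : Prop :=
  [/\ derivable_on D f,
      derivable_on D (deriv_on D f) &
      {within D, continuous (deriv2_on D f)}].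

Definition monotonic_on {R : realType} (A : set R) (h : R -> R) : Prop :=
  {in A &, {homo h : x y / x <= y}} \/ {in A &, {homo h : x y /~ x <= y}}.

(* [p] lists the partition points after [a], so consecutive points of [a :: p]
   bound the pieces. *)
Definition piecewise_monotonic {R : realType} (a b : R) (h : R -> R) : Prop :=
  exists p : seq R, itv_partition a b p /\
    forall i, (i < size p)%N ->
      monotonic_on `](nth b (a :: p) i), (nth b (a :: p) i.+1)[%classic h.

(* [f] is a strictly decreasing bijection of [0, L] and [g] is its inverse;
   the values of [f] and [g] outside [0, L] are irrelevant. *)
Definition decreasing_curve {R : realType} (L : R) (f g : R -> R) : Prop :=
  [/\ set_bij `[0, L] `[0, L] f,
      {in `[0, L] &, {homo f : x y /~ x < y}},
      set_fun `[0, L] `[0, L] g,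
      {in `[0, L], cancel f g} &
      {in `[0, L], cancel g f}].

Definition convex_curve {R : realType} (L : R) (f : R -> R) : Prop :=
  convex_function (`[0, L]%classic : set R^o) (f : R^o -> R^o).

Definition concave_curve {R : realType} (L : R) (f : R -> R) : Prop :=
  convex_function (`[0, L]%classic : set R^o) ((fun x => - f x) : R^o -> R^o).

Definition on_curve {R : realType} (L : R) (f : R -> R) (alpha beta : R) : Prop :=
  0 <= alpha <= L /\ beta = f alpha.

Definition area {R : realType} (L : R) (f : R -> R) : R :=
  \int[lebesgue_measure]_(x in `[0, L]) f x.

Definition lattice_points {R : realType} (L : R) (f : R -> R)
    (sigma tau r s : R) : set (nat * nat) :=
  [set jk | [/\ (1 <= jk.1)%N, (1 <= jk.2)%N,
      (jk.1%:R + sigma) * s / r <= L &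
      jk.2%:R + tau <= r * s * f ((jk.1%:R + sigma) * s / r)]].

(* [fset_set] returns [fset0] on infinite sets, but the set of lattice points
   is finite whenever sigma, tau > -1 and r, s > 0. *)
Definition lattice_count {R : realType} (L : R) (f : R -> R) (sigma tau r s : R) : nat :=
  #|` fset_set (lattice_points L f sigma tau r s) |.

Definition argmax_stretch {R : realType} (L : R) (f : R -> R) (sigma tau r : R) : set R :=
  [set s | 0 < s /\ forall s', 0 < s' ->
     (lattice_count L f sigma tau r s' <= lattice_count L f sigma tau r s)%N].

(* The supremum of a nonempty bounded set of naturals, hence its maximum. *)
Definition max_lattice_count {R : realType} (L : R) (f : R -> R) (sigma tau r : R) : R :=
  sup [set (lattice_count L f sigma tau r s)%:R | s in [set s : R | 0 < s]].

(* A minimum of a continuous function over a compact interval, hence equal to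
   the infimum: a decreasing bijection between intervals is continuous. *)
Definition mu_min {R : realType} (L : R) (f : R -> R) (sigma : R) : R :=
  inf [set (1 + sigma) * f ((1 + sigma) / (2 + sigma) * x) - f x
      | x in `[(1 + sigma) / (2 + sigma) * L, L]].

(* [f = O(h)] along an arbitrary filter: the notation [=O_] does not infer the
   bundled filter for [+oo_R] and [0^'+]. *)
Definition isO {R : realType} (F : set_system R) {FF : Filter F} (f h : R -> R) : Prop :=
  (f : R -> R^o) =O_ (FilterType F FF) (h : R -> R^o).
Arguments isO {R} F {FF} f h.

Definition concave_side {R : realType} (alpha : R) (f : R -> R) (a1 a2 : R) : Prop :=
  let D : set R := `]0, alpha]%classic in
  [/\ C2_on D f,
      forall x, D x -> deriv_on D f x < 0 /\ deriv2_on D f x < 0,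
      piecewise_monotonic 0 alpha (deriv2_on D f) &
      exists delta : R -> R,
        [/\ forall r : R, 0 < r -> 0 < delta r,
            isO +oo_R delta (fun r => r `^ (- 2 * a1)) &
            isO +oo_R (fun r => (deriv2_on D f (delta r))^-1)
              (fun r => r `^ (1 - 4 * a2))]].

Definition convex_side {R : realType} (L alpha : R) (f : R -> R) (a1 a2 a3 : R) : Prop :=
  let D : set R := `[alpha, L[%classic in
  [/\ C2_on D f,
      forall x, D x -> deriv_on D f x < 0 /\ 0 < deriv2_on D f x,
      piecewise_monotonic alpha L (deriv2_on D f),
      exists delta : R -> R,
        [/\ forall r : R, 0 < r -> 0 < delta r,
            isO +oo_R delta (fun r => r `^ (- 2 * a1)) &
            isO +oo_R (fun r => (deriv2_on D f (L - delta r))^-1)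
              (fun r => r `^ (1 - 4 * a2))] &
      isO 0^'+ (fun x => f x - L) (fun x => x `^ (2 * a3))].

Definition concave_case {R : realType} (L : R) (f g : R -> R)
    (sigma tau a1 a2 a3 b1 b2 b3 : R) : Prop :=
  let sm := neg_part sigma in
  let tm := neg_part tau in
  [/\ concave_curve L f,
      Num.max (f ((1 - sm) / (2 - sm) * L)) (g ((1 - tm) / (2 - tm) * L))
        < 2 * (2^-1 - sm - tm) * L,
      exists alpha beta : R,
        [/\ on_curve L f alpha beta, 0 < alpha, 0 < beta,
            concave_side alpha f a1 a2 & concave_side beta g b1 b2] &
      a3 = 2^-1 /\ b3 = 2^-1].

Definition convex_case {R : realType} (L : R) (f g : R -> R)
    (sigma tau a1 a2 a3 b1 b2 b3 : R) : Prop :=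
  let sm := neg_part sigma in
  let tm := neg_part tau in
  [/\ convex_curve L f,
      2 * (sm + tm) * L <
        Num.min ((1 - sm) * f ((1 - sm) / (2 - sm) * L))
                ((1 - tm) * g ((1 - tm) / (2 - tm) * L)),
      0 < mu_min L f sigma,
      0 < mu_min L g tau &
      exists alpha beta : R,
        [/\ on_curve L f alpha beta, 0 < alpha, 0 < beta,
            convex_side L alpha f a1 a2 a3 & convex_side L beta g b1 b2 b3]].

Definition s_star {R : realType} (sigma tau : R) : R :=
  Num.sqrt ((tau + 2^-1) / (sigma + 2^-1)).

Definition rate {R : realType} (a1 a2 a3 b1 b2 b3 : R) : R :=
  \big[Num.min/6^-1]_(c <- [:: a1; a2; a3; b1; b2; b3]) c.

(* Main.v *)
Require Import Defs.
From HB Require Import structures.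
From mathcomp Require Import all_boot all_order all_algebra.
From mathcomp Require Import finmap.
From mathcomp Require Import all_classical all_reals all_analysis.
From mathcomp Require Import ring lra zify.
Import Order.TTheory GRing.Theory Num.Theory.
Import numFieldNormedType.Exports.

Local Open Scope classical_set_scope.
Local Open Scope ring_scope.

(** Put a = sigma + 1/2, b = tau + 1/2 and e = 1 - 2 E.  Uniformly for s in a compact
    set of stretch factors the count is
      r^2 Area - r L (a s + b / s) + O(r^e).
    The bracket is 2 sqrt (a b) + a (s - t)^2 / s with t = sqrt (b / a), the point
    called s_star.  A maximizer s does at least as well as t, so
    r (s - t)^2 = O(r^e), that is s - t = O(r^(- E)), and the value at the maximum
    follows ([optimum_rate]).

    Compactness.  As soon as it is positive, the count is at most
    r^2 Area - c r s + O(r / s + 1) for some c > 0, since the columns have heights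
    bounded by the curve and a Riemann sum of step s / r falls short of the area
    by a multiple of its step: for a concave curve by inscribed trapezoids, for a
    convex curve by the midpoint rule ([concave_riemann], [convex_riemann]).  The
    inverse curve, with sigma and tau exchanged and 1 / s for s, gives the same
    for small s.  Hence the count is bounded in s, a maximum exists, and for
    large r maximizers lie in a fixed compact set ([optimum_confined]).

    Asymptotics.  The curve is cut at (alpha, beta).  On one side points are
    counted by columns, on the other by rows, that is by columns of the inverse
    curve ([count_concave_split], [count_convex_split]).  A column of height y
    contains floor (y - tau) points, so y - tau - 1/2 minus a sawtooth.  The sum of
    the heights is compared with an integral by the midpoint rule, whose error is
    bounded through convexity and a Lipschitz constant ([midpoint_sum]).  Contributions
    of first order at the cut cancel between the two sides, by integration by
    parts for a monotone function and its inverse ([legendre_area],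
    [corner_error]).  On a convex curve some heights are below tau near the axes;
    the behaviour x^(2 a3) of the curve there bounds their number.

    Oscillation.  The sawtooth sums must be O(r^e), with e at least 2/3.  Averaged over a
    short window the sawtooth is a difference quotient of the periodic Bernoulli
    polynomial ([sawtooth_sandwich]), whose Fourier coefficients decay like 1/k^2
    and whose Cesaro sums converge uniformly by positivity of the Fejer kernel.
    The exponential sums are estimated by van der Corput's second derivative test,
    a consequence of the Kusmin-Landau inequality.  Next to the
    axis the second derivative f'' of the curve may vanish or blow up.  Where it is
    monotone the range is cut into octaves of the size of f'', and the total is
    O(r^(2/3) + sqrt (r / min f'')) ([sawtooth_monotone], [colsum_monotone]).  This
    is applied up to the distance delta r from the axis, where the minimum is
    controlled by hypothesis and gives r^(1 - 2 a2); the remaining columns number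
    O(r^(1 - 2 a1)). *)

Set Implicit Arguments.
Unset Strict Implicit.
Unset Printing Implicit Defensive.

(** * Exponential sums with monotone differences *)

Section trig.
Context {R : realType}.
Implicit Types (x : nat -> R) (a b n : nat).

Lemma le_sin_pi (t : R) : 0 <= t -> t <= 2^-1 -> t <= sin (pi * t).
Proof.
move=> t0 t2.
have cos4 : 2^-1 <= cos (pi / 4 : R).
  have c40 : 0 <= cos (pi / 4 : R).
    by apply: cos_ge0_pihalf; have := pi_gt0 R; lra.
  have : (cos (pi / 4 : R)) ^+ 2 = 2^-1.
    have := cos_mulr2n (pi / 4 : R).
    have -> : (pi / 4 *+ 2 : R) = pi / 2 by lra.
    rewrite cos_pihalf; lra.
  nra.
have sin4 : 2^-1 <= sin (pi / 4 : R).
  have := sin2cos2 (pi / 4 : R).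
  have : (cos (pi / 4 : R)) ^+ 2 = 2^-1.
    have := cos_mulr2n (pi / 4 : R).
    have -> : (pi / 4 *+ 2 : R) = pi / 2 by lra.
    rewrite cos_pihalf; lra.
  have : 0 <= sin (pi / 4 : R).
    by apply: sin_ge0_pi; have := pi_gt0 R; lra.
  nra.
have p2 := pi_ge2 R.
have [t4|t4] := lerP t 4^-1; last first.
  apply: (le_trans t2); apply: (le_trans sin4).
  by rewrite leNgt ltr_sin ?in_itv /= -?leNgt; nra.
have [||c] := @MVT_segment R sin cos 0 (pi * t).
- by nra.
- exact/continuous_subspaceT/continuous_sin.
rewrite in_itv /= => /andP[c0 c1]; rewrite sin0 !subr0 => ->.
suff : 2^-1 <= cos c by nra.
apply: (le_trans cos4).
by rewrite leNgt ltr_cos ?in_itv /= -?leNgt; nra.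
Qed.

(** Summation by parts: the weights decrease, so their total variation
    telescopes to c a - c b.-1 and no sum over n survives. *)
Lemma abel_bound (c S : nat -> R) a b : (a < b)%N ->
  (forall n, (a <= n)%N -> (n.+1 < b)%N -> c n.+1 <= c n) ->
  (forall n, `|S n| <= 1) ->
  `|\sum_(a <= n < b) c n * (S n.+1 - S n) - c b.-1 * S b|
    <= `|c a| + (c a - c b.-1).
Proof.
elim: b => // b IH; rewrite ltnS leq_eqVlt => /orP[/eqP -> _ S1|ab c1 S1].
  rewrite big_nat1 /= subrr addr0 (_ : _ - _ = - (c b * S b)); last by ring.
  by rewrite normrN normrM ler_piMr.
rewrite big_nat_recr ?(ltnW ab) //=.
have := IH ab (fun n an nb => c1 n an (ltnW nb)) S1.
set T := \sum_(_ <= _ < _) _ => IH'.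
have b0 : b = b.-1.+1 by rewrite prednK // (leq_ltn_trans _ ab).
have cb : c b <= c b.-1.
  by rewrite [X in c X <= _]b0; apply: c1; rewrite -?b0 // -ltnS -b0.
rewrite (_ : _ - _ = (T - c b.-1 * S b) + (c b.-1 - c b) * S b); last by ring.
apply: (le_trans (ler_normD _ _)).
have : `|(c b.-1 - c b) * S b| <= c b.-1 - c b.
  by rewrite normrM ger0_norm ?subr_ge0 // ler_piMr // subr_ge0.
lra.
Qed.

(** Writing a term of an exponential sum with step d as a difference of
    consecutive terms divided by 1 - exp(i d) and taking imaginary parts leaves
    two differences, the second weighted by a cotangent.  In a sum over n the
    first telescopes, and the weights of the second are monotone as soon as the
    steps are. *)
Lemma sin_cot_step (y d : R) : sin (d / 2) != 0 ->
  sin y = 2^-1 * (sin y - sin (y + d))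
        - 2^-1 * (cos (d / 2) / sin (d / 2)) * (cos (y + d) - cos y).
Proof.
move=> sd; have e : d = d / 2 + d / 2 by lra.
rewrite [in sin (y + d)]e [in cos (y + d)]e.
move: sd; move: (d / 2) => h sh; rewrite !(sinD, cosD).
have c2 : cos h * cos h = 1 - sin h * sin h.
  by have := cos2sin2 h; rewrite !expr2.
have -> : cos h * cos h - sin h * sin h = 1 - 2 * sin h * sin h.
  by rewrite c2; ring.
transitivity (sin y * (sin h * sin h + cos h * cos h)); last by field.
by rewrite c2; ring.
Qed.

(** The Kusmin-Landau inequality.  The steps stay away from the integers, so
    the cotangents of half the angle steps are at most 1 / theta; the steps
    increase, so these cotangents decrease and summation by parts loses no
    factor b - a.  The free phase phi makes the bound cover cosines too. *)
Lemma kusmin_landau (x : nat -> R) a b (theta phi : R) : (a <= b)%N ->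
  0 < theta -> theta <= 2^-1 ->
  (forall n, (a <= n)%N -> (n < b)%N -> theta <= x n.+1 - x n <= 1 - theta) ->
  (forall n, (a <= n)%N -> (n.+1 < b)%N ->
     x n.+1 - x n <= x n.+2 - x n.+1) ->
  `|\sum_(a <= n < b) sin (2 * pi * x n + phi)| <= 3 / theta.
Proof.
rewrite leq_eqVlt => /orP[/eqP <- t0 _ _ _|ab t0 t2 hd hm].
  by rewrite big_geq // normr0 divr_ge0 // ltW.
have tV : 2 <= theta^-1.
  by rewrite -[leLHS]invrK lef_pV2 // ?posrE // invr_gt0.
have sd n : (a <= n)%N -> (n < b)%N -> theta <= sin (pi * (x n.+1 - x n)).
  move=> an nb; have /andP[d1 d2] := hd n an nb.
  have [d3|d3] := lerP (x n.+1 - x n) 2^-1.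
    by apply: (le_trans d1); apply: le_sin_pi => //; lra.
  have -> : pi * (x n.+1 - x n) = - (pi * (1 - (x n.+1 - x n))) + pi by ring.
  rewrite sinDpi sinN opprK.
  by apply: le_trans (le_sin_pi _ _); lra.
pose c n := cos (pi * (x n.+1 - x n)) / sin (pi * (x n.+1 - x n)).
have cb n : (a <= n)%N -> (n < b)%N -> `|c n| <= theta^-1.
  move=> an nb; have s := sd n an nb.
  rewrite normrM normfV (gtr0_norm (lt_le_trans t0 s)).
  rewrite -[leRHS]mul1r ler_pM ?invr_ge0 ?cos_max ?(le_trans (ltW t0) s) //.
  by rewrite lef_pV2 ?posrE // (lt_le_trans t0 s).
have cm n : (a <= n)%N -> (n.+1 < b)%N -> c n.+1 <= c n.
  move=> an nb; have s1 := sd n an (ltnW nb); have s2 := sd n.+1 (leqW an) nb.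
  rewrite -subr_ge0 /c -mulNr addf_div; last 2 first.
  - by rewrite gt_eqF // (lt_le_trans t0 s1).
  - by rewrite gt_eqF // (lt_le_trans t0 s2).
  apply: divr_ge0; last by rewrite mulr_ge0 // ltW // (lt_le_trans t0).
  set u := pi * (x n.+1 - _); set v := pi * (x n.+2 - _).
  have -> : cos u * sin v + - cos v * sin u = sin (v - u) by rewrite sinB; ring.
  have /andP[? ?] := hd n an (ltnW nb).
  have /andP[? ?] := hd n.+1 (leqW an) nb.
  have := hm n an nb; have := pi_gt0 R.
  by move=> p0 ?; apply: sin_ge0_pi; rewrite /u /v; nra.
pose y n := 2 * pi * x n + phi.
have step n : (a <= n)%N -> (n < b)%N -> sin (y n) =
    2^-1 * (sin (y n) - sin (y n.+1)) - 2^-1 * (c n * (cos (y n.+1) - cos (y n))).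
  move=> an nb; have s := sd n an nb.
  have e : y n.+1 = y n + 2 * (pi * (x n.+1 - x n)) by rewrite /y; ring.
  have e2 : 2 * (pi * (x n.+1 - x n)) / 2 = pi * (x n.+1 - x n) by field.
  rewrite e {1}(@sin_cot_step (y n) (2 * (pi * (x n.+1 - x n)))) e2; last first.
    by rewrite gt_eqF // (lt_le_trans t0 s).
  by rewrite -/(c n) !mulrA.
(* a telescoping part and a part ready for summation by parts *)
rewrite (@eq_big_nat _ _ _ a b _ (fun n => 2^-1 * (sin (y n) - sin (y n.+1))
   - 2^-1 * (c n * (cos (y n.+1) - cos (y n))))); last first.
  by move=> n /andP[an nb]; exact: step.
rewrite sumrB -!mulr_sumr.
have -> : \sum_(a <= n < b) (sin (y n) - sin (y n.+1)) = sin (y a) - sin (y b).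
  have := telescope_sumr (fun n => - sin (y n)) (ltnW ab).
  rewrite opprK addrC => <-.
  by apply: eq_bigr => n _; rewrite opprK addrC.
have b0 : b = b.-1.+1 by rewrite prednK // (leq_ltn_trans _ ab).
have /= := @abel_bound c (fun n => cos (y n)) a b ab cm (fun n => cos_max _).
set T := \sum_(_ <= _ < _) _.
have /ler_normlP[? ?] := cb a (leqnn _) ab.
have /ler_normlP[? ?] : `|c b.-1| <= theta^-1 by apply: cb; lia.
have := cos_max (y b); move: (cos (y b)) => C Cb.
have : `|c b.-1 * C| <= theta^-1.
  rewrite normrM -[leRHS]mulr1 ler_pM //; first by apply: cb; lia.
have /ler_normlP[? ?] := sin_max (y a).
have /ler_normlP[? ?] := sin_max (y b).
have ca : `|c a| <= theta^-1 by exact: cb.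
rewrite !ler_norml => /andP[? ?] /andP[? ?]; apply/andP; split; lra.
Qed.

Lemma split_monotone (u : nat -> R) a b (t : R) : (a <= b)%N ->
  (forall n, (a <= n)%N -> (n.+1 < b)%N -> u n <= u n.+1) ->
  exists c, [/\ (a <= c)%N, (c <= b)%N,
    forall n, (a <= n)%N -> (n < c)%N -> u n < t &
    forall n, (c <= n)%N -> (n < b)%N -> t <= u n].
Proof.
move=> ab; rewrite -(subnKC ab); move: (b - a)%N => k {ab b}.
elim: k => [_|k IH hu].
  by exists a; split; rewrite ?addn0 // => n; lia.
have [n an nk|c [ac ck h1 h2]] := IH.
  by apply: hu => //; lia.
have [lt|ge] := ltP (u (a + k)%N) t.
  exists (a + k.+1)%N; split; rewrite ?leq_addr // => n; last by lia.
  move=> an nk; have [nc|cn] := ltnP n c; first exact: h1.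
  have [nk'|kn] := ltnP n (a + k); last by have -> : n = (a + k)%N by lia.
  have := h2 (a + k).-1.
  have := hu (a + k).-1; rewrite prednK; last by lia.
  have : forall i, (n <= i)%N -> (i <= a + k)%N -> u n <= u i.
    elim=> [|i IHi ni ik]; first by case: (n) => // _ _.
    have [->//|ni'] := eqVneq n i.+1.
    apply: le_trans (IHi _ _) (hu _ _ _); lia.
  move=> H _ _; apply: le_lt_trans (H (a + k)%N _ _) lt; lia.
exists c; split=> //; first by lia.
move=> n cn nk; have [nk'|kn] := ltnP n (a + k); first exact: h2.
by have -> : n = (a + k)%N by lia.
Qed.

Lemma le_monotone (u : nat -> R) a b :
  (forall n, (a <= n)%N -> (n.+1 < b)%N -> u n <= u n.+1) ->
  forall i j, (a <= i)%N -> (i <= j)%N -> (j < b)%N -> u i <= u j.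
Proof.
move=> hu i j ai; elim: j => [|j IH]; first by rewrite leqn0 => /eqP ->.
rewrite leq_eqVlt => /orP[/eqP -> //|ij jb].
apply: le_trans (IH ij (ltnW jb)) (hu _ _ _); lia.
Qed.

Lemma growth_lower (u : nat -> R) a b (lam : R) :
  (forall n, (a <= n)%N -> (n.+1 < b)%N -> lam <= u n.+1 - u n) ->
  forall k, (a + k < b)%N -> k%:R * lam <= u (a + k)%N - u a.
Proof.
move=> hu; elim=> [|k IH kb]; first by rewrite addn0 mul0r subrr.
have := hu (a + k)%N (leq_addr _ _); rewrite -addnS => /(_ kb).
have := IH ltac:(lia); rewrite -(natr1 k) mulrDl mul1r; lra.
Qed.

Lemma norm_sum_sin_le (y : nat -> R) a b :
  `|\sum_(a <= n < b) sin (y n)| <= (b - a)%:R.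
Proof.
apply: (le_trans (ler_norm_sum _ _ _)).
rewrite -[leRHS]mulr1 mulr_natl -sumr_const_nat.
by apply: ler_sum => n _; exact: sin_max.
Qed.
End trig.

(** * Van der Corput's second derivative test *)

Section vdc.
Context {R : realType}.
Implicit Types (x : nat -> R) (a b n : nat).

Lemma sinD_int (t : R) (m : int) : sin (t + 2 * pi * m%:~R) = sin t.
Proof.
case: m => n.
  rewrite -[LHS]/(sin (t + 2 * pi * n%:R)).
  rewrite (_ : 2 * pi * n%:R = pi *+ 2 *+ n); last by rewrite -mulr_natr; ring.
  exact: (periodicn (@sinD2pi R)).
rewrite NegzE mulrNz mulrN -[in RHS](subrK (pi *+ 2 *+ n.+1) t).
rewrite (periodicn (@sinD2pi R)); congr (sin (_ - _)).
by rewrite -[in RHS]mulr_natr; ring.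
Qed.

Lemma cosD_int (t : R) (m : int) : cos (t + 2 * pi * m%:~R) = cos t.
Proof. by rewrite -!sinDpihalf addrAC sinD_int. Qed.

Lemma count_le_growth (u : nat -> R) a b (lam w t : R) : 0 < lam -> (a <= b)%N ->
  (forall n, (a <= n)%N -> (n.+1 < b)%N -> lam <= u n.+1 - u n) ->
  (forall n, (a <= n)%N -> (n < b)%N -> t <= u n <= t + w) -> 0 <= w ->
  (b - a)%:R <= w / lam + 1.
Proof.
move=> l0 ab hu ht w0; have [->|ab'] := eqVneq a b.
  by rewrite subnn addr_ge0 ?divr_ge0 // ltW.
have kb : (a + (b - a).-1 < b)%N by lia.
have := growth_lower hu kb.
have /andP[? ?] := ht a (leqnn _) ltac:(lia).
have /andP[? ?] := ht (a + (b - a).-1)%N (leq_addr _ _) kb.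
have -> : (b - a)%:R = (b - a).-1%:R + 1 :> R by rewrite natr1 prednK //; lia.
by move=> h; rewrite lerD2r ler_pdivlMr //; lra.
Qed.

(** Here the steps run through a single interval between consecutive integers.
    Near its two ends they are within sqrt Lam / 2 of an integer for at most
    O(1 / sqrt Lam) indices, because they grow by Lam each time; these terms are
    bounded by 1, and the Kusmin-Landau inequality handles the others. *)
Lemma second_derivative_window (x : nat -> R) a b (Lam phi : R) (m : int) :
  (a <= b)%N -> 0 < Lam -> Lam <= 1 ->
  (forall n, (a <= n)%N -> (n.+1 < b)%N ->
     Lam <= (x n.+2 - x n.+1) - (x n.+1 - x n)) ->
  (forall n, (a <= n)%N -> (n < b)%N -> m%:~R <= x n.+1 - x n <= m%:~R + 1) ->
  `|\sum_(a <= n < b) sin (2 * pi * x n + phi)| <= 9 / Num.sqrt Lam.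
Proof.
move=> ab L0 L1 he hd.
(* sines do not see the integer drift m n, which brings the steps to [0, 1] *)
pose z n := x n - m%:~R * n%:R.
have dz n : z n.+1 - z n = x n.+1 - x n - m%:~R.
  by rewrite /z -natr1; ring.
have -> : \sum_(a <= n < b) sin (2 * pi * x n + phi) =
    \sum_(a <= n < b) sin (2 * pi * z n + phi).
  apply: eq_bigr => n _; rewrite -[RHS](sinD_int _ (m * n%:Z)) /z; congr sin.
  by rewrite intrM -[n%:Z%:~R]/(n%:R); ring.
have ez n : (a <= n)%N -> (n.+1 < b)%N ->
    Lam <= (z n.+2 - z n.+1) - (z n.+1 - z n).
  by move=> an nb; rewrite !dz; have := he n an nb; lra.
have zm n : (a <= n)%N -> (n.+1 < b)%N -> z n.+1 - z n <= z n.+2 - z n.+1.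
  by move=> an nb; have := ez n an nb; lra.
have z01 n : (a <= n)%N -> (n < b)%N -> 0 <= z n.+1 - z n <= 1.
  by move=> an nb; rewrite dz; have := hd n an nb; lra.
set q := Num.sqrt Lam; have q0 : 0 < q by rewrite sqrtr_gt0.
have q1 : q <= 1 by rewrite -sqrtr1 ler_wsqrtr.
have qq : q * q = Lam by rewrite -expr2 sqr_sqrtr ?ltW.
have qV1 : 1 <= q^-1 by rewrite invf_ge1.
pose d n := z n.+1 - z n.
have [c [ac cb dlt dge]] := @split_monotone R d a b (q / 2) ab zm.
have [|e [ce eb elt ege]] := @split_monotone R d c b (1 - q / 2) cb.
  by move=> n cn nb; apply: zm => //; lia.
rewrite (big_cat_nat ac cb) /= (big_cat_nat ce eb) /=.
have s1 : (c - a)%:R <= q^-1 / 2 + 1.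
  have -> : q^-1 / 2 = (q / 2) / Lam by rewrite -qq; field; rewrite gt_eqF.
  apply: (@count_le_growth d _ _ _ _ 0 L0 ac); last by lra.
  - by move=> n an nc; apply: ez; lia.
  - by move=> n an nc; rewrite add0r (ltW (dlt n _ _)) // ?andbT; have /andP[] := z01 n an ltac:(lia).
have s3 : (b - e)%:R <= q^-1 / 2 + 1.
  have -> : q^-1 / 2 = (q / 2) / Lam by rewrite -qq; field; rewrite gt_eqF.
  apply: (@count_le_growth d _ _ _ _ (1 - q / 2) L0 eb); last by lra.
  - by move=> n an nc; apply: ez; lia.
  - move=> n an nc; rewrite subrK ege //=.
    by have /andP[] := z01 n ltac:(lia) nc.
have s2 : `|\sum_(c <= n < e) sin (2 * pi * z n + phi)| <= 3 / (q / 2).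
  apply: kusmin_landau => //; [by lra|by lra| |].
  - by move=> n cn ne; rewrite dge ?ltW //=; [exact: elt|lia].
  - by move=> n cn ne; apply: zm; lia.
have E : 3 / (q / 2) = 6 * q^-1 by field; rewrite gt_eqF.
rewrite E in s2.
have /= := @norm_sum_sin_le R (fun n => 2 * pi * z n + phi) a c.
have /= := @norm_sum_sin_le R (fun n => 2 * pi * z n + phi) e b.
move: s1 s2 s3 qV1; move: (q^-1) => Q.
set A := \sum_(a <= _ < c) _; set B := \sum_(c <= _ < e) _.
set C := \sum_(e <= _ < b) _ => s1 s2 s3 q' hC hA.
have := ler_normD A (B + C); have := ler_normD B C; lra.
Qed.

Lemma second_derivative_windows (x : nat -> R) (Lam phi : R) j :
  0 < Lam -> Lam <= 1 -> forall a b (m : int), (a <= b)%N ->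
  (forall n, (a <= n)%N -> (n.+1 < b)%N ->
     Lam <= (x n.+2 - x n.+1) - (x n.+1 - x n)) ->
  (forall n, (a <= n)%N -> (n < b)%N ->
     m%:~R <= x n.+1 - x n <= m%:~R + j%:R) ->
  `|\sum_(a <= n < b) sin (2 * pi * x n + phi)| <= j.+1%:R * (9 / Num.sqrt Lam).
Proof.
move=> L0 L1; elim: j => [|j IH] a b m ab he hd.
  rewrite mul1r; apply: (@second_derivative_window x _ _ Lam phi m) => // n an nb.
  by have := hd n an nb; lra.
have [|c [ac cb dlt dge]] := @split_monotone R (fun n => x n.+1 - x n) a b (m + 1)%:~R ab.
  by move=> n an nb; have := he n an nb; lra.
rewrite (big_cat_nat ac cb) /=.
apply: (le_trans (ler_normD _ _)).
rewrite -(natr1 j.+1) [leRHS]mulrDl [X in _ <= _ + X]mul1r [leLHS]addrC; apply: lerD.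
  apply: (IH c b (m + 1)) => //.
  - by move=> n cn nb; apply: he; lia.
  - move=> n cn nb; rewrite dge //=.
    by have := hd n ltac:(lia) nb; rewrite intrD -natr1; lra.
apply: (@second_derivative_window x _ _ Lam phi m) => //.
- by move=> n an nc; apply: he; lia.
- move=> n an nc; have := dlt n an nc; have := hd n an ltac:(lia).
  by rewrite intrD; lra.
Qed.

(** The steps increase from one value to another at distance at most V, hence
    meet at most V + 3 intervals between consecutive integers. *)
Lemma second_derivative_test (x : nat -> R) (Lam V phi : R) a b :
  (a <= b)%N -> 0 < Lam -> Lam <= 1 -> 0 <= V ->
  (forall n, (a <= n)%N -> (n.+1 < b)%N ->
     Lam <= (x n.+2 - x n.+1) - (x n.+1 - x n)) ->
  (forall n k, (a <= n)%N -> (n <= k)%N -> (k < b)%N ->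
     (x k.+1 - x k) - (x n.+1 - x n) <= V) ->
  `|\sum_(a <= n < b) sin (2 * pi * x n + phi)| <= (V + 3) * (9 / Num.sqrt Lam).
Proof.
move=> ab L0 L1 V0 he hV.
pose d n := x n.+1 - x n.
have dm : forall i k, (a <= i)%N -> (i <= k)%N -> (k < b)%N -> d i <= d k.
  apply: le_monotone => n an nb.
  by have := he n an nb; rewrite /d; lra.
apply: (@le_trans _ _ ((Num.truncn V).+2.+1%:R * (9 / Num.sqrt Lam))); last first.
  apply: ler_wpM2r; first by rewrite divr_ge0 ?sqrtr_ge0.
  have /andP[h _] := truncn_itv V0; rewrite -(natr1 (Num.truncn V).+2) -(natr1 (Num.truncn V).+1) -(natr1 (Num.truncn V)); lra.
apply: (@second_derivative_windows x Lam phi _ L0 L1 _ _ (Num.floor (d a))) => // n an nb.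
have /andP[f1 f2] := floor_itv (d a).
have := dm a n (leqnn _) an nb; have := hV a n (leqnn _) an nb.
have := truncnS_gt V; rewrite intrD in f2.
by rewrite -/(d a) -/(d n) -(natr1 (Num.truncn V).+1); lra.
Qed.

End vdc.

(** * Uniform Cesaro sums of the periodic Bernoulli polynomial *)

Section fejer.
Context {R : realType}.
Implicit Types (x t : R) (K n : nat).

(** The Dirichlet kernel, in a form without denominators. *)
Lemma sin_dirichlet t n :
  sin t * (1 + 2 * \sum_(1 <= k < n.+1) cos (2 * k%:R * t)) =
  sin ((2 * n%:R + 1) * t).
Proof.
elim: n => [|n IH]; first by rewrite big_geq // !mulr0 addr0 add0r mulr1 mul1r.
rewrite big_nat_recr //= -[in RHS](natr1 n).
set A := \sum_(_ <= _ < _) _ in IH *; set c := cos _.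
have -> : sin t * (1 + 2 * (A + c)) = sin t * (1 + 2 * A) + 2 * sin t * c by ring.
rewrite IH /c.
have -> : (2 * n%:R + 1) * t = 2 * (n.+1)%:R * t - t by rewrite -(natr1 n); ring.
have -> : (2 * (n%:R + 1) + 1) * t = 2 * (n.+1)%:R * t + t by rewrite -(natr1 n); ring.
by rewrite sinB sinD; ring.
Qed.

(** Averaging the Dirichlet kernels gives a square: this positivity is what makes
    the Cesaro sums below converge uniformly. *)
Lemma sin_fejer t K :
  sin t ^+ 2 * (K%:R + 2 * \sum_(1 <= k < K) (K%:R - k%:R) * cos (2 * k%:R * t))
  = sin (K%:R * t) ^+ 2.
Proof.
elim: K => [|K IH]; first by rewrite big_geq // mul0r sin0; ring.
have -> : \sum_(1 <= k < K.+1) (K.+1%:R - k%:R) * cos (2 * k%:R * t) =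
   \sum_(1 <= k < K) (K%:R - k%:R) * cos (2 * k%:R * t) +
   \sum_(1 <= k < K.+1) cos (2 * k%:R * t).
  case: K {IH} => [|K]; first by rewrite !big_geq // addr0.
  have -> : \sum_(1 <= k < K.+1) (K.+1%:R - k%:R) * cos (2 * k%:R * t) =
     \sum_(1 <= k < K.+2) (K.+1%:R - k%:R) * cos (2 * k%:R * t).
    by rewrite [RHS]big_nat_recr //= subrr mul0r addr0.
  rewrite -big_split /=; apply: eq_bigr => k _; rewrite -(natr1 K.+1); ring.
have := sin_dirichlet t K; move: IH.
set A := \sum_(1 <= k < K) _; set B := \sum_(1 <= k < K.+1) _ => IH hB.
rewrite -(natr1 K); transitivity (sin (K%:R * t) ^+ 2 + sin t * sin ((2 * K%:R + 1) * t)).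
  by rewrite -hB -IH; ring.
have -> : (2 * K%:R + 1) * t = K%:R * t + (K%:R * t + t) by ring.
have -> : (K%:R + 1) * t = K%:R * t + t by ring.
rewrite !(sinD, cosD); set s := sin (_ * t); set c := cos (_ * t).
have h1 : c ^+ 2 = 1 - s ^+ 2 by exact: cos2sin2.
have h2 : cos t ^+ 2 = 1 - sin t ^+ 2 by exact: cos2sin2.
transitivity (s ^+ 2 + sin t ^+ 2 * c ^+ 2 + 2 * s * c * sin t * cos t - s ^+ 2 * sin t ^+ 2).
  ring.
rewrite [RHS](_ : _ = s ^+ 2 * cos t ^+ 2 + sin t ^+ 2 * c ^+ 2 + 2 * s * c * sin t * cos t); last by ring.
by rewrite h1 h2; ring.
Qed.

Definition fejer K x : R :=
  1 + 2 * \sum_(1 <= k < K) (1 - k%:R / K%:R) * cos (2 * pi * k%:R * x).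

Lemma fejerE K x : (0 < K)%N ->
  K%:R * sin (pi * x) ^+ 2 * fejer K x = sin (K%:R * (pi * x)) ^+ 2.
Proof.
move=> K0; rewrite -sin_fejer /fejer.
have Kn0 : K%:R != 0 :> R by rewrite pnatr_eq0 -lt0n.
have -> : \sum_(1 <= k < K) (K%:R - k%:R) * cos (2 * k%:R * (pi * x)) =
    K%:R * \sum_(1 <= k < K) (1 - k%:R / K%:R) * cos (2 * pi * k%:R * x).
  rewrite mulr_sumr; apply: eq_bigr => k _.
  have -> : 2 * k%:R * (pi * x) = 2 * pi * k%:R * x by ring.
  by field.
ring.
Qed.

Lemma is_derive_sum_nat (h : nat -> R -> R) (dh : nat -> R) K x :
  (forall k, is_derive x 1 (h k) (dh k)) ->
  is_derive x 1 (fun y => \sum_(1 <= k < K) h k y) (\sum_(1 <= k < K) dh k).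
Proof.
move=> hd; elim: K => [|[|K] IH].
- by rewrite big_geq //; under eq_fun do rewrite big_geq //; exact: is_derive_cst.
- by rewrite big_geq //; under eq_fun do rewrite big_geq //; exact: is_derive_cst.
rewrite big_nat_recr //=; under eq_fun do rewrite big_nat_recr //=.
exact: is_deriveD.
Qed.

Lemma is_derive_cosM (c w x : R) :
  is_derive x 1 (fun y => c * cos (w * y)) (- (c * w * sin (w * x))).
Proof.
have -> : (fun y => c * cos (w * y)) = c \*: (@cos R \o ( *%R w)) by apply/funext.
apply: is_derive_eq.
rewrite /= !scaler1 -[_ *: _]/(_ * _) /GRing.scale /=; ring.
Qed.

Lemma is_derive_sinM (c w x : R) :
  is_derive x 1 (fun y => c * sin (w * y)) (c * w * cos (w * x)).
Proof.
have -> : (fun y => c * sin (w * y)) = c \*: (@sin R \o ( *%R w)) by apply/funext.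
apply: is_derive_eq.
rewrite /= !scaler1 -[_ *: _]/(_ * _) /GRing.scale /=; ring.
Qed.

Let saw_coef (v p k : R) : p != 0 -> k != 0 -> v / (p * k) * (2 * p * k) = 2 * v.
Proof. by move=> p0 k0; field; rewrite p0 k0. Qed.

Let bern_coef (v p k : R) : p != 0 -> k != 0 ->
  v / (2 * (p * k) ^+ 2) * (2 * p * k) = v / (p * k).
Proof. by move=> p0 k0; field; rewrite p0 k0. Qed.

(** Primitive of the Fejer kernel vanishing at 0, hence an approximation of the
    constant 1/2 on the open interval between 0 and 1. *)
Definition cesaro_saw K x : R :=
  x + \sum_(1 <= k < K) (1 - k%:R / K%:R) / (pi * k%:R) * sin (2 * pi * k%:R * x).

(** Cesaro sums of the Fourier series of (u^2 - u) / 2, without its constant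
    term. *)
Definition cesaro_bern K x : R :=
  \sum_(1 <= k < K) (1 - k%:R / K%:R) / (2 * (pi * k%:R) ^+ 2) * cos (2 * pi * k%:R * x).

Lemma is_derive_cesaro_saw K x : is_derive x 1 (cesaro_saw K) (fejer K x).
Proof.
apply: is_deriveD; rewrite mulr_sumr.
pose c k : R := (1 - k%:R / K%:R) / (pi * k%:R).
have h := @is_derive_sum_nat (fun k y => c k * sin (2 * pi * k%:R * y)) _ K x
  (fun k => is_derive_sinM (c k) (2 * pi * k%:R) x).
apply: (is_derive_eq h); apply: eq_big_nat => k /andP[k1 _].
rewrite [RHS]mulrA; congr (_ * _); rewrite /c.
by rewrite saw_coef ?gt_eqF ?pi_gt0 ?ltr0n.
Qed.

Lemma is_derive_cesaro_bern K x :
  is_derive x 1 (fun y => (y ^+ 2 - y) / 2 - cesaro_bern K y) (cesaro_saw K x - 2^-1).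
Proof.
pose c k : R := (1 - k%:R / K%:R) / (2 * (pi * k%:R) ^+ 2).
have h := @is_derive_sum_nat (fun k y => c k * cos (2 * pi * k%:R * y)) _ K x
  (fun k => is_derive_cosM (c k) (2 * pi * k%:R) x).
have h2 : is_derive x 1 (fun y : R => (y ^+ 2 - y) / 2) (x - 2^-1).
  have -> : (fun y : R => (y ^+ 2 - y) / 2) = 2^-1 \*: (fun y : R => y ^+ 2 - y).
    by apply/funext => y; rewrite /GRing.scale /= mulrC.
  apply: is_derive_eq.
  by rewrite /GRing.scale /=; field.
have hd := is_deriveB h2 h; apply: (is_derive_eq hd).
rewrite sumrN opprK /cesaro_saw addrAC; congr (_ + _); congr (_ + _).
apply: eq_big_nat => k /andP[k1 _]; congr (_ * _); rewrite /c.
by rewrite bern_coef ?gt_eqF ?pi_gt0 ?ltr0n.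
Qed.

Lemma sin_pin n : sin (pi * n%:R : R) = 0.
Proof.
elim: n => [|n IH]; first by rewrite mulr0 sin0.
by rewrite -natr1 mulrDr mulr1 sinDpi IH oppr0.
Qed.

(** Away from the integers the Fejer kernel is a square over K sin(pi x)^2. *)
Lemma fejer_bounds K x : (0 < K)%N -> 0 < x -> x <= 2^-1 ->
  0 <= fejer K x <= (K%:R * x ^+ 2)^-1.
Proof.
move=> K0 x0 x2; have := fejerE x K0.
have sx := le_sin_pi (ltW x0) x2.
have s1 : sin (K%:R * (pi * x)) ^+ 2 <= 1.
  by rewrite sin2cos2 gerBl sqr_ge0.
have Kp : 0 < K%:R :> R by rewrite ltr0n.
set q := K%:R * _ => e; have q0 : K%:R * x ^+ 2 <= q.
  by rewrite ler_pM2l // ler_pXn2r ?nnegrE ?(ltW x0) // (le_trans _ sx) // ltW.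
have kx0 : 0 < K%:R * x ^+ 2 by rewrite mulr_gt0 // exprn_gt0.
have q1 : 0 < q by apply: lt_le_trans q0.
apply/andP; split; first by rewrite -(pmulr_rge0 _ q1) e sqr_ge0.
apply: (@le_trans _ _ q^-1); last by rewrite lef_pV2.
by rewrite -(ler_pM2l q1) e mulfV ?gt_eqF.
Qed.

Lemma continuous_is_derive (h dh : R -> R) (A : set R) :
  (forall x, is_derive x 1 h (dh x)) -> {within A, continuous h}.
Proof.
move=> hd; apply: continuous_subspaceT => x.
by apply: differentiable_continuous; apply/derivable1_diffP; case: (hd x).
Qed.

(** The integral of the Fejer kernel over half a period is 1/2 and its mass
    concentrates at 0; monotonicity keeps the primitive between 0 and 1/2 even
    where the convergence fails. *)
Lemma cesaro_saw_near K x : (0 < K)%N -> 0 < x -> x < 2^-1 ->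
  0 <= 2^-1 - cesaro_saw K x <= (2 * K%:R * x ^+ 2)^-1 /\ 0 <= cesaro_saw K x.
Proof.
move=> K0 x0 x2.
have dG y := is_derive_cesaro_saw K y.
have G0 : cesaro_saw K 0 = 0.
  by rewrite /cesaro_saw add0r big1 // => k _; rewrite mulr0 sin0 mulr0.
have G2 : cesaro_saw K 2^-1 = 2^-1.
  rewrite /cesaro_saw big1 ?addr0 // => k _.
  rewrite (_ : 2 * pi * k%:R * 2^-1 = pi * k%:R); last by field.
  by rewrite sin_pin mulr0.
have Kp : 0 < K%:R :> R by rewrite ltr0n.
split.
  have [c + e] := MVT x2 (fun y _ => dG y) (continuous_is_derive dG).
  rewrite in_itv /= => /andP[c1 c2].
  have /andP[f0 f1] := fejer_bounds K0 (lt_trans x0 c1) (ltW c2).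
  rewrite G2 in e; rewrite e; apply/andP; split; first by rewrite mulr_ge0 // subr_ge0 ltW.
  have : fejer K c <= (K%:R * x ^+ 2)^-1.
    apply: (le_trans f1); rewrite lef_pV2 ?posrE ?mulr_gt0 ?exprn_gt0 ?(lt_trans x0 c1) //.
    by rewrite ler_pM2l // ler_pXn2r ?nnegrE ?ltW // (lt_trans x0 c1).
  rewrite -mulrA [(2 * _)^-1]invfM.
  move: (fejer K c) f0 ((K%:R * x ^+ 2)^-1) => F F0 Q FQ.
  by rewrite mulrC; apply: ler_pM => //; lra.
have [c + e] := MVT x0 (fun y _ => dG y) (continuous_is_derive dG).
rewrite in_itv /= => /andP[c1 c2].
have /andP[f0 f1] := fejer_bounds K0 c1 (ltW (lt_trans c2 x2)).
by rewrite G0 !subr0 in e; rewrite e mulr_ge0 // ltW.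
Qed.

(** Its derivative is cesaro_saw - 1/2, bounded everywhere and small away from
    0, so that it is nearly constant on a half period. *)
Definition bern_err K x : R := (x ^+ 2 - x) / 2 - cesaro_bern K x.

(** Points beyond eta are compared with 1/2 through the smallness of the
    derivative, points below eta are first moved to eta. *)
Lemma bern_err_half K x eta : (0 < K)%N -> 0 < eta -> eta < 2^-1 ->
  0 <= x <= 2^-1 ->
  `|bern_err K x - bern_err K 2^-1| <= eta / 2 + (4 * K%:R * eta ^+ 2)^-1.
Proof.
move=> K0 e0 e2 /andP[x0 x2].
have dR (y : R) : is_derive y 1 (bern_err K) (cesaro_saw K y - 2^-1) := is_derive_cesaro_bern K y.
have Kp : 0 < K%:R :> R by rewrite ltr0n.
have far y : eta <= y -> y <= 2^-1 ->
    `|bern_err K y - bern_err K 2^-1| <= (4 * K%:R * eta ^+ 2)^-1.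
  rewrite [y <= _]le_eqVlt => ey /orP[/eqP ->|y2].
    by rewrite subrr normr0 invr_ge0 !mulr_ge0 ?exprn_ge0 // ltW.
  have [c + e] := MVT y2 (fun y _ => dR y) (continuous_is_derive dR).
  rewrite in_itv /= => /andP[c1 c2]; rewrite distrC e normrM.
  have c0 : 0 < c by lra.
  have [/andP[g0 g1] _] := cesaro_saw_near K0 c0 c2.
  have : 2^-1 - cesaro_saw K c <= (2 * K%:R * eta ^+ 2)^-1.
    apply: (le_trans g1); rewrite lef_pV2 ?posrE ?mulr_gt0 ?exprn_gt0 //.
    rewrite ler_pM2l ?mulr_gt0 // ler_pXn2r ?nnegrE ?ltW //; lra.
  rewrite distrC (ger0_norm g0) ger0_norm; last by lra.
  rewrite (_ : (4 * K%:R * eta ^+ 2)^-1 = (2 * K%:R * eta ^+ 2)^-1 * 2^-1); last first.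
    by field; rewrite !gt_eqF.
  by move=> h; apply: ler_pM => //; lra.
have [xe|xe] := ltP x eta; last first.
  by apply: (le_trans (far x xe x2)); rewrite lerDr; lra.
apply: (le_trans (ler_distD (bern_err K eta) _ _)).
apply: lerD; last by apply: far => //; lra.
have [c + e] := MVT xe (fun y _ => dR y) (continuous_is_derive dR).
rewrite in_itv /= => /andP[c1 c2]; rewrite distrC e normrM.
have c0 : 0 < c by lra.
have [/andP[g0 _] g1] := cesaro_saw_near K0 c0 (lt_trans c2 e2).
rewrite ler0_norm ?ger0_norm; [|lra|lra].
rewrite mulrC; apply: ler_pM; lra.
Qed.

Definition bern2 x : R := let u := x - (Num.floor x)%:~R in (u ^+ 2 - u) / 2.

Lemma cesaro_bernD_int K x (m : int) : cesaro_bern K (x + m%:~R) = cesaro_bern K x.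
Proof.
apply: eq_bigr => k _; congr (_ * _).
rewrite -(@cosD_int R (2 * pi * k%:R * x) (k%:Z * m)); congr cos.
by rewrite intrM -[k%:Z%:~R]/(k%:R); ring.
Qed.

Lemma cesaro_bern1B K x : cesaro_bern K (1 - x) = cesaro_bern K x.
Proof.
rewrite addrC -[1]/(1%:~R) cesaro_bernD_int.
by apply: eq_bigr => k _; rewrite mulrN cosN.
Qed.

(** The mean value of the Bernoulli polynomial is never computed: only
    differences of its values occur below, so approximation up to an unknown
    constant suffices. *)
Lemma bern2_approx eps : 0 < eps -> exists2 K, (0 < K)%N &
  forall x y, `|(bern2 x - cesaro_bern K x) - (bern2 y - cesaro_bern K y)| <= eps.
Proof.
move=> e0.
pose eta := Num.min (eps / 2) 4^-1.
have eta0 : 0 < eta by rewrite lt_min divr_gt0 //=.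
have eta2 : eta < 2^-1 by rewrite gt_min; apply/orP; right; lra.
have etae : eta <= eps / 2 by rewrite ge_min lexx.
pose q := (eps * eta ^+ 2)^-1.
have q0 : 0 < q by rewrite invr_gt0 mulr_gt0 // exprn_gt0.
pose K := (Num.truncn q).+1.
have Kq : q < K%:R by exact: truncnS_gt.
exists K => // x y.
have key z : `|(bern2 z - cesaro_bern K z) - bern_err K 2^-1| <= eps / 2.
  pose u := z - (Num.floor z)%:~R.
  have /andP[u0 u1] : 0 <= u <= 1.
    by have /andP[? h] := floor_itv z; rewrite /u; rewrite intrD in h; apply/andP; split; lra.
  have -> : bern2 z - cesaro_bern K z = bern_err K u.
    by rewrite /bern_err /bern2 -/u -[in cesaro_bern K z](subrK (Num.floor z)%:~R z) cesaro_bernD_int.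
  have hK : (4 * K%:R * eta ^+ 2)^-1 <= eps / 4.
    rewrite -[leRHS]invrK lef_pV2 ?posrE ?invr_gt0 ?mulr_gt0 ?exprn_gt0 ?ltr0n ?invr_gt0 //.
    rewrite invf_div ler_pdivrMr // -(mulrA 4) -mulrA ler_peMr //.
    rewrite -(ler_pM2l q0) mulr1 (le_trans (ltW Kq)) // /q.
    by rewrite le_eqVlt; apply/orP; left; apply/eqP; field; rewrite !gt_eqF.
  have [u2|u2] := lerP u 2^-1.
    have := @bern_err_half K u eta isT eta0 eta2; rewrite u0 u2 => /(_ isT); lra.
  have -> : bern_err K u = bern_err K (1 - u).
    by rewrite /bern_err cesaro_bern1B; congr (_ - _); field.
  have := @bern_err_half K (1 - u) eta isT eta0 eta2.
  rewrite subr_ge0 u1 (_ : 1 - u <= 2^-1); last by lra.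
  by move=> /(_ isT); lra.
have := key x; have := key y.
rewrite !ler_norml => /andP[? ?] /andP[? ?]; apply/andP; split; lra.
Qed.

Definition sawtooth x : R := x - (Num.floor x)%:~R - 2^-1.

Lemma floor_frac x : exists m : int, exists u : R,
  [/\ x = m%:~R + u, 0 <= u < 1, Num.floor x = m & sawtooth x = u - 2^-1].
Proof.
exists (Num.floor x), (x - (Num.floor x)%:~R); split=> //.
- by rewrite addrC subrK.
- have /andP[? h] := floor_itv x; rewrite intrD in h.
  by apply/andP; split; lra.
Qed.

Lemma bern2E x (m : int) (u : R) : x = m%:~R + u -> 0 <= u < 1 -> bern2 x = (u ^+ 2 - u) / 2.
Proof.
move=> e /andP[u0 u1]; have fm : Num.floor x = m.
  by apply: floor_def; rewrite e intrD; apply/andP; split; lra.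
by rewrite /bern2 fm e addrAC subrr add0r.
Qed.

(** On each period the Bernoulli polynomial is a primitive of the sawtooth, so
    that its difference quotients average the sawtooth over a window of length
    w to the right or to the left of x; the sawtooth has slope 1 and jumps
    downwards, which fixes the direction of both inequalities. *)
Lemma sawtooth_sandwich x w : 0 < w -> w <= 1 ->
  (bern2 (x + w) - bern2 x) / w - w / 2 <= sawtooth x
    <= (bern2 x - bern2 (x - w)) / w + w / 2.
Proof.
move=> w0 w1; have [m [u [e u01 fm ->]]] := floor_frac x.
have /andP[u0 u1] := u01.
rewrite (bern2E e u01); apply/andP; split.
  rewrite lerBlDr ler_pdivrMr //.
  have [h|h] := ltP (u + w) 1.
    by rewrite (@bern2E (x + w) m (u + w)) ?e ?addrA //; nra.
  rewrite (@bern2E (x + w) (m + 1) (u + w - 1)); last 2 first.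
  - by rewrite e intrD; ring.
  - by lra.
  nra.
rewrite -lerBlDr ler_pdivlMr //.
have [h|h] := leP w u.
  rewrite (@bern2E (x - w) m (u - w)) ?e ?addrA //; last by lra.
  nra.
rewrite (@bern2E (x - w) (m - 1) (u - w + 1)); last 2 first.
- by rewrite e intrB; ring.
- by lra.
nra.
Qed.

Lemma sawtooth_norm_le1 x : `|sawtooth x| <= 1.
Proof.
have [m [u [_ /andP[u0 u1] _ ->]]] := floor_frac x.
by rewrite ler_norml; apply/andP; split; lra.
Qed.

Lemma norm_sum_sawtooth (y : nat -> R) (a b : nat) :
  `|\sum_(a <= j < b) sawtooth (y j)| <= (b - a)%:R.
Proof.
apply: (le_trans (ler_norm_sum _ _ _)).
rewrite -[leRHS]mulr1 mulr_natl -sumr_const_nat; apply: ler_sum => n _.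
exact: sawtooth_norm_le1.
Qed.

End fejer.

(** * Sawtooth sums over a block of bounded convexity *)

Section block.
Context {R : realType}.
Implicit Types (x z : nat -> R) (a b n : nat).

Lemma norm_sin_le (t : R) : 0 <= t -> `|sin t| <= t.
Proof.
move=> t0; have [|c _] := @MVT_segment R sin cos 0 t t0.
  exact/continuous_subspaceT/continuous_sin.
rewrite sin0 !subr0 => ->; rewrite normrM (ger0_norm t0).
by rewrite ler_piMl // cos_max.
Qed.

Lemma cos_diff (A t : R) : cos (A + 2 * t) - cos A = - 2 * sin t * sin (A + t).
Proof.
have -> : A + 2 * t = (A + t) + t by ring.
rewrite -[X in _ - cos X](addrK t A) cosB cosD; ring.
Qed.

(** Up to a constant, w * wt w k bounds the k-th Fourier coefficient of the
    difference of the Bernoulli polynomial over a step w: the coefficient 1/k^2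
    is reduced by the factor k w when k w is small. *)
Let wt (w : R) (k : nat) : R := Num.min (k%:R^-1) ((k%:R ^+ 2 * w)^-1).

Let wt_coef (p k s : R) : p != 0 -> k != 0 ->
  (2 * (p * k) ^+ 2)^-1 * (2 * s) = (p ^+ 2)^-1 * (k ^+ 2)^-1 * s.
Proof. by move=> p0 k0; field; rewrite p0 k0. Qed.

Lemma cesaro_bern_sum_le x a b (u w T : R) (E : nat -> R) K : 0 < w ->
  (forall k phi, (0 < k)%N ->
     `|\sum_(a <= n < b) sin (2 * pi * k%:R * x n + phi)| <= E k) ->
  \sum_(1 <= k < K) wt w k * E k <= T ->
  `|\sum_(a <= n < b) (cesaro_bern K (x n + u + w) - cesaro_bern K (x n + u))| <= w * T.
Proof.
move=> w0 hE hT; have p0 := pi_gt0 R; have p2 := pi_ge2 R.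
have -> : \sum_(a <= n < b) (cesaro_bern K (x n + u + w) - cesaro_bern K (x n + u)) =
   \sum_(1 <= k < K) (1 - k%:R / K%:R) / (2 * (pi * k%:R) ^+ 2) *
     (- 2 * sin (pi * k%:R * w)) * \sum_(a <= n < b)
        sin (2 * pi * k%:R * x n + (2 * pi * k%:R * u + pi * k%:R * w)).
  rewrite /cesaro_bern; under eq_bigr do rewrite -sumrB.
  rewrite exchange_big /=; apply: eq_bigr => k _.
  rewrite mulr_sumr; apply: eq_bigr => n _.
  rewrite -mulrBr -[RHS]mulrA; congr (_ * _).
  have -> : 2 * pi * k%:R * (x n + u + w) = 2 * pi * k%:R * (x n + u) + 2 * (pi * k%:R * w).
    by ring.
  rewrite cos_diff; congr (_ * sin _); ring.
apply: (le_trans (ler_norm_sum _ _ _)).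
apply: (@le_trans _ _ (w * \sum_(1 <= k < K) wt w k * E k)); last by rewrite ler_pM2l.
rewrite mulr_sumr; apply: ler_sum_nat => k /andP[k1 kK].
have E0 : 0 <= E k by apply: le_trans (hE k 0 k1).
have k0 : 0 < k%:R :> R by rewrite ltr0n.
rewrite mulrA normrM; apply: ler_pM => //; last exact: hE.
have c1 : `|(1 - k%:R / K%:R) / (2 * (pi * k%:R) ^+ 2) : R| <= (2 * (pi * k%:R) ^+ 2)^-1.
  have kK1 : k%:R / K%:R <= 1 :> R.
    rewrite ler_pdivrMr ?mul1r ?ler_nat ?ltr0n; lia.
  have kK0 : 0 <= k%:R / K%:R :> R by rewrite divr_ge0.
  have q0 : 0 <= (2 * (pi * k%:R) ^+ 2)^-1 :> R by rewrite invr_ge0 mulr_ge0 // sqr_ge0.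
  rewrite ger0_norm; last by rewrite mulr_ge0 //; lra.
  by rewrite ler_piMl //; lra.
rewrite normrM; apply: (@le_trans _ _ ((2 * (pi * k%:R) ^+ 2)^-1 * (2 * `|sin (pi * k%:R * w)|))).
  apply: ler_pM => //.
  by rewrite normrM normrN (ger0_norm (_ : 0 <= 2)).
have -> : (2 * (pi * k%:R) ^+ 2)^-1 * (2 * `|sin (pi * k%:R * w)|) =
   (pi ^+ 2)^-1 * (k%:R ^+ 2)^-1 * `|sin (pi * k%:R * w)|.
  by apply: wt_coef; rewrite gt_eqF.
rewrite /wt /Num.min; case: ifP => _.
  have := @norm_sin_le (pi * k%:R * w) (mulr_ge0 (mulr_ge0 (ltW p0) (ltW k0)) (ltW w0)).
  move=> h; apply: (@le_trans _ _ ((pi ^+ 2)^-1 * (k%:R ^+ 2)^-1 * (pi * k%:R * w))).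
    by apply: ler_wpM2l => //; rewrite mulr_ge0 // invr_ge0 sqr_ge0.
  have -> : (pi ^+ 2)^-1 * (k%:R ^+ 2)^-1 * (pi * k%:R * w) = pi^-1 * (w * k%:R^-1).
    move: (pi : R) p0 => p p0; field; rewrite !gt_eqF //.
  apply: ler_piMl.
    by rewrite mulr_ge0 ?invr_ge0 ?(ltW w0) ?(ltW k0).
  by rewrite invf_le1 //; lra.
apply: (@le_trans _ _ (1 * (k%:R ^+ 2)^-1 * 1)); last first.
  have -> : w * (k%:R ^+ 2 * w)^-1 = (k%:R ^+ 2)^-1.
    by field; rewrite !gt_eqF.
  by rewrite mul1r mulr1.
apply: ler_pM => //; [by rewrite mulr_ge0 ?invr_ge0 ?sqr_ge0| |exact: sin_max].
apply: ler_wpM2r; first by rewrite invr_ge0 sqr_ge0.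
rewrite invf_le1 ?exprn_gt0 //.
by rewrite expr_ge1 //; lra.
Qed.

(** A sawtooth sum is controlled by the exponential sums of all frequencies,
    where no truncation of the Fourier series is left: the Cesaro sums converge
    uniformly, so K can be taken after everything else.  The width w of the
    averaging window costs (b - a) w and is free. *)
Lemma sawtooth_sum_le x a b (w T : R) (E : nat -> R) : (a <= b)%N -> 0 < w -> w <= 1 ->
  (forall k phi, (0 < k)%N ->
     `|\sum_(a <= n < b) sin (2 * pi * k%:R * x n + phi)| <= E k) ->
  (forall K, \sum_(1 <= k < K) wt w k * E k <= T) ->
  `|\sum_(a <= n < b) sawtooth (x n)| <= (b - a)%:R * w + T.
Proof.
move=> ab w0 w1 hE hT.
have ew : 0 < w ^+ 2 / 2 by rewrite divr_gt0 // exprn_gt0.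
have [K K0 hK] := @bern2_approx R _ ew.
have N0 : 0 <= (b - a)%:R :> R by [].
have key u : `|\sum_(a <= n < b) (bern2 (x n + u + w) - bern2 (x n + u)) / w|
     <= (b - a)%:R * w / 2 + T.
  rewrite -mulr_suml normrM [X in _ * X]gtr0_norm ?invr_gt0 // ler_pdivrMr //.
  have h1 := cesaro_bern_sum_le u w0 hE (hT K).
  have h2 : `|\sum_(a <= n < b) (bern2 (x n + u + w) - bern2 (x n + u))
     - \sum_(a <= n < b) (cesaro_bern K (x n + u + w) - cesaro_bern K (x n + u))|
     <= (b - a)%:R * (w ^+ 2 / 2).
    rewrite -sumrB; apply: (le_trans (ler_norm_sum _ _ _)).
    rewrite mulr_natl -sumr_const_nat; apply: ler_sum => n _.
    have := hK (x n + u + w) (x n + u).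
    rewrite (_ : bern2 _ - _ - _ = bern2 (x n + u + w) - bern2 (x n + u) -
      (cesaro_bern K (x n + u + w) - cesaro_bern K (x n + u))) //; ring.
  have -> : ((b - a)%:R * w / 2 + T) * w = (b - a)%:R * (w ^+ 2 / 2) + w * T.
    by field.
  move: h1 h2; rewrite !ler_norml => /andP[? ?] /andP[? ?]; apply/andP; split; lra.
have sand n := sawtooth_sandwich (x n) w0 w1.
have cst : \sum_(a <= n < b) (w / 2) = (b - a)%:R * w / 2.
  by rewrite sumr_const_nat -[LHS]mulr_natl mulrA.
have lo : \sum_(a <= n < b) ((bern2 (x n + 0 + w) - bern2 (x n + 0)) / w) -
    (b - a)%:R * w / 2 <= \sum_(a <= n < b) sawtooth (x n).
  rewrite -cst -sumrB; apply: ler_sum => n _; rewrite addr0.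
  by have /andP[] := sand n.
have up : \sum_(a <= n < b) sawtooth (x n) <=
    \sum_(a <= n < b) ((bern2 (x n + - w + w) - bern2 (x n + - w)) / w) +
    (b - a)%:R * w / 2.
  rewrite -cst -big_split /=; apply: ler_sum => n _; rewrite subrK.
  by have /andP[] := sand n.
have /ler_normlP[? ?] := key 0; have /ler_normlP[? ?] := key (- w).
rewrite ler_norml; apply/andP; split; lra.
Qed.

Let sqrtn (k : nat) : R := Num.sqrt k%:R.

Lemma sqrtn_gt0 k : (0 < k)%N -> 0 < sqrtn k.
Proof. by move=> k0; rewrite sqrtr_gt0 ltr0n. Qed.

Lemma sqrtn_sqr k : sqrtn k * sqrtn k = k%:R.
Proof. by rewrite -expr2 sqr_sqrtr. Qed.

Lemma sum_inv_sqrt K : \sum_(1 <= k < K.+1) (sqrtn k)^-1 <= 2 * sqrtn K.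
Proof.
elim: K => [|K IH]; first by rewrite big_geq // mulr_ge0 // sqrtr_ge0.
rewrite big_nat_recr //=.
have t0 := sqrtn_gt0 (ltn0Sn K); have s0 : 0 <= sqrtn K by exact: sqrtr_ge0.
have e1 := sqrtn_sqr K; have := sqrtn_sqr K.+1; rewrite -(natr1 K) -e1.
move: IH s0 t0; move: (sqrtn K) (sqrtn K.+1) => s t IH s0 t0 e.
have st : s <= t by nra.
suff : t^-1 <= 2 * (t - s) by lra.
have h : 1 <= 2 * (t - s) * t by nra.
by rewrite -(ler_pM2r t0) mulVf ?gt_eqF.
Qed.

Lemma sum_inv_sqrt3 T j : (0 < T)%N ->
  \sum_(T <= k < T + j) (k%:R * sqrtn k)^-1 <= 3 / sqrtn T.
Proof.
move=> T0; case: j => [|j].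
  by rewrite addn0 big_geq // divr_ge0 // sqrtr_ge0.
suff : \sum_(T <= k < T + j.+1) (k%:R * sqrtn k)^-1 <= 3 / sqrtn T - 2 / sqrtn (T + j).
  by move/le_trans; apply; rewrite gerBl divr_ge0 // sqrtr_ge0.
elim: j => [|j IH].
  rewrite addn0 addn1 big_nat1 invfM.
  have : T%:R^-1 * (sqrtn T)^-1 <= 1 * (sqrtn T)^-1.
    by rewrite ler_wpM2r ?invr_ge0 ?sqrtr_ge0 // invf_le1 ?ler1n ?ltr0n.
  lra.
rewrite addnS big_nat_recr ?leq_addr //=.
apply: (le_trans (lerD IH (lexx _))).
rewrite addnS; set m := (T + j)%N; have m0 : (0 < m)%N by rewrite /m; lia.
have t0 := sqrtn_gt0 (ltn0Sn m); have s0 := sqrtn_gt0 m0.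
have e1 := sqrtn_sqr m; have := sqrtn_sqr m.+1; rewrite -(natr1 m) -e1 => e2.
move: s0 t0 e2; move: (sqrtn m) (sqrtn m.+1) => s t s0 t0 e2.
rewrite -e2; have st : s <= t by nra.
suff : (t * t * t)^-1 <= 2 / s - 2 / t by lra.
have -> : 2 / s - 2 / t = 2 * (t - s) / (s * t) by field; rewrite !gt_eqF.
have h : 1 <= 2 * (t - s) * t by nra.
rewrite ler_pdivlMr ?mulr_gt0 // ler_pdivrMl ?mulr_gt0 //.
nra.
Qed.

Lemma sum_wt_invsqrt w K : 0 < w -> w <= 1 ->
  \sum_(1 <= k < K) wt w k / sqrtn k <= 3.
Proof.
move=> w0 w1; case: K => [|K]; first by rewrite big_geq.
apply: (@le_trans _ _ (\sum_(1 <= k < 1 + K) (k%:R * sqrtn k)^-1)).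
  apply: ler_sum_nat => k /andP[k1 _]; rewrite invfM ler_wpM2r ?invr_ge0 ?sqrtr_ge0 //.
  by rewrite /wt ge_min lexx.
have := @sum_inv_sqrt3 1 K isT.
by rewrite [sqrtn 1]sqrtr1 divr1.
Qed.

(** The sum of 1 / sqrt k up to 1/w and of 1 / (w k^(3/2)) beyond. *)
Lemma sum_wt_sqrt w K : 0 < w -> w <= 1 ->
  \sum_(1 <= k < K) wt w k * sqrtn k <= 6 / Num.sqrt w.
Proof.
move=> w0 w1; set q := Num.sqrt w.
have q0 : 0 < q by rewrite sqrtr_gt0.
have qq : q * q = w by rewrite -expr2 sqr_sqrtr // ltW.
pose T := (Num.truncn w^-1).+1.
have T0 : (0 < T)%N by [].
have wV : 0 <= w^-1 by rewrite invr_ge0 ltW.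
have T1 : w^-1 < T%:R by exact: truncnS_gt.
have T2 : T%:R <= 2 * w^-1.
  have /andP[h _] := truncn_itv wV.
  have : 1 <= w^-1 by rewrite invf_ge1.
  rewrite /T -natr1; lra.
have sT := sqrtn_gt0 T0; have sTT := sqrtn_sqr T.
have b1 : sqrtn T <= 3 / 2 / q.
  rewrite -(ler_pXn2r (_ : (0 < 2)%N)) ?nnegrE ?(ltW sT) ?divr_ge0 ?(ltW q0) //.
  rewrite expr2 sTT expr_div_n (expr2 q) qq; apply: (le_trans T2).
  by rewrite ler_wpM2r //; lra.
have b2 : q^-1 <= sqrtn T.
  rewrite -(ler_pXn2r (_ : (0 < 2)%N)) ?nnegrE ?(ltW sT) ?invr_ge0 ?(ltW q0) //.
  by rewrite exprVn (expr2 q) qq (expr2 (sqrtn T)) sTT ltW.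
have wt0 k : (0 < k)%N -> wt w k <= k%:R^-1 by move=> _; rewrite /wt ge_min lexx.
have small J : (J <= T)%N -> \sum_(1 <= k < J) wt w k * sqrtn k <= 3 / q.
  move=> JT; apply: (@le_trans _ _ (\sum_(1 <= k < J.+1) (sqrtn k)^-1)).
    apply: (@le_trans _ _ (\sum_(1 <= k < J) (sqrtn k)^-1)).
      apply: ler_sum_nat => k /andP[k1 _]; have s := sqrtn_gt0 k1.
      rewrite -[leRHS]mul1r -ler_pdivlMr // -mulrA -invfM sqrtn_sqr mul1r.
      exact: wt0.
    case: J JT => [|J] JT; first by rewrite !big_geq.
    by rewrite [leRHS]big_nat_recr //= lerDl invr_ge0 sqrtr_ge0.
  apply: (le_trans (sum_inv_sqrt J)).
  have : sqrtn J <= sqrtn T by apply: ler_wsqrtr; rewrite ler_nat.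
  have -> : 3 / q = 2 * (3 / 2 / q) by field; rewrite gt_eqF.
  move: b1 sT; rewrite -(ler_pM2l (_ : 0 < 2 :> R)) //; lra.
have [KT|TK] := leqP K T.
  apply: (le_trans (small K KT)); rewrite ler_wpM2r ?invr_ge0 ?(ltW q0) //; lra.
rewrite (big_cat_nat (n := T)) //=; last exact: ltnW.
have -> : 6 / q = 3 / q + 3 / q by rewrite -mulrDl; congr (_ / _); lra.
apply: lerD; first exact: small.
apply: (@le_trans _ _ (w^-1 * \sum_(T <= k < T + (K - T)) (k%:R * sqrtn k)^-1)).
  rewrite subnKC ?(ltnW TK) // mulr_sumr; apply: ler_sum_nat => k /andP[kT _].
  have k0 : (0 < k)%N by lia.
  have s := sqrtn_gt0 k0.
  have -> : w^-1 * (k%:R * sqrtn k)^-1 = (k%:R ^+ 2 * w)^-1 * sqrtn k.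
    by rewrite -sqrtn_sqr; field; rewrite !gt_eqF.
  by rewrite ler_pM2r // /wt ge_min lexx orbT.
apply: (le_trans (ler_wpM2l wV (sum_inv_sqrt3 _ T0))).
have b3 : (sqrtn T)^-1 <= q.
  by rewrite -[leRHS]invrK lef_pV2 ?posrE ?invr_gt0.
apply: (@le_trans _ _ (w^-1 * (3 * q))); first by rewrite ler_wpM2l // ler_wpM2l.
by rewrite -qq le_eqVlt; apply/orP; left; apply/eqP; field; rewrite gt_eqF.
Qed.

(** The second derivative test for the frequency k has convexity k lam and total
    slope variation k V, so gives (k V + 3) / sqrt (k lam), summed over k against
    the weights above.  The test needs k lam <= 1; beyond that the trivial bound
    is as good, since b - a is at most V / lam.  The sign c lets the sequence be
    convex or concave. *)
Lemma sawtooth_block z a b (c lam w V : R) : (c = 1 \/ c = -1) ->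
  (a <= b)%N -> 0 < lam -> lam <= 1 -> 0 < w -> w <= 1 -> 0 <= V ->
  (forall n, (a <= n)%N -> (n.+1 < b)%N ->
     lam <= (z n.+2 - z n.+1) - (z n.+1 - z n)) ->
  (forall n k, (a <= n)%N -> (n <= k)%N -> (k < b)%N ->
     (z k.+1 - z k) - (z n.+1 - z n) <= V) ->
  `|\sum_(a <= n < b) sawtooth (c * z n)| <=
    (b - a)%:R * w + 54 * V / (Num.sqrt lam * Num.sqrt w) + 81 / Num.sqrt lam.
Proof.
move=> hc ab l0 l1 w0 w1 V0 he hV.
set p := Num.sqrt lam; have p0 : 0 < p by rewrite sqrtr_gt0.
have p1 : p <= 1 by rewrite -sqrtr1 ler_wsqrtr.
have pp : p * p = lam by rewrite -expr2 sqr_sqrtr // ltW.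
set q := Num.sqrt w; have q0 : 0 < q by rewrite sqrtr_gt0.
have [ab1|ab1] := leqP (b - a) 1.
  apply: (@le_trans _ _ 1); last first.
    have h1 : 1 <= p^-1 by rewrite invf_ge1.
    have h2 : 0 <= (b - a)%:R * w by rewrite mulr_ge0 // ltW.
    have h3 : 0 <= 54 * V / (p * q) by rewrite divr_ge0 ?mulr_ge0 // ltW.
    lra.
  by apply: (le_trans (norm_sum_sawtooth _ _ _)); rewrite lern1.
have [ab2 ab3 ab4] : [/\ (a + (b - a).-1 < b)%N, (0 < (b - a).-1)%N & (b - a).-1.+1 = (b - a)%N].
  by move: ab ab1; clear; split; lia.
pose E (k : nat) := 9 * (k%:R * V + 3) / (p * sqrtn k).
have hE k phi : (0 < k)%N ->
  `|\sum_(a <= n < b) sin (2 * pi * k%:R * (c * z n) + phi)| <= E k.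
  move=> k0.
  have kr0 : 0 < k%:R :> R by rewrite ltr0n.
  have sk := sqrtn_gt0 k0; have skk := sqrtn_sqr k.
  wlog c1 : c phi {hc} / c = 1.
    move=> H; case: hc => hc; first exact: H.
    have := H 1 (- phi) erefl.
    rewrite -normrN -sumrN; congr (`|_| <= _); apply: eq_bigr => n _.
    by rewrite hc -sinN; congr sin; ring.
  have -> : \sum_(a <= n < b) sin (2 * pi * k%:R * (c * z n) + phi) =
      \sum_(a <= n < b) sin (2 * pi * k%:R * z n + phi).
    by apply: eq_bigr => n _; rewrite c1 mul1r.
  have [kl|kl] := leP (k%:R * lam) 1.
    have := @second_derivative_test R (fun n => k%:R * z n) (k%:R * lam) (k%:R * V) phi a b ab.
    have -> : (k%:R * V + 3) * (9 / Num.sqrt (k%:R * lam)) = E k.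
      by rewrite sqrtrM ?ler0n // -/p -/(sqrtn k) /E; field; rewrite (gt_eqF p0) (gt_eqF sk).
    have -> : \sum_(a <= n < b) sin (2 * pi * k%:R * z n + phi) =
      \sum_(a <= n < b) sin (2 * pi * (k%:R * z n) + phi).
      by apply: eq_bigr => n _; rewrite mulrA.
    apply => //.
    - by rewrite mulr_gt0.
    - by rewrite mulr_ge0 // ltW.
    - by move=> n an nb; rewrite -!mulrBr ler_pM2l //; exact: he.
    - by move=> n j an nj jb; rewrite -!mulrBr ler_pM2l //; exact: hV.
  apply: (le_trans (norm_sum_sin_le _ _ _)).
  have hgr : (b - a)%:R <= 2 * (V / lam).
    have := @growth_lower R (fun n => z n.+1 - z n) a b lam he (b - a).-1 ab2.
    have := hV a (a + (b - a).-1)%N (leqnn _) (leq_addr _ _) ab2.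
    move=> h1 h2; have h3 := le_trans h2 h1.
    rewrite -ler_pdivlMr // in h3.
    have h4 : (1 : R) <= (b - a).-1%:R by rewrite ler1n.
    have -> : (b - a)%:R = (b - a).-1%:R + 1 :> R by rewrite natr1 ab4.
    by move: h3 h4; clear; lra.
  apply: (le_trans hgr); rewrite /E.
  have sp1 : 1 <= sqrtn k * p.
    rewrite -(ler_pXn2r (_ : (0 < 2)%N)) ?nnegrE ?mulr_ge0 ?(ltW sk) ?(ltW p0) //.
    by rewrite expr1n exprMn !expr2 skk pp ltW.
  apply: (@le_trans _ _ (2 * (k%:R * V) / (p * sqrtn k))); last first.
    rewrite ler_pM2r ?invr_gt0 ?mulr_gt0 //.
    have : 0 <= k%:R * V by rewrite mulr_ge0 // ltW.
    lra.
  rewrite -skk -pp.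
  have -> : 2 * (sqrtn k * sqrtn k * V) / (p * sqrtn k) = 2 * (V / (p * p)) * (sqrtn k * p).
    by field; rewrite !gt_eqF.
  by rewrite ler_peMr // mulr_ge0 // divr_ge0 // mulr_ge0 // ltW.
have hT K : \sum_(1 <= k < K) wt w k * E k <= 54 * V / (p * q) + 81 / p.
  have -> : \sum_(1 <= k < K) wt w k * E k =
    9 * V / p * (\sum_(1 <= k < K) wt w k * sqrtn k) +
    27 / p * (\sum_(1 <= k < K) wt w k / sqrtn k).
    rewrite !mulr_sumr -big_split /=; apply: eq_big_nat => j /andP[j1 _].
    have sj := sqrtn_gt0 j1; rewrite /E -(sqrtn_sqr j); move: (wt w j) => W.
    by field; rewrite !gt_eqF.
  have -> : 54 * V / (p * q) = 9 * V / p * (6 / q) by field; rewrite !gt_eqF.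
  have -> : 81 / p = 27 / p * 3 by field; rewrite !gt_eqF.
  apply: lerD; apply: ler_wpM2l.
  - by rewrite divr_ge0 ?mulr_ge0 // ltW.
  - exact: sum_wt_sqrt.
  - by rewrite divr_ge0 // ltW.
  - exact: sum_wt_invsqrt.
rewrite -addrA; exact: sawtooth_sum_le hE hT.
Qed.

End block.

(** * Sawtooth sums with monotone convexity *)

Section monotone.
Context {R : realType}.
Implicit Types (z u : nat -> R) (a b n : nat).

Definition nat_monotone u a b : Prop :=
  (forall n, (a <= n)%N -> (n.+1 < b)%N -> u n <= u n.+1) \/
  (forall n, (a <= n)%N -> (n.+1 < b)%N -> u n.+1 <= u n).

Definition second_diff z n := (z n.+2 - z n.+1) - (z n.+1 - z n).

Lemma nat_monotone_sub u a b a' b' : (a <= a')%N -> (b' <= b)%N ->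
  nat_monotone u a b -> nat_monotone u a' b'.
Proof.
by move=> aa bb [h|h]; [left|right] => n an nb; apply: h;
  [exact: leq_trans an|exact: leq_trans bb|exact: leq_trans an|exact: leq_trans bb].
Qed.

Lemma split_nat_monotone u a b (t : R) : (a <= b)%N -> nat_monotone u a b ->
  exists c, [/\ (a <= c)%N, (c <= b)%N &
    ((forall n, (a <= n)%N -> (n < c)%N -> u n <= t) /\
     (forall n, (c <= n)%N -> (n < b)%N -> t <= u n)) \/
    ((forall n, (a <= n)%N -> (n < c)%N -> t <= u n) /\
     (forall n, (c <= n)%N -> (n < b)%N -> u n <= t))].
Proof.
move=> ab [h|h].
  have [c [ac cb h1 h2]] := @split_monotone R u a b t ab h.
  exists c; split=> //; left; split=> // n an nc; exact/ltW/h1.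
have [|c [ac cb h1 h2]] := @split_monotone R (fun n => - u n) a b (- t) ab.
  by move=> n an nb; rewrite lerN2 h.
exists c; split=> //; right; split=> n an nc.
  by have := h1 n an nc; rewrite ltrN2 => /ltW.
by have := h2 n an nc; rewrite lerN2.
Qed.

Lemma sqrt_cube (w : R) : 0 <= w -> Num.sqrt (w ^+ 3) = w * Num.sqrt w.
Proof.
by move=> w0; rewrite exprSr sqrtrM ?exprn_ge0 // sqrtr_sqr ger0_norm.
Qed.

(** When the convexity stays within a factor 8 of w^3, the slopes vary by at most
    8 (b - a) w^3, and the window w balances the terms of the block estimate. *)
Lemma sawtooth_octave z a b (c w : R) : (c = 1 \/ c = -1) ->
  (a <= b)%N -> 0 < w -> w <= 1 ->
  (forall n, (a <= n)%N -> (n.+1 < b)%N -> w ^+ 3 <= second_diff z n <= 8 * w ^+ 3) ->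
  `|\sum_(a <= n < b) sawtooth (c * z n)| <=
    433 * (b - a)%:R * w + 81 / (w * Num.sqrt w).
Proof.
move=> hc ab w0 w1 he.
have q0 : 0 < Num.sqrt w by rewrite sqrtr_gt0.
have qq : Num.sqrt w * Num.sqrt w = w by rewrite -expr2 sqr_sqrtr // ltW.
have s3 := sqrt_cube (ltW w0).
have w3 : 0 < w ^+ 3 by rewrite exprn_gt0.
have N0 : 0 <= (b - a)%:R :> R by [].
have hV n k : (a <= n)%N -> (n <= k)%N -> (k < b)%N ->
    (z k.+1 - z k) - (z n.+1 - z n) <= 8 * (b - a)%:R * w ^+ 3.
  move=> an nk kb; apply: (@le_trans _ _ ((k - n)%:R * (8 * w ^+ 3))); last first.
    rewrite -mulrA mulrCA; rewrite ler_pM2l // ler_pM2r // ler_nat; lia.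
  elim: k nk kb => [|k IH] nk kb.
    by move: nk; rewrite leqn0 => /eqP ->; rewrite subrr mulr_ge0 // mulr_ge0 // ltW.
  have [->|nk'] := eqVneq n k.+1.
    by rewrite subrr mulr_ge0 // mulr_ge0 // ltW.
  have nk2 : (n <= k)%N by lia.
  have ak : (a <= k)%N by lia.
  have := IH nk2 (ltnW kb); have /andP[_] := he k ak kb; rewrite /second_diff.
  rewrite subSn // -natr1 mulrDl mul1r; lra.
have V0 : 0 <= 8 * (b - a)%:R * w ^+ 3 by rewrite !mulr_ge0 // ltW.
have w31 : w ^+ 3 <= 1 by rewrite exprn_ile1 // ltW.
have hl n : (a <= n)%N -> (n.+1 < b)%N -> w ^+ 3 <= z n.+2 - z n.+1 - (z n.+1 - z n).
  by move=> an nb; have /andP[] := he n an nb.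
have := sawtooth_block hc ab w3 w31 w0 w1 V0 hl hV.
rewrite s3.
have -> : 54 * (8 * (b - a)%:R * w ^+ 3) / (w * Num.sqrt w * Num.sqrt w)
   = 432 * (b - a)%:R * w.
  by rewrite -[X in _ / X]mulrA qq; field; rewrite gt_eqF.
lra.
Qed.

(** A monotone convexity crosses the octaves in order, so each octave is a block of
    indices and the octave estimates add up.  The main terms sum to the total
    number of indices, the remainders form a geometric series of ratio
    2^(-3/2) dominated by the flattest octave: 162 is twice 81. *)
Lemma sawtooth_octaves z (c : R) i : (c = 1 \/ c = -1) ->
  forall (w : R) a b, (a <= b)%N -> 0 < w -> 2 ^+ i * w <= 1 ->
  nat_monotone (second_diff z) a b.-1 ->
  (forall n, (a <= n)%N -> (n.+1 < b)%N ->
     w ^+ 3 <= second_diff z n <= 8 ^+ i * w ^+ 3) ->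
  `|\sum_(a <= n < b) sawtooth (c * z n)| <=
    433 * (b - a)%:R * (2 ^+ i * w) + 162 / (w * Num.sqrt w).
Proof.
move=> hc; elim: i => [|i IH] w a b ab w0 w1 hm he.
  rewrite expr0 mul1r in w1 *.
  have h : 0 < (w * Num.sqrt w)^-1 by rewrite invr_gt0 mulr_gt0 // sqrtr_gt0.
  apply: (@le_trans _ _ (433 * (b - a)%:R * w + 81 / (w * Num.sqrt w))); last by lra.
  apply: sawtooth_octave => // n an nb.
  have w3 : 0 < w ^+ 3 by rewrite exprn_gt0.
  have := he n an nb; rewrite expr0 mul1r; lra.
have i1 : 1 <= 2 ^+ i :> R by rewrite exprn_ege1 // ler1n.
have w1' : w <= 1.
  apply: le_trans w1; rewrite ler_peMl ?(ltW w0) //.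
  by rewrite exprn_ege1 // ler1n.
have q0 : 0 < Num.sqrt w by rewrite sqrtr_gt0.
have low a' b' : (a <= a')%N -> (a' <= b')%N -> (b' <= b)%N ->
    (forall n, (a' <= n)%N -> (n.+1 < b')%N -> second_diff z n <= 8 * w ^+ 3) ->
    `|\sum_(a' <= n < b') sawtooth (c * z n)| <=
      433 * (b' - a')%:R * (2 ^+ i.+1 * w) + 81 / (w * Num.sqrt w).
  move=> aa a'b' bb h; apply: (@le_trans _ _ (433 * (b' - a')%:R * w + 81 / (w * Num.sqrt w))).
    apply: sawtooth_octave => // n an nb; rewrite h // andbT.
    by have /andP[] := he n (leq_trans aa an) (leq_trans nb bb).
  rewrite lerD2r; apply: ler_wpM2l; first by rewrite -natrM ler0n.
  by rewrite ler_peMl ?(ltW w0) // exprn_ege1 // ler1n.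
have high a' b' : (a <= a')%N -> (a' <= b')%N -> (b' <= b)%N ->
    (forall n, (a' <= n)%N -> (n.+1 < b')%N -> 8 * w ^+ 3 <= second_diff z n) ->
    `|\sum_(a' <= n < b') sawtooth (c * z n)| <=
      433 * (b' - a')%:R * (2 ^+ i.+1 * w) + 81 / (w * Num.sqrt w).
  move=> aa a'b' bb h.
  have e2 : 2 ^+ i.+1 * w = 2 ^+ i * (2 * w) by rewrite exprS; ring.
  have := IH (2 * w) a' b' a'b'; rewrite -e2 mulr_gt0 // => /(_ isT w1).
  have hm' : nat_monotone (second_diff z) a' b'.-1.
    by apply: nat_monotone_sub hm => //; rewrite -!subn1 leq_sub2r.
  have hb : forall n, (a' <= n)%N -> (n.+1 < b')%N ->
    (2 * w) ^+ 3 <= second_diff z n <= 8 ^+ i * (2 * w) ^+ 3.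
    move=> n an nb.
    have -> : (2 * w) ^+ 3 = 8 * w ^+ 3 by ring.
    rewrite h //= mulrA -exprSr.
    by have /andP[] := he n (leq_trans aa an) (leq_trans nb bb).
  move=> /(_ hm' hb) /le_trans; apply; rewrite lerD2l.
  have q2 : Num.sqrt w <= Num.sqrt (2 * w) by apply: ler_wsqrtr; lra.
  have -> : 81 / (w * Num.sqrt w) = 162 / (2 * w * Num.sqrt w).
    by field; rewrite !gt_eqF.
  have q3 : 0 < Num.sqrt (2 * w) by exact: lt_le_trans q2.
  have w2 : 0 < 2 * w by rewrite mulr_gt0.
  by rewrite ler_pM2l // lef_pV2 ?posrE ?mulr_gt0 // ler_pM2l.
have ab1 : (a <= b.-1)%N \/ b = a by move: ab; clear; lia.
case: ab1 => [ab1|->]; last first.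
  rewrite big_geq // normr0 subnn mulr0 mul0r add0r divr_ge0 ?ler0n //.
  by rewrite mulr_ge0 // ltW.
have [d [ad db hd]] := split_nat_monotone (8 * w ^+ 3) ab1 hm.
have db' : (d <= b)%N by apply: leq_trans db (leq_pred _).
have pb n : (n.+1 < b)%N -> (n < b.-1)%N by clear; lia.
rewrite (big_cat_nat ad db') /=.
apply: (le_trans (ler_normD _ _)).
have -> : (b - a)%:R = (d - a)%:R + (b - d)%:R :> R.
  by rewrite -natrD; congr (_%:R); move: ad db'; clear; lia.
suff : `|\sum_(a <= n < d) sawtooth (c * z n)| <=
    433 * (d - a)%:R * (2 ^+ i.+1 * w) + 81 / (w * Num.sqrt w) /\
  `|\sum_(d <= n < b) sawtooth (c * z n)| <=
    433 * (b - d)%:R * (2 ^+ i.+1 * w) + 81 / (w * Num.sqrt w).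
  by move=> [h1 h2]; lra.
case: hd => -[h1 h2].
  split; [apply: low|apply: high] => // n an nb; first exact: h1 (ltnW nb).
  exact: h2 (pb _ nb).
split; [apply: high|apply: low] => // n an nb; first exact: h1 (ltnW nb).
exact: h2 (pb _ nb).
Qed.

(** The octaves are aligned with rho at the top; lam lies in the lowest one. *)
Lemma octave_below (rho lam : R) : 0 < rho -> 0 < lam -> lam <= rho ^+ 3 ->
  exists i w, [/\ 0 < w, 2 ^+ i * w = rho, w ^+ 3 <= lam & lam <= 8 * w ^+ 3].
Proof.
move=> r0 l0 lr.
have ex : exists i, (rho / 2 ^+ i) ^+ 3 <= lam.
  pose q := rho ^+ 3 / lam.
  have q1 : 0 <= q by rewrite divr_ge0 ?exprn_ge0 // ltW.
  pose i := (Num.truncn q).+1; exists i.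
  have qi : q <= 2 ^+ i.
    apply: (@le_trans _ _ i%:R); first by rewrite /i; apply: ltW; exact: truncnS_gt.
    by rewrite -natrX ler_nat ltnW // ltn_expl.
  rewrite expr_div_n ler_pdivrMr ?exprn_gt0 // -ler_pdivrMl // mulrC.
  by apply: (le_trans qi); apply: ler_eXnr => //; rewrite exprn_ege1 // ler1n.
have [i hi mi] := ex_minnP ex.
exists i, (rho / 2 ^+ i); split=> //.
- by rewrite divr_gt0 // exprn_gt0.
- by rewrite mulrC divfK // gt_eqF // exprn_gt0.
case: i hi mi => [|i] hi mi.
  rewrite expr0 divr1 in hi *; apply: (le_trans lr).
  have : 0 < rho ^+ 3 by rewrite exprn_gt0.
  lra.
have : ~~ ((rho / 2 ^+ i) ^+ 3 <= lam).
  by apply/negP => /mi; rewrite ltnn.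
rewrite -ltNge => /ltW /le_trans; apply.
have p : 0 < 2 ^+ i :> R by rewrite exprn_gt0.
rewrite [2 ^+ i.+1]exprS; move: (2 ^+ i) p => P p.
by rewrite le_eqVlt; apply/orP; left; apply/eqP; field; rewrite gt_eqF.
Qed.

(** Where the convexity exceeds rho^3 one block with window rho suffices; the flat
    part is cut into octaves, whose windows are all at most rho.  A single block
    over the whole range would lose a power of lam, because it would pair the
    largest slope variation with the smallest convexity. *)
Lemma sawtooth_monotone z a b (c lam rho V : R) : (c = 1 \/ c = -1) ->
  (a <= b)%N -> 0 < lam -> 0 < rho -> rho <= 1 -> 0 <= V ->
  nat_monotone (second_diff z) a b.-1 ->
  (forall n, (a <= n)%N -> (n.+1 < b)%N -> lam <= second_diff z n) ->
  (forall n k, (a <= n)%N -> (n <= k)%N -> (k < b)%N ->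
     (z k.+1 - z k) - (z n.+1 - z n) <= V) ->
  `|\sum_(a <= n < b) sawtooth (c * z n)| <=
    500 * ((b - a)%:R * rho + V / rho ^+ 2 + (Num.sqrt lam)^-1 + (rho * Num.sqrt rho)^-1).
Proof.
move=> hc ab l0 r0 r1 V0 hm he hV.
have q0 : 0 < Num.sqrt rho by rewrite sqrtr_gt0.
have qq : Num.sqrt rho * Num.sqrt rho = rho by rewrite -expr2 sqr_sqrtr // ltW.
have r3 : 0 < rho ^+ 3 by rewrite exprn_gt0.
have r31 : rho ^+ 3 <= 1 by rewrite exprn_ile1 // ltW.
have s3 := sqrt_cube (ltW r0).
have V2 : 0 <= V / rho ^+ 2 by rewrite divr_ge0 // exprn_ge0 // ltW.
have sl : 0 < (Num.sqrt lam)^-1 by rewrite invr_gt0 sqrtr_gt0.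
have sr : 0 < (rho * Num.sqrt rho)^-1 by rewrite invr_gt0 mulr_gt0.
have high a' b' : (a <= a')%N -> (a' <= b')%N -> (b' <= b)%N ->
    (forall n, (a' <= n)%N -> (n.+1 < b')%N -> rho ^+ 3 <= second_diff z n) ->
    `|\sum_(a' <= n < b') sawtooth (c * z n)| <=
      (b' - a')%:R * rho + 54 * (V / rho ^+ 2) + 81 * (rho * Num.sqrt rho)^-1.
  move=> aa a'b' bb h.
  have := @sawtooth_block R z a' b' c (rho ^+ 3) rho V hc a'b' r3 r31 r0 r1 V0 h.
  have -> : 54 * V / (Num.sqrt (rho ^+ 3) * Num.sqrt rho) = 54 * (V / rho ^+ 2).
    by rewrite s3 -[X in _ / X]mulrA qq; field; rewrite gt_eqF.
  rewrite s3; apply => n k an nk kb.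
  by apply: hV; [exact: leq_trans an|exact: nk|exact: leq_trans kb bb].
have N0 : 0 <= (b - a)%:R * rho by rewrite mulr_ge0 // ltW.
have [lr|rl] := leP lam (rho ^+ 3); last first.
  apply: (le_trans (high a b (leqnn _) ab (leqnn _) _)); last by lra.
  by move=> n an nb; apply: le_trans (he n an nb); exact: ltW.
have [i [w [w0 wr w3 lw]]] := octave_below r0 l0 lr.
have wq0 : 0 < Num.sqrt w by rewrite sqrtr_gt0.
have wV : (w * Num.sqrt w)^-1 <= 3 * (Num.sqrt lam)^-1.
  have -> : 3 * (Num.sqrt lam)^-1 = (Num.sqrt lam / 3)^-1.
    by rewrite invf_div mulrC.
  rewrite lef_pV2 ?posrE ?mulr_gt0 ?divr_gt0 ?sqrtr_gt0 //.
  rewrite ler_pdivrMr //.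
  have -> : w * Num.sqrt w * 3 = Num.sqrt (9 * w ^+ 3).
    have -> : 9 * w ^+ 3 = (3 * w) ^+ 2 * w by ring.
    rewrite sqrtrM ?sqr_ge0 // sqrtr_sqr ger0_norm; last by rewrite mulr_ge0 // ltW.
    ring.
  apply: ler_wsqrtr; apply: (le_trans lw).
  by rewrite ler_pM2r ?exprn_gt0 //; lra.
have low a' b' : (a <= a')%N -> (a' <= b')%N -> (b' <= b)%N ->
    (forall n, (a' <= n)%N -> (n.+1 < b')%N -> second_diff z n <= rho ^+ 3) ->
    `|\sum_(a' <= n < b') sawtooth (c * z n)| <=
      433 * (b' - a')%:R * rho + 486 * (Num.sqrt lam)^-1.
  move=> aa a'b' bb h.
  have := @sawtooth_octaves z c i hc w a' b' a'b' w0; rewrite wr => /(_ r1).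
  have hm' : nat_monotone (second_diff z) a' b'.-1.
    by apply: nat_monotone_sub hm => //; rewrite -!subn1 leq_sub2r.
  have hb : forall n, (a' <= n)%N -> (n.+1 < b')%N ->
    w ^+ 3 <= second_diff z n <= 8 ^+ i * w ^+ 3.
    move=> n an nb.
    have -> : 8 ^+ i * w ^+ 3 = rho ^+ 3.
      by rewrite -wr exprMn -exprM mulnC exprM; congr (_ ^+ _ * _); lra.
    by rewrite h // andbT (le_trans w3) // he //; [exact: leq_trans an|exact: leq_trans bb].
  move=> /(_ hm' hb); lra.
have ab1 : (a <= b.-1)%N \/ b = a by move: ab; clear; lia.
case: ab1 => [ab1|ba]; last first.
  rewrite ba big_geq // normr0; apply: mulr_ge0; first exact: ler0n.
  rewrite ba in N0; lra.
have [d [ad db hd]] := split_nat_monotone (rho ^+ 3) ab1 hm.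
have db' : (d <= b)%N by apply: leq_trans db (leq_pred _).
have pb n : (n.+1 < b)%N -> (n < b.-1)%N by clear; lia.
rewrite (big_cat_nat ad db') /=.
apply: (le_trans (ler_normD _ _)).
have eN : (b - a)%:R = (d - a)%:R + (b - d)%:R :> R.
  by rewrite -natrD; congr (_%:R); move: ad db'; clear; lia.
have N1 : 0 <= (d - a)%:R * rho by rewrite mulr_ge0 // ltW.
have N2 : 0 <= (b - d)%:R * rho by rewrite mulr_ge0 // ltW.
rewrite eN mulrDl.
case: hd => -[h1 h2].
  have := low a d (leqnn _) ad db' (fun n an nb => h1 n an (ltnW nb)).
  have := high d b ad db' (leqnn _) (fun n an nb => h2 n an (pb _ nb)).
  lra.
have := high a d (leqnn _) ad db' (fun n an nb => h1 n an (ltnW nb)).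
have := low d b ad db' (leqnn _) (fun n an nb => h2 n an (pb _ nb)).
lra.
Qed.

End monotone.

(** * One-sided derivatives and divided differences *)

Section calculus.
Context {R : realType}.
Implicit Types (phi : R -> R).

Lemma within_dnbhs_interior (D : set R) (x : R) : nbhs x D -> within D x^' = x^'.
Proof.
move=> xD; rewrite eqEsubset; split=> A.
  by move=> h; near=> y; have /= := near (h : x^' _) y; apply => //; near: y; exact: nbhs_dnbhs.
move=> h; rewrite /within /=; near=> y => _; near: y; exact: h.
Unshelve. all: end_near. Qed.

(** At an interior point the derivative relative to D is the usual one. *)
Lemma is_derive_diff_quotient (D : set R) phi (x : R) :
  nbhs x D -> derivable_on D phi -> is_derive x 1 phi (deriv_on D phi x).
Proof.
move=> xD hd; have := hd x (nbhs_singleton xD).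
rewrite /deriv_on (within_dnbhs_interior xD).
set l := lim _ => hl0.
have hl : diff_quotient phi x y @[y --> x^'] --> l by exact: hl0.
have sh : (h + x) @[h --> 0^'] --> x^'.
  move=> A; rewrite /dnbhs /within /= => /nbhs_ballP[e /= e0 he].
  apply/nbhs_ballP; exists e => //= h; rewrite /ball /= sub0r normrN => he' h0.
  apply: he; last by rewrite -subr_eq0 addrK.
  by rewrite /ball /= opprD addrCA subrr addr0 normrN.
have key : (fun h => h^-1 *: ((phi \o shift x) (h *: (1 : R)) - phi x)) @ 0^' --> l.
  have -> : (fun h => h^-1 *: ((phi \o shift x) (h *: (1 : R)) - phi x)) =
      diff_quotient phi x \o (fun h => h + x).
    apply/funext => h; rewrite /diff_quotient /= addrK /GRing.scale /= mulr1.
    by rewrite mulrC.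
  by move=> A lA; exact: (sh _ (hl A lA)).
apply: DeriveDef; first by apply/cvg_ex; exists l.
exact: cvg_lim.
Qed.

Lemma mvt_is_derive phi (dphi : R -> R) (a b : R) : a < b -> continuous phi ->
  (forall x, a < x < b -> is_derive x 1 phi (dphi x)) ->
  exists2 c, a < c < b & phi b - phi a = dphi c * (b - a).
Proof.
move=> ab cphi hd.
have hd' x : x \in `]a, b[%R -> is_derive x 1 phi (dphi x).
  by rewrite in_itv /= => /hd.
have [c] := @MVT R phi dphi a b ab hd' (continuous_subspaceT cphi).
by rewrite in_itv /= => cab e; exists c.
Qed.

Lemma mvt_open (df ddf : R -> R) (p q : R) :
  (forall y, p < y < q -> is_derive y 1 df (ddf y)) ->
  forall u v, u < v -> p < u -> v < q ->
  exists2 d, u < d < v & df v - df u = ddf d * (v - u).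
Proof.
move=> hdd u v uv pu vq.
have hd' x : x \in `]u, v[%R -> is_derive x 1 df (ddf x).
  by rewrite in_itv /= => hx; apply: hdd; lra.
have [|d] := @MVT R df ddf u v uv hd'.
  apply: derivable_within_continuous => y; rewrite in_itv /= => hy.
  by have [] := hdd y ltac:(lra).
by rewrite in_itv /= => h e; exists d.
Qed.

Lemma is_derive_shift phi (d : R) (u x : R) : is_derive (x + u) 1 phi d ->
  is_derive x 1 (fun t => phi (t + u)) d.
Proof.
move=> h.
have hs : is_derive x 1 (fun t : R => t + u) 1 by apply: is_derive_eq; rewrite addr0.
have := @is_derive1_comp R phi (fun t => t + u) x d 1 h hs.
by rewrite mulr1.
Qed.

Lemma continuous_shift phi (u : R) : continuous phi -> continuous (fun t => phi (t + u)).
Proof.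
move=> cphi t; apply: (@continuous_comp _ _ _ (fun t => t + u) phi t); last exact: cphi.
by apply: cvgD; [exact: cvg_id|exact: cvg_cst].
Qed.

(** Mean value theorem for the increment t |-> phi (t + eta) - phi t, then for the
    derivative.  The open interval allows derivatives that blow up at its ends. *)
Lemma second_diff_mvt phi (df ddf : R -> R) (p q x eta : R) : continuous phi -> 0 < eta ->
  (forall y, p < y < q -> is_derive y 1 phi (df y)) ->
  (forall y, p < y < q -> is_derive y 1 df (ddf y)) ->
  p <= x -> x + 2 * eta <= q ->
  exists2 c, p < c < q &
    (phi (x + 2 * eta) - phi (x + eta)) - (phi (x + eta) - phi x) = eta ^+ 2 * ddf c.
Proof.
move=> cphi e0 hd hdd px xq.
have [|||c c12 e] := @mvt_is_derive (fun t => phi (t + eta) - phi t)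
    (fun t => df (t + eta) - df t) x (x + eta).
- by lra.
- move=> t; apply: cvgB; last exact: cphi.
  exact: continuous_shift.
- move=> t ht; apply: is_deriveB; last by apply: hd; lra.
  by apply: is_derive_shift; apply: hd; lra.
have [d d12 e2] : exists2 d, c < d < c + eta & df (c + eta) - df c = ddf d * (c + eta - c).
  by apply: (mvt_open hdd); lra.
exists d; first by lra.
have -> : x + 2 * eta = x + eta + eta by ring.
rewrite e e2; ring.
Qed.

(** The third derivative need not exist: stopping one derivative earlier leaves a
    difference of second derivatives at two ordered points. *)
Lemma third_diff_mvt phi (df ddf : R -> R) (p q x eta : R) : continuous phi -> 0 < eta ->
  (forall y, p < y < q -> is_derive y 1 phi (df y)) ->
  (forall y, p < y < q -> is_derive y 1 df (ddf y)) ->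
  p <= x -> x + 3 * eta <= q ->
  exists c d, [/\ p < c, c < d, d < q &
    ((phi (x + 3 * eta) - phi (x + 2 * eta)) - (phi (x + 2 * eta) - phi (x + eta)))
    - ((phi (x + 2 * eta) - phi (x + eta)) - (phi (x + eta) - phi x))
     = eta ^+ 2 * (ddf d - ddf c)].
Proof.
move=> cphi e0 hd hdd px xq.
have ct u : continuous (fun t => phi (t + u)) by exact: continuous_shift.
have [|||c c12 e] := @mvt_is_derive (fun t => phi (t + 2 * eta) - phi (t + eta) - (phi (t + eta) - phi t))
    (fun t => df (t + 2 * eta) - df (t + eta) - (df (t + eta) - df t)) x (x + eta).
- by lra.
- move=> t; apply: cvgB; apply: cvgB => //; try exact: ct; exact: cphi.
- move=> t ht; apply: is_deriveB; apply: is_deriveB; try (apply: is_derive_shift); apply: hd; lra.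
have [d1 h1 e1]  := @mvt_open _ _ _ _ hdd c (c + eta) ltac:(lra) ltac:(lra) ltac:(lra).
have [d2 h2 e2]  := @mvt_open _ _ _ _ hdd (c + eta) (c + 2 * eta) ltac:(lra) ltac:(lra) ltac:(lra).
exists d1, d2; split; [lra|lra|lra|].
have h3 : x + eta + 2 * eta = x + 3 * eta by ring.
have h4 : x + eta + eta = x + 2 * eta by ring.
rewrite h3 h4 in e; rewrite e e1 e2; ring.
Qed.

End calculus.

(** * Sawtooth sums along an arc *)

Section arc.
Context {R : realType}.

Section hypotheses.
Variables (phi df ddf : R -> R) (p q c kappa B A eta sigma tau : R) (a b : nat).
Hypothesis cphi : continuous phi.
Hypothesis hd : forall y, p < y < q -> is_derive y 1 phi (df y).
Hypothesis hdd : forall y, p < y < q -> is_derive y 1 df (ddf y).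
Hypothesis hc : c = 1 \/ c = -1.
Hypothesis kappa0 : 0 < kappa.
Hypothesis hk : forall y, p < y < q -> kappa <= c * ddf y.
Hypothesis hB : forall x y, p <= x -> x <= y -> y <= q -> `|phi y - phi x| <= B * (y - x).
Hypothesis A0 : 0 < A.
Hypothesis eta0 : 0 < eta.

Let X (j : nat) : R := (j%:R + sigma) * eta.
Let z (j : nat) : R := c * (A * phi (X j) - tau).

Hypothesis hX : forall j, (a <= j)%N -> (j < b)%N -> p <= X j <= q.

Let c2 : c * c = 1. Proof. by case: hc => ->; rewrite ?mulrNN mul1r. Qed.

Let XS j : X j.+1 = X j + eta.
Proof. by rewrite /X -natr1; ring. Qed.

Let XSS j : X j.+2 = X j + 2 * eta.
Proof. by rewrite !XS; ring. Qed.

Let XSSS j : X j.+3 = X j + 3 * eta.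
Proof. by rewrite !XS; ring. Qed.

Let z_second_diff n : (a <= n)%N -> (n.+2 < b)%N ->
  A * eta ^+ 2 * kappa <= second_diff z n.
Proof.
move=> an nb; have /andP[h1 _] := hX an (ltnW (ltnW nb)).
have /andP[_ h2] := hX (leqW (leqW an)) nb.
rewrite XSS in h2.
have [d dpq e] := second_diff_mvt cphi eta0 hd hdd h1 h2.
have -> : second_diff z n = A * eta ^+ 2 * (c * ddf d).
  rewrite /second_diff /z XSS XS; transitivity (A * c * ((phi (X n + 2 * eta) - phi (X n + eta)) - (phi (X n + eta) - phi (X n)))); first by ring.
  by rewrite e; ring.
by rewrite ler_pM2l ?mulr_gt0 ?exprn_gt0 //; exact: hk.
Qed.

Let z_first_diff n k : (a <= n)%N -> (n <= k)%N -> (k.+1 < b)%N ->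
  (z k.+1 - z k) - (z n.+1 - z n) <= 2 * A * B * eta.
Proof.
move=> an nk kb.
have key j : (a <= j)%N -> (j.+1 < b)%N -> `|z j.+1 - z j| <= A * B * eta.
  move=> aj jb; have /andP[h1 _] := hX aj (ltnW jb).
  have /andP[_ h2] := hX (leqW aj) jb; rewrite XS in h2.
  have h3 : X j <= X j + eta by rewrite lerDl ltW.
  have := hB h1 h3 h2.
  have -> : z j.+1 - z j = c * (A * (phi (X j + eta) - phi (X j))).
    by rewrite /z XS; ring.
  have -> : `|c * (A * (phi (X j + eta) - phi (X j)))| = A * `|phi (X j + eta) - phi (X j)|.
    have -> : `|c * (A * (phi (X j + eta) - phi (X j)))| = `|A * (phi (X j + eta) - phi (X j))|.
      by case: hc => ->; rewrite ?mul1r ?mulN1r ?normrN.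
    by rewrite normrM gtr0_norm.
  rewrite (_ : X j + eta - X j = eta); last by ring.
  by rewrite -mulrA ler_pM2l.
have /ler_normlP[_ h1] := key k (leq_trans an nk) kb.
have nb : (n.+1 < b)%N by exact: leq_ltn_trans (nk : (n.+1 <= k.+1)%N) kb.
have /ler_normlP[h2 _] := key n an nb.
lra.
Qed.

(* The second difference at n involves the point X (n + 2), so the last term of a
   range is split off to keep all points inside the arc. *)
Let sum_last (T : R) : 0 <= T ->
  ((a <= b.-1)%N -> `|\sum_(a <= j < b.-1) sawtooth (c * z j)| <= T) ->
  `|\sum_(a <= j < b) sawtooth (A * phi (X j) - tau)| <= 1 + T.
Proof.
move=> T0; case: b => [|b'] h; first by rewrite big_geq // normr0 addr_ge0.
have [ab|ab] := leqP a b'; last by rewrite big_geq // normr0 addr_ge0.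
rewrite big_nat_recr //= addrC; apply: (le_trans (ler_normD _ _)); apply: lerD.
  exact: sawtooth_norm_le1.
have -> : \sum_(a <= j < b') sawtooth (A * phi (X j) - tau) =
    \sum_(a <= j < b') sawtooth (c * z j).
  by apply: eq_bigr => j _; rewrite /z mulrA c2 mul1r.
exact: h.
Qed.

Let B0 : (exists2 n, (a <= n)%N & (n.+1 < b)%N) -> 0 <= B.
Proof.
move=> [n an nb]; have /andP[h1 _] := hX an (ltnW nb).
have /andP[_ h2] := hX (leqW an) nb; rewrite XS in h2.
have h3 : X n <= X n + eta by rewrite lerDl ltW.
have := le_trans (normr_ge0 _) (hB h1 h3 h2).
by rewrite (_ : X n + eta - X n = eta) ?pmulr_lge0 //; ring.
Qed.

(** Second differences of the sampled curve are values of its second derivative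
    at intermediate points, and third differences carry its monotonicity. *)
Lemma sawtooth_arc_monotone (rho : R) : 0 <= B ->
  {in `]p, q[ &, {homo ddf : x y / x <= y}} \/
  {in `]p, q[ &, {homo ddf : x y /~ x <= y}} ->
  0 < rho -> rho <= 1 ->
  `|\sum_(a <= j < b) sawtooth (A * phi (X j) - tau)| <=
    1 + 500 * ((b - a)%:R * rho + 2 * A * B * eta / rho ^+ 2 +
               (Num.sqrt (A * eta ^+ 2 * kappa))^-1 + (rho * Num.sqrt rho)^-1).
Proof.
move=> B0' hm r0 r1.
have V0 : 0 <= 2 * A * B * eta by rewrite !mulr_ge0 // ltW.
have l0 : 0 < A * eta ^+ 2 * kappa by rewrite !mulr_gt0 ?exprn_gt0.
have mono : nat_monotone (second_diff z) a b.-1.-1.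
  have key n : (a <= n)%N -> (n.+1 < b.-1.-1)%N -> exists u v,
      [/\ p < u, u < v, v < q & second_diff z n.+1 - second_diff z n =
         A * eta ^+ 2 * (c * (ddf v - ddf u))].
    move=> an nb.
    have nb3 : (n.+3 < b)%N by move: nb; clear; lia.
    have /andP[h1 _] := hX an (ltnW (ltnW (ltnW nb3))).
    have /andP[_ h2] := hX (leqW (leqW (leqW an))) nb3.
    rewrite XSSS in h2.
    have [u [v [pu uv vq e]]] := third_diff_mvt cphi eta0 hd hdd h1 h2.
    exists u, v; split=> //.
    transitivity (A * c * (phi (X n + 3 * eta) - phi (X n + 2 * eta) -
      (phi (X n + 2 * eta) - phi (X n + eta)) -
      (phi (X n + 2 * eta) - phi (X n + eta) - (phi (X n + eta) - phi (X n))))).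
      by rewrite /second_diff /z XSSS XSS XS; ring.
    by rewrite e; ring.
  have Ae : 0 <= A * eta ^+ 2 by rewrite ltW // mulr_gt0 ?exprn_gt0.
  have incr : (forall u v, p < u -> u < v -> v < q -> c * ddf u <= c * ddf v) \/
      (forall u v, p < u -> u < v -> v < q -> c * ddf v <= c * ddf u).
    have inI u v : p < u -> u < v -> v < q -> (u \in `]p, q[%R) /\ (v \in `]p, q[%R).
      by move=> pu uv vq; rewrite !in_itv /= pu vq (lt_trans pu uv) (lt_trans uv vq).
    case: hc hm => -> [h|h]; [left|right|right|left] => u v pu uv vq;
      have [iu iv] := inI u v pu uv vq; rewrite ?mul1r ?mulN1r ?lerN2; apply: h => //; exact: ltW.
  case: incr => h; [left|right] => n an nb; have [u [v [pu uv vq e]]] := key n an nb.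
    by rewrite -subr_ge0 e mulr_ge0 // mulrBr subr_ge0 h.
  by rewrite -subr_le0 e mulr_ge0_le0 // mulrBr subr_le0 h.
apply: sum_last.
  rewrite mulr_ge0 ?ler0n // !addr_ge0 ?mulr_ge0 ?invr_ge0 ?sqrtr_ge0 ?exprn_ge0 // ?mulr_ge0 ?sqrtr_ge0 ?ltW //.
move=> ab.
have pb n : (n < b.-1)%N -> (n.+1 < b)%N by clear; lia.
apply: le_trans (sawtooth_monotone hc ab l0 r0 r1 V0 mono _ _) _.
- by move=> n an nb; apply: z_second_diff => //; exact: pb.
- by move=> n k an nk kb; apply: z_first_diff => //; exact: pb.
have : (b.-1 - a)%:R * rho <= (b - a)%:R * rho.
  by rewrite ler_wpM2r ?(ltW r0) // ler_nat; move: ab; clear; lia.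
rewrite ler_pM2l ?ltr0n //; lra.
Qed.

(** With the second derivative bounded below by a constant one block suffices;
    the variation of the slopes comes from the Lipschitz constant B. *)
Lemma sawtooth_arc_bounded (rho : R) : 0 <= B ->
  0 < rho -> rho <= 1 -> kappa <= 1 -> rho ^+ 3 <= A * eta ^+ 2 ->
  `|\sum_(a <= j < b) sawtooth (A * phi (X j) - tau)| <=
    1 + ((b - a)%:R * rho + 108 * A * B * eta / (Num.sqrt kappa * rho ^+ 2) +
         81 / (Num.sqrt kappa * (rho * Num.sqrt rho))).
Proof.
move=> B0' r0 r1 k1 rA.
have V0 : 0 <= 2 * A * B * eta by rewrite !mulr_ge0 // ltW.
have sk : 0 < Num.sqrt kappa by rewrite sqrtr_gt0.
have sr : 0 < Num.sqrt rho by rewrite sqrtr_gt0.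
have qq : Num.sqrt rho * Num.sqrt rho = rho by rewrite -expr2 sqr_sqrtr // ltW.
have s3 := sqrt_cube (ltW r0).
have r3 : 0 < rho ^+ 3 by rewrite exprn_gt0.
have l0 : 0 < kappa * rho ^+ 3 by rewrite mulr_gt0.
have l1 : kappa * rho ^+ 3 <= 1.
  have r31 : rho ^+ 3 <= 1 by rewrite exprn_ile1 // ltW.
  by apply: mulr_ile1 => //; exact: ltW.
have e : Num.sqrt (kappa * rho ^+ 3) = Num.sqrt kappa * (rho * Num.sqrt rho).
  by rewrite sqrtrM ?s3 // ltW.
apply: sum_last.
  rewrite !addr_ge0 ?divr_ge0 ?mulr_ge0 ?ler0n ?exprn_ge0 //; exact: ltW.
move=> ab.
have pb n : (n < b.-1)%N -> (n.+1 < b)%N by clear; lia.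
apply: le_trans (sawtooth_block hc ab l0 l1 r0 r1 V0 _ _) _.
- move=> n an nb; apply: le_trans (z_second_diff an (pb _ nb)).
  by rewrite mulrC ler_pM2r.
- by move=> n k an nk kb; apply: z_first_diff => //; exact: pb.
have h : (b.-1 - a)%:R * rho <= (b - a)%:R * rho.
  by rewrite ler_wpM2r ?(ltW r0) // ler_nat; move: ab; clear; lia.
rewrite e.
have -> : 54 * (2 * A * B * eta) / (Num.sqrt kappa * (rho * Num.sqrt rho) * Num.sqrt rho)
   = 108 * A * B * eta / (Num.sqrt kappa * rho ^+ 2).
  have -> : Num.sqrt kappa * (rho * Num.sqrt rho) * Num.sqrt rho = Num.sqrt kappa * rho ^+ 2.
    by rewrite -!mulrA qq.
  by congr (_ / _); ring.
by rewrite !lerD2r.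
Qed.

End hypotheses.
End arc.

(** * Counting lattice points by columns and by rows *)

Section counting.

Lemma sum_leq_indicator (m a k : nat) :
  (\sum_(a.+1 <= j < a.+1 + k) (j <= m) = minn (m - a) k)%N.
Proof.
elim: k => [|k IH]; first by rewrite addn0 big_geq // minn0.
rewrite addnS big_nat_recr ?leq_addr //= IH.
by case: (leqP (a.+1 + k) m) => h /=; lia.
Qed.

(** Columns beyond M have height at most K, so the points they contain are counted
    by the parts beyond M of the first K rows. *)
Lemma dual_tail_sum (n m : nat -> nat) (M K J : nat) :
  (forall j k, (0 < j)%N -> (0 < k)%N -> (k <= n j)%N = (j <= m k)%N) ->
  (forall j, (M < j)%N -> (n j <= K)%N) ->
  (forall k, (0 < k)%N -> (m k <= J)%N) -> (M <= J)%N ->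
  (\sum_(M.+1 <= j < J.+1) n j = \sum_(1 <= k < K.+1) (m k - M))%N.
Proof.
move=> dual hK hJ MJ.
transitivity (\sum_(M.+1 <= j < J.+1) \sum_(1 <= k < K.+1) (k <= n j))%N.
  apply: eq_big_nat => j /andP[Mj _].
  by have := sum_leq_indicator (n j) 0 K; rewrite add1n subn0 => ->; have := hK j Mj; lia.
rewrite exchange_big /=; apply: eq_big_nat => k /andP[k0 _].
transitivity (\sum_(M.+1 <= j < J.+1) (j <= m k))%N.
  by apply: eq_big_nat => j /andP[Mj _]; rewrite dual //; lia.
have -> : J.+1 = (M.+1 + (J - M))%N by lia.
by rewrite sum_leq_indicator; have := hJ k k0; lia.
Qed.

Local Open Scope fset_scope.

Lemma card_under_graph (n : nat -> nat) (J : nat) (S : set (nat * nat)) :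
  (forall jk, S jk <-> [/\ (0 < jk.1)%N, (0 < jk.2)%N & (jk.2 <= n jk.1)%N]) ->
  (forall j, (J < j)%N -> n j = 0%N) ->
  #|` fset_set S| = (\sum_(1 <= j < J.+1) n j)%N.
Proof.
move=> hS hJ.
pose s := [seq (j, k) | j <- iota 1 J, k <- iota 1 (n j)].
have us : uniq s.
  apply: allpairs_uniq_dep => [||[a b] [a' b'] _ _ /= [-> ->]] //.
    exact: iota_uniq.
  by move=> j _; exact: iota_uniq.
have -> : S = [set` [fset x in s]].
  apply/seteqP; split=> -[j k] /=; rewrite !inE.
    move=> /hS /= [j0 k0 kn]; apply/allpairsPdep; exists j, k; split=> //.
      rewrite mem_iota j0 /= add1n ltnS leqNgt; apply/negP => /hJ nj0.
      by move: kn; rewrite nj0; lia.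
    by rewrite mem_iota k0 add1n ltnS.
  move=> /allpairsPdep[j' [k' [+ + [-> ->]]]]; rewrite !mem_iota => h1 h2.
  by apply/hS; split=> /=; lia.
rewrite set_fsetK card_fseq undup_id // size_allpairs_dep sumnE big_map.
rewrite /index_iota subn1 /=; apply: eq_bigr => j _; exact: size_iota.
Qed.

End counting.

(** * The curve and its primitive *)

Section curve.
Context {R : realType}.
Implicit Types (L x y : R) (f g : R -> R).

(** The curve prolonged by the constants L to the left and 0 to the right.  This
    makes it a continuous function on the line and turns the constraint x <= L
    of the lattice count into positivity of the height. *)
Definition clampf L f x : R := f (Num.min L (Num.max 0 x)).

Lemma decreasing_curve_sym L f g : decreasing_curve L f g -> decreasing_curve L g f.
Proof.
move=> [[f1 f2 f3] fdec gfun fg gf].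
have gin x : x \in `[0, L]%R -> g x \in `[0, L]%R by move=> h; exact: gfun.
have fin x : x \in `[0, L]%R -> f x \in `[0, L]%R by move=> h; exact: f1.
split=> //.
- split=> //.
  + by move=> x y; rewrite !inE /= => hx hy e; rewrite -(gf x hx) -(gf y hy) e.
  + by move=> x hx; exists (f x); [exact: fin|exact: fg].
- move=> x y hx hy xy; rewrite ltNge; apply/negP; rewrite le_eqVlt => /orP[/eqP e|h].
    by move: xy; rewrite -(gf x hx) -(gf y hy) e ltxx.
  have : f (g x) < f (g y) by apply: fdec h; exact: gin.
  by rewrite !gf // => /(lt_trans xy); rewrite ltxx.
Qed.

Section fixed_curve.
Variables (L : R) (f g : R -> R).
Hypotheses (L0 : 0 < L) (hc : decreasing_curve L f g).

Let gin x : 0 <= x <= L -> 0 <= g x <= L.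
Proof.
case: hc => _ _ gfun _ _ h.
by have := gfun x; rewrite /= !in_itv /=; apply.
Qed.

Let fin x : 0 <= x <= L -> 0 <= f x <= L.
Proof.
case: hc => -[f1 _ _] _ _ _ _ h.
by have := f1 x; rewrite /= !in_itv /=; apply.
Qed.

Let fg x : 0 <= x <= L -> g (f x) = x.
Proof. by case: hc => _ _ _ h _ hx; apply: h; rewrite in_itv. Qed.

Let gf x : 0 <= x <= L -> f (g x) = x.
Proof. by case: hc => _ _ _ _ h hx; apply: h; rewrite in_itv. Qed.

Let fdec x y : 0 <= x -> x < y -> y <= L -> f y < f x.
Proof.
case: hc => _ h _ _ _ x0 xy yL.
by apply: h => //; rewrite in_itv /=; apply/andP; split; lra.
Qed.

Local Notation phi := (clampf L f).

Let clamp_in x : 0 <= Num.min L (Num.max 0 x) <= L.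
Proof.
rewrite le_min ge_min lexx /= andbT (ltW L0) /= le_max lexx //.
Qed.

Lemma clampf_id x : 0 <= x <= L -> phi x = f x.
Proof.
by move=> /andP[x0 xL]; rewrite /clampf (max_idPr x0) (min_idPr xL).
Qed.

Lemma clampf_range x : 0 <= phi x <= L.
Proof. exact: fin (clamp_in x). Qed.

Lemma curve_at0 : f 0 = L.
Proof.
have h0 : 0 <= (0 : R) <= L by rewrite lexx ltW.
have hL : 0 <= L <= L by rewrite lexx ltW.
have /andP[g0 g1] := gin hL.
have [e|ne] := eqVneq (g L) 0; first by rewrite -e gf.
have : 0 < g L by rewrite lt_neqAle eq_sym ne.
move=> /(fdec (lexx 0)) /(_ g1); rewrite gf // => h.
have /andP[_] := fin h0; lra.
Qed.

Lemma curve_atL : f L = 0.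
Proof.
have h0 : 0 <= (0 : R) <= L by rewrite lexx ltW.
have hL : 0 <= L <= L by rewrite lexx ltW.
have /andP[g0 g1] := gin h0.
have [e|ne] := eqVneq (g 0) L; first by rewrite -e gf.
have : g 0 < L by rewrite lt_neqAle ne.
move=> /(fdec g0) /(_ (lexx _)); rewrite gf // => h.
have /andP[] := fin hL; lra.
Qed.

Lemma clampf_le0 x : x <= 0 -> phi x = L.
Proof.
by move=> x0; rewrite /clampf (max_idPl x0) (min_idPr (ltW L0)) curve_at0.
Qed.

Lemma clampf_geL x : L <= x -> phi x = 0.
Proof.
move=> xL; have x0 : 0 <= x by rewrite (le_trans (ltW L0)).
by rewrite /clampf (max_idPr x0) (min_idPl xL) curve_atL.
Qed.

Lemma clampf_nonincr x y : x <= y -> phi y <= phi x.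
Proof.
move=> xy; have [x0|x0] := leP x 0.
  by rewrite (clampf_le0 x0); have /andP[] := clampf_range y.
have [yL|yL] := leP L y.
  by rewrite (clampf_geL yL); have /andP[] := clampf_range x.
rewrite !clampf_id; [|lra|lra].
have [->//|ne] := eqVneq x y.
apply/ltW/fdec; [exact: ltW| |exact: ltW].
by rewrite lt_neqAle ne.
Qed.

Lemma clampf_decr x y : 0 <= x -> x < y -> y <= L -> phi y < phi x.
Proof. by move=> x0 xy yL; rewrite !clampf_id; [exact: fdec|lra|lra]. Qed.

Lemma clampf_gt0 x : x < L -> 0 < phi x.
Proof.
move=> xL; have [x0|x0] := leP x 0; first by rewrite clampf_le0.
by rewrite -(clampf_geL (lexx L)); apply: clampf_decr => //; exact: ltW.
Qed.

(** Lying under the graph of f is lying under the graph of g; the points must be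
    off the axes, where the prolonged curves are not inverse to each other. *)
Lemma clampf_dual x y : 0 < x -> 0 < y -> (y <= phi x) = (x <= clampf L g y).
Proof.
have dir h k u v : (forall z, 0 <= z <= L -> 0 <= h z <= L) ->
    (forall z, 0 <= z <= L -> k (h z) = z) -> h L = 0 ->
    (forall z w, 0 <= z -> z < w -> w <= L -> k w < k z) ->
    0 < u -> 0 < v -> v <= clampf L h u -> u <= clampf L k v.
  move=> hin kh hL kd u0 v0 vh.
  have uL : u < L.
    rewrite ltNge; apply/negP => Lu; move: vh.
    by rewrite /clampf (max_idPr (ltW u0)) (min_idPl Lu) hL; lra.
  have e : Num.min L (Num.max 0 u) = u.
    by rewrite (max_idPr (ltW u0)) (min_idPr (ltW uL)).
  rewrite /clampf e in vh.
  have uu : 0 <= u <= L by rewrite !ltW.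
  have /andP[_ huL] := hin u uu.
  have vL := le_trans vh huL.
  rewrite /clampf (max_idPr (ltW v0)) (min_idPr vL).
  rewrite -[leLHS](kh u uu); have [->//|ne] := eqVneq v (h u).
  apply/ltW/kd => //; first exact: ltW.
  by rewrite lt_neqAle ne.
have hsym := decreasing_curve_sym hc.
have gdec z w : 0 <= z -> z < w -> w <= L -> g w < g z.
  case: hsym => _ h _ _ _ x0 xy yL.
  by apply: h => //; rewrite in_itv /=; apply/andP; split; lra.
have gL : g L = 0 by rewrite -curve_at0 fg // lexx ltW.
move=> x0 y0; apply/idP/idP.
  by apply: (dir f g) => //; exact: curve_atL.
by apply: (dir g f).
Qed.

(** A monotone function onto an interval has no jump: the values phi x + e / 2 and
    phi x - e / 2 are attained, or lie outside the range. *)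
Lemma clampf_continuous : continuous phi.
Proof.
move=> x; apply/cvgrPdist_lt => e e0.
have [a ax ha] : exists2 a, a < x & forall t, a < t -> phi t < phi x + e.
  have [h|h] := ltP L (phi x + e).
    exists (x - 1); first by lra.
    by move=> t _; have /andP[_] := clampf_range t; lra.
  have /andP[p0 _] := clampf_range x.
  have hy : 0 <= phi x + e / 2 <= L by apply/andP; split; lra.
  have ey : phi (g (phi x + e / 2)) = phi x + e / 2.
    by rewrite clampf_id ?gf //; exact: gin.
  exists (g (phi x + e / 2)).
    rewrite ltNge; apply/negP => /clampf_nonincr; rewrite ey; lra.
  by move=> t /ltW /clampf_nonincr; rewrite ey; lra.
have [b xb hb] : exists2 b, x < b & forall t, t < b -> phi x - e < phi t.
  have [h|h] := ltP (phi x - e) 0.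
    exists (x + 1); first by lra.
    by move=> t _; have /andP[+ _] := clampf_range t; lra.
  have /andP[_ pL] := clampf_range x.
  have hy : 0 <= phi x - e / 2 <= L by apply/andP; split; lra.
  have ey : phi (g (phi x - e / 2)) = phi x - e / 2.
    by rewrite clampf_id ?gf //; exact: gin.
  exists (g (phi x - e / 2)).
    rewrite ltNge; apply/negP => /clampf_nonincr; rewrite ey; lra.
  by move=> t /ltW /clampf_nonincr; rewrite ey; lra.
have : \forall t \near x, t \in `]a, b[%R.
  by apply: near_in_itvoo; rewrite in_itv /= ax xb.
apply: filterS => t; rewrite in_itv /= => /andP[at_ tb].
have := ha t at_; have := hb t tb.
by rewrite ltr_norml => h1 h2; apply/andP; split; lra.
Qed.

End fixed_curve.

(** The base point -1 lies to the left of the range of integration, so the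
    primitive has a two-sided derivative at 0 as well. *)
Lemma continuous_primitive (phi : R -> R) : continuous phi ->
  exists F : R -> R, (forall x, -1 < x -> is_derive x 1 F (phi x)) /\
    forall a b, -1 < a -> a < b ->
      (\int[lebesgue_measure]_(x in `[a, b]) phi x)%R = F b - F a.
Proof.
move=> cphi.
pose F x : R := (\int[lebesgue_measure]_(t in [set` `[(-1), x]]) phi t)%R.
have int u : lebesgue_measure.-integrable `[(-1), u] (EFin \o phi).
  apply: continuous_compact_integrable; first exact: segment_compact.
  exact: continuous_subspaceT.
have dF x : -1 < x -> is_derive x 1 F (phi x).
  move=> x1; have xu : x < x + 1 by rewrite ltrDl.
  have [h1 h2] := continuous_FTC1_closed xu (int _) x1 (cphi x).
  apply: DeriveDef; first exact: h1.
  by rewrite -h2 derive1E.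
exists F; split=> // a b a1 ab.
have cF x : -1 < x -> {for x, continuous F}.
  by move=> x1; apply: differentiable_continuous; apply/derivable1_diffP; have [] := dF x x1.
have := @continuous_FTC2 R phi F a b ab.
rewrite /Rintegral => -> //.
- exact: continuous_subspaceT.
- split.
  + by move=> x; rewrite in_itv /= => /andP[ax _]; have [] := dF x (lt_trans a1 ax).
  + exact/cvg_at_right_filter/cF.
  + exact/cvg_at_left_filter/cF/(lt_trans a1).
- move=> x; rewrite in_itv /= => /andP[ax _].
  by rewrite derive1E; have [_ ->] := dF x (lt_trans a1 ax).
Qed.

End curve.

(** * Convexity and the midpoint rule *)

Section convexity.
Context {R : realType}.
Implicit Types (h phi F : R -> R) (u v x y z : R).

(** Convexity without quotients: the three-point inequality multiplied by z - x. *)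
Definition convex_on h u v : Prop := forall x y z,
  u <= x -> x <= y -> y <= z -> z <= v ->
  (z - x) * h y <= (z - y) * h x + (y - x) * h z.

Lemma convex_on_sub h u v u' v' : u <= u' -> v' <= v ->
  convex_on h u v -> convex_on h u' v'.
Proof.
move=> uu vv hc x y z ux xy yz zv.
by apply: hc => //; [exact: le_trans ux|exact: le_trans vv].
Qed.

Lemma convex_function_on (L : R) h :
  convex_function (`[0, L]%classic : set R^o) (h : R^o -> R^o) -> convex_on h 0 L.
Proof.
move=> hc x y z x0 xy yz zL.
have [e|ne] := eqVneq x z.
  by have -> : y = x; [lra|rewrite e; lra].
have xz : 0 < z - x by rewrite subr_gt0 lt_neqAle ne (le_trans xy).
pose t := (z - y) / (z - x).
have t0 : 0 <= t by rewrite divr_ge0 ?subr_ge0 // ltW // -subr_gt0.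
have t1 : t <= 1 by rewrite ler_pdivrMr // mul1r; lra.
have xin : x \in (`[0, L]%classic : set R^o) by rewrite inE /= in_itv /=; apply/andP; split; lra.
have zin : z \in (`[0, L]%classic : set R^o) by rewrite inE /= in_itv /=; apply/andP; split; lra.
have hy : h (t * x + (1 - t) * z) <= t * h x + (1 - t) * h z.
  exact: (hc (Itv01 t0 t1) x z xin zin).
have yE : t * x + (1 - t) * z = y by rewrite /t; field; rewrite gt_eqF.
rewrite yE -(ler_pM2l xz) in hy; apply: (le_trans hy).
by rewrite le_eqVlt; apply/orP; left; apply/eqP; rewrite /t; field; rewrite gt_eqF.
Qed.

Lemma convex_on_slope h u v x y d : convex_on h u v -> u <= x -> x <= y -> 0 <= d -> y + d <= v ->
  h (x + d) - h x <= h (y + d) - h y.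
Proof.
move=> hc ux xy d0 yv.
have [e|ne] := eqVneq x y; first by rewrite e.
have xy' : 0 < y - x by rewrite subr_gt0 lt_neqAle ne.
have w0 : 0 < y + d - x by lra.
have h1 := hc x (x + d) (y + d) ltac:(lra) ltac:(lra) ltac:(lra) yv.
have h2 := hc x y (y + d) ltac:(lra) ltac:(lra) ltac:(lra) yv.
rewrite -(ler_pM2l w0); lra.
Qed.

(** The symmetric second difference of a convex function grows with the step. *)
Lemma convex_on_sym h u v x t w : convex_on h u v -> 0 <= t -> t <= w ->
  u <= x - w -> x + w <= v ->
  0 <= h (x + t) + h (x - t) - 2 * h x <= h (x + w) + h (x - w) - 2 * h x.
Proof.
move=> hc t0 tw uw wv.
have h0 := hc (x - t) x (x + t) ltac:(lra) ltac:(lra) ltac:(lra) ltac:(lra).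
have h1 := @convex_on_slope h u v (x - w) (x + t) (w - t) hc uw ltac:(lra) ltac:(lra) ltac:(lra).
rewrite (_ : x - w + (w - t) = x - t) in h1; last by ring.
rewrite (_ : x + t + (w - t) = x + w) in h1; last by ring.
apply/andP; split; last by lra.
have [->|ne] := eqVneq t 0; first by rewrite subr0 addr0; lra.
have tp : 0 < t by rewrite lt_neqAle eq_sym ne.
rewrite -(ler_pM2l tp); lra.
Qed.

Definition lipschitz_on phi (B : R) u v : Prop :=
  forall x y, u <= x -> x <= y -> y <= v -> `|phi y - phi x| <= B * (y - x).

Lemma lipschitz_on_sub phi B u v u' v' : u <= u' -> v' <= v ->
  lipschitz_on phi B u v -> lipschitz_on phi B u' v'.
Proof.
move=> uu vv hB x y ux xy yv.
by apply: hB => //; [exact: le_trans ux|exact: le_trans vv].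
Qed.

Section primitive.
Variables (phi F : R -> R).
Hypothesis dF : forall x, -1 < x -> is_derive x 1 F (phi x).

Lemma primitive_mvt x y : -1 < x -> x <= y ->
  exists2 t, x <= t <= y & F y - F x = phi t * (y - x).
Proof.
move=> x1 xy.
have [e|ne] := eqVneq x y.
  by exists x; [rewrite lexx|rewrite e !subrr mulr0].
have xy' : x < y by rewrite lt_neqAle ne.
have hd' t : t \in `]x, y[%R -> is_derive t 1 F (phi t).
  by rewrite in_itv /= => /andP[xt _]; apply/dF/(lt_trans x1).
have [|t] := @MVT R F phi x y xy' hd'.
  apply: derivable_within_continuous => t; rewrite in_itv /= => /andP[xt _].
  by have [] := dF (lt_le_trans x1 xt).
by rewrite in_itv /= => /andP[t1 t2] e; exists t; rewrite ?ltW.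
Qed.

Lemma primitive_taylor B u v x y : lipschitz_on phi B u v -> 0 <= B -> -1 < u ->
  u <= x -> x <= v -> u <= y -> y <= v ->
  `|F y - F x - (y - x) * phi x| <= B * (y - x) ^+ 2.
Proof.
move=> hB B0 u1 ux xv uy yv.
have [xy|yx] := leP x y.
  have [t /andP[t1 t2] ->] := primitive_mvt (lt_le_trans u1 ux) xy.
  rewrite (_ : _ - _ = (phi t - phi x) * (y - x)); last by ring.
  rewrite normrM (ger0_norm (_ : 0 <= y - x)) ?subr_ge0 // expr2 mulrA.
  apply: ler_wpM2r; first by rewrite subr_ge0.
  apply: (le_trans (hB x t ux t1 (le_trans t2 yv))).
  by apply: ler_wpM2l => //; lra.
have [t /andP[t1 t2] e] := primitive_mvt (lt_le_trans u1 uy) (ltW yx).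
have -> : F y - F x - (y - x) * phi x = (phi x - phi t) * (x - y).
  have -> : F y = F x - phi t * (x - y) by rewrite -e; ring.
  by ring.
rewrite normrM (ger0_norm (_ : 0 <= x - y)); last by lra.
rewrite (_ : B * (y - x) ^+ 2 = B * (x - y) * (x - y)); last by ring.
apply: ler_wpM2r; first by lra.
apply: (le_trans (hB t x (le_trans uy t1) t2 xv)).
by apply: ler_wpM2l => //; lra.
Qed.

(** The error of the midpoint rule on one cell, as a function of the half width,
    has the symmetric second difference of phi as its derivative. *)
Lemma midpoint_cell x w lo hi : 0 < w -> -1 < x - w ->
  (forall t, 0 <= t -> t <= w -> lo <= phi (x + t) + phi (x - t) - 2 * phi x <= hi) ->
  w * lo <= F (x + w) - F (x - w) - 2 * w * phi x <= w * hi.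
Proof.
move=> w0 x1 hV.
pose G t := F (t + x) - F (x - t) - 2 * t * phi x.
have dG t : -w <= t <= w -> is_derive t 1 G (phi (x + t) + phi (x - t) - 2 * phi x).
  move=> tw.
  have h1 : is_derive t 1 (fun t => F (t + x)) (phi (x + t)).
    have hs : is_derive t 1 (fun t : R => t + x) 1 by apply: is_derive_eq; rewrite addr0.
    have hF : is_derive (t + x) 1 F (phi (x + t)) by rewrite addrC; apply: dF; lra.
    by have := @is_derive1_comp R F (fun t => t + x) t (phi (x + t)) 1 hF hs; rewrite mulr1.
  have h2 : is_derive t 1 (fun t => F (x - t)) (- phi (x - t)).
    have hs : is_derive t 1 (fun t : R => x - t) (-1) by apply: is_derive_eq; rewrite add0r mul1r.
    have hF : is_derive (x - t) 1 F (phi (x - t)) by apply: dF; lra.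
    by have := @is_derive1_comp R F (fun t => x - t) t (phi (x - t)) (-1) hF hs; rewrite mulrN1.
  have h3 : is_derive t 1 (fun t : R => 2 * t * phi x) (2 * phi x).
    apply: is_derive_eq; rewrite scaler0 add0r -[_ *: _]/(phi x * (2 * 1)).
    by ring.
  have := is_deriveB (is_deriveB h1 h2) h3; rewrite opprK; exact.
have hd' t : t \in `]0, w[%R -> is_derive t 1 G (phi (x + t) + phi (x - t) - 2 * phi x).
  by rewrite in_itv /= => /andP[t0 tw]; apply: dG; apply/andP; split; lra.
have [|t] := @MVT R G _ 0 w w0 hd'.
  apply: derivable_within_continuous => t; rewrite in_itv /= => /andP[t0 tw].
  by have [] := dG t ltac:(lra).
rewrite in_itv /= => /andP[t0 tw].
have -> : F (x + w) - F (x - w) - 2 * w * phi x = G w - G 0.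
  by rewrite /G add0r !subr0 [w + x]addrC; ring.
move=> ->; rewrite subr0 ![w * _]mulrC !ler_pM2r //.
by apply: hV; exact: ltW.
Qed.

(** The error on a cell is at most the half width times the growth of the
    increments D' to D across that cell.  By convexity the increments keep
    growing from one cell to the next, so the errors telescope and the total is
    bounded by the extreme increments: an error of order eta^2 whatever the
    number of cells. *)
Lemma midpoint_sum c B u v (sigma eta : R) (a b : nat) : (c = 1 \/ c = -1) ->
  convex_on (fun x => c * phi x) u v -> lipschitz_on phi B u v -> 0 <= B ->
  -1 < u -> 0 < eta -> (a <= b)%N ->
  u <= (a%:R - 2^-1 + sigma) * eta -> (b%:R - 2^-1 + sigma) * eta <= v ->
  `|eta * \sum_(a <= j < b) phi ((j%:R + sigma) * eta)
    - (F ((b%:R - 2^-1 + sigma) * eta) - F ((a%:R - 2^-1 + sigma) * eta))| <= B * eta ^+ 2.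
Proof.
move=> hc hconv hB B0 u1 e0 ab ua bv.
pose w := eta / 2; have w0 : 0 < w by rewrite divr_gt0.
pose X (j : nat) := (j%:R + sigma) * eta.
have Xm j : X j - w = (j%:R - 2^-1 + sigma) * eta by rewrite /X /w; field.
have Xp j : X j + w = (j.+1%:R - 2^-1 + sigma) * eta by rewrite /X /w -natr1; field.
rewrite -!Xm; rewrite -!Xm in ua bv.
pose D j := c * (phi (X j + w) - phi (X j)).
pose D' j := c * (phi (X j) - phi (X j - w)).
have XS j : X j.+1 = X j + eta by rewrite /X -natr1; ring.
have mX i j : (i <= j)%N -> X i <= X j.
  by move=> ij; rewrite /X ler_pM2r // lerD2r ler_nat.
have cn (t : R) : `|c * t| = `|t| by case: hc => ->; rewrite ?mul1r ?mulN1r ?normrN.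
have cell j : (a <= j)%N -> (j < b)%N ->
    `|eta * phi (X j) - (F (X j + w) - F (X j - w))| <= w * (D j - D' j).
  move=> aj jb; have h1 := mX _ _ aj; have h2 : X j + w <= X b - w.
    by rewrite Xp Xm ler_pM2r // lerD2r lerD2r ler_nat.
  rewrite distrC (_ : eta = 2 * w); last by rewrite /w; field.
  rewrite ler_norml -mulrN; apply: midpoint_cell => //; first by lra.
  have hu : u <= X j - w by lra.
  have hv : X j + w <= v by lra.
  move=> t t0 tw; have /andP[g1 g2] := convex_on_sym hconv t0 tw hu hv.
  by rewrite -ler_norml -cn ger0_norm; [rewrite /D /D'; lra|lra].
have tel k : (a + k <= b)%N -> `|eta * \sum_(a <= j < a + k) phi (X j)
    - (F (X (a + k)%N - w) - F (X a - w))| <= w * \sum_(a <= j < a + k) (D j - D' j).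
  elim: k => [|k IH] kb.
    by rewrite addn0 !big_geq // !mulr0 subrr subrr normr0.
  rewrite addnS !big_nat_recr ?leq_addr //= !mulrDr.
  have := cell (a + k)%N (leq_addr _ _) ltac:(lia).
  have := IH ltac:(lia).
  rewrite (_ : X (a + k).+1 - w = X (a + k)%N + w); last by rewrite Xm Xp.
  set S := \sum_(a <= j < a + k) phi (X j); set T := \sum_(a <= j < a + k) _.
  rewrite !ler_norml => /andP[? ?] /andP[? ?]; apply/andP; split; lra.
have sumD k : (a + k < b)%N -> \sum_(a <= j < (a + k).+1) (D j - D' j) <= D (a + k)%N - D' a.
  elim: k => [|k IH] kb; first by rewrite addn0 big_nat1.
  rewrite addnS big_nat_recr ?leqW ?leq_addr //=.
  have := IH ltac:(lia).
  have : D (a + k)%N <= D' (a + k).+1.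
    rewrite /D /D' !mulrBr XS.
    have h1 := mX _ _ (leq_addr k a).
    have h2 : X (a + k).+1 + w <= X b - w.
      by rewrite Xp Xm ler_pM2r // lerD2r lerD2r ler_nat; lia.
    rewrite XS in h2.
    have hw : eta = w + w by rewrite /w; field.
    have g1 : u <= X (a + k)%N by move: w0 ua h1; clear; lra.
    have g2 : X (a + k)%N <= X (a + k)%N + w by move: w0; clear; lra.
    have g3 : X (a + k)%N + w + w <= v by move: hw w0 bv h2; clear; lra.
    have := convex_on_slope hconv g1 g2 (ltW w0) g3.
    rewrite (_ : X (a + k)%N + eta - w = X (a + k)%N + w); last by rewrite /w; field.
    by rewrite (_ : X (a + k)%N + w + w = X (a + k)%N + eta) //; rewrite /w; field.
  lra.
move: (tel (b - a)%N); rewrite subnKC // => /(_ (leqnn _)) /le_trans; apply.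
have [->|ne] := eqVneq a b.
  by rewrite big_geq // mulr0 mulr_ge0 // exprn_ge0 // ltW.
have ab' : (a + (b - a).-1 < b)%N by move: ab ne; clear; lia.
have := sumD _ ab'.
have -> : (a + (b - a).-1).+1 = b by move: ab ne; clear; lia.
move=> hs; have h1 := mX _ _ (leq_addr (b - a).-1 a).
have h2 : X (a + (b - a).-1)%N + w <= X b - w.
  by rewrite Xp Xm ler_pM2r // lerD2r lerD2r ler_nat.
have : `|D (a + (b - a).-1)%N| <= B * w.
  rewrite cn; apply: le_trans (hB _ _ _ _ _) _; [lra|lra|lra|].
  by rewrite addrAC subrr add0r.
have : `|D' a| <= B * w.
  rewrite cn; apply: le_trans (hB _ _ _ _ _) _; [lra|lra|lra|].
  by rewrite opprB addrC subrK.
rewrite !ler_norml => /andP[? ?] /andP[? ?].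
apply: (@le_trans _ _ (w * (2 * (B * w)))).
  by rewrite ler_pM2l //; lra.
have -> : w * (2 * (B * w)) = B * eta ^+ 2 / 2 by rewrite /w; field.
have : 0 <= B * eta ^+ 2 by rewrite mulr_ge0 // exprn_ge0 // ltW.
lra.
Qed.

End primitive.

End convexity.

(** * Sawtooth sums over the columns between two abscissas *)

Section columns.
Context {R : realType}.
Implicit Types (x p q sigma eta r s : R).

(** The index of the last column with abscissa at most x; columns start at 1, and
    0 means that there is none. *)
Definition column_index sigma eta x : nat := Num.truncn (x / eta - sigma).

Lemma column_indexP sigma eta x (j : nat) : 0 < eta -> (0 < j)%N ->
  (j <= column_index sigma eta x)%N = ((j%:R + sigma) * eta <= x).
Proof.
move=> e0 j0; rewrite /column_index -ler_pdivlMr // -lerBrDr.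
have [u0|u0] := leP 0 (x / eta - sigma); first by rewrite truncn_ge_nat.
have -> : Num.truncn (x / eta - sigma) = 0%N.
  by apply/truncn0Pn; rewrite -ltNge (lt_trans u0).
rewrite leqNgt j0 /=; apply/esym/negbTE; rewrite -ltNge (lt_trans u0) // ltr0n.
by [].
Qed.

Lemma column_index_mono sigma eta x y : 0 < eta -> x <= y ->
  (column_index sigma eta x <= column_index sigma eta y)%N.
Proof. by move=> e0 xy; apply: le_truncn; rewrite lerD2r ler_pM2r ?invr_gt0. Qed.

Lemma column_count sigma eta p q : 0 < eta -> p <= q ->
  (column_index sigma eta q - column_index sigma eta p)%:R <= (q - p) / eta + 1.
Proof.
move=> e0 pq; set a := column_index _ _ p; set b := column_index _ _ q.
have qp0 : 0 <= (q - p) / eta by rewrite divr_ge0 ?subr_ge0 // ltW.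
have [ba|ab] := leqP b a.
  by move: ba; rewrite -subn_eq0 => /eqP ->; rewrite addr_ge0.
have hb : (b%:R + sigma) * eta <= q.
  by rewrite -column_indexP //; apply: leq_ltn_trans ab.
have ha : p < (a.+1%:R + sigma) * eta.
  by rewrite ltNge -column_indexP // ltnn.
rewrite natrB ?(ltnW ab) // -lerBlDr ler_pdivlMr //.
move: hb ha; rewrite -(natr1 a); nra.
Qed.

(** The window r^(-1/3) balances b - a ~ r columns against the slope terms. *)
Lemma cube_root_inv r : 1 <= r -> exists rho, [/\ 0 < rho, rho <= 1,
  r * rho = r `^ (2 / 3), (rho ^+ 2)^-1 = r `^ (2 / 3) & rho ^+ 3 = r^-1].
Proof.
move=> r1; have r0 : 0 < r by lra.
have rn0 : r != 0 by rewrite gt_eqF.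
exists (r `^ (- 3^-1)); split.
- exact: powR_gt0.
- by rewrite -[leRHS](powRr0 r); apply: ler_powR => //; lra.
- have -> : 2 / 3 = 1 + - 3^-1 :> R by lra.
  by rewrite powRD ?rn0 ?implybT // powRr1 // ltW.
- have -> : 2 / 3 = - (- 3^-1 * 2%:R) :> R by lra.
  by rewrite [RHS]powRN powRrM powR_mulrn ?powR_ge0.
- rewrite -powR_mulrn ?powR_ge0 // -powRrM -[RHS]powR_inv1 ?(ltW r0) //.
  by have -> : - 3^-1 * 3 = -1 :> R by lra.
Qed.

Lemma powR23_ge1 r : 1 <= r -> 1 <= r `^ (2 / 3).
Proof. by move=> r1; rewrite -[leLHS](powRr0 r); apply: ler_powR => //; lra. Qed.

Lemma column_bound r s p q c1 L sigma : 0 < c1 -> c1 <= s -> 1 <= r ->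
  p <= q -> q - p <= L ->
  (column_index sigma (s / r) q - column_index sigma (s / r) p)%:R <= (L / c1 + 1) * r.
Proof.
move=> c0 cs r1 pq pqL; have r0 : 0 < r by lra.
have s0 : 0 < s by exact: lt_le_trans cs.
have e0 : 0 < s / r by rewrite divr_gt0.
apply: (le_trans (column_count sigma e0 pq)).
rewrite [leRHS]mulrDl mul1r; apply: lerD => //.
rewrite invf_div mulrA mulrAC ler_pM2r //.
apply: ler_pM; [by rewrite subr_ge0|by rewrite invr_ge0 ltW|by []|].
by rewrite lef_pV2.
Qed.

Section pieces.
Variables (phi : R -> R) (c c1 c2 B L sigma tau : R).
Hypothesis cphi : continuous phi.
Hypothesis hc : c = 1 \/ c = -1.
Hypotheses (c10 : 0 < c1) (B0 : 0 <= B) (L0 : 0 <= L).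

(** The oscillating part of the number of points in the columns with abscissas
    between p and q. *)
Definition colsum r s p q : R :=
  \sum_((column_index sigma (s / r) p).+1 <= j < (column_index sigma (s / r) q).+1)
    sawtooth (r * s * phi ((j%:R + sigma) * (s / r)) - tau).

(** Used next to the singular point of the curve, over a length decreasing with
    r. *)
Lemma colsum_trivial r s p q : 0 < r -> c1 <= s -> p <= q ->
  `|colsum r s p q| <= (q - p) * r / c1 + 1.
Proof.
move=> r0 cs pq; have s0 : 0 < s by exact: lt_le_trans cs.
have e0 : 0 < s / r by rewrite divr_gt0.
apply: (le_trans (norm_sum_sawtooth _ _ _)); rewrite subSS.
apply: (le_trans (column_count sigma e0 pq)).
rewrite lerD2r invf_div mulrA; apply: ler_pM; [by rewrite mulr_ge0 ?subr_ge0 ?(ltW r0)|by rewrite invr_ge0 ltW|by []|].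
by rewrite lef_pV2.
Qed.

Lemma colsum_cat r s p q t : 0 < r -> 0 < s -> p <= q -> q <= t ->
  colsum r s p t = colsum r s p q + colsum r s q t.
Proof.
move=> r0 s0 pq qt; rewrite /colsum (big_cat_nat (n := (column_index sigma (s / r) q).+1)) //=;
  by rewrite ltnS; apply: column_index_mono => //; rewrite divr_gt0.
Qed.

Let piece_points r s p q : 0 < s / r ->
  forall j, ((column_index sigma (s / r) p).+1 <= j)%N ->
    (j < (column_index sigma (s / r) q).+1)%N -> p <= (j%:R + sigma) * (s / r) <= q.
Proof.
move=> e0 j jp jq; have j0 : (0 < j)%N by apply: leq_ltn_trans jp.
rewrite ltnS column_indexP // in jq; rewrite jq andbT.
by rewrite ltnNge column_indexP // -ltNge in jp; exact: ltW.
Qed.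

(** The constant is uniform in p, q, kappa, because the arc and the lower bound
    kappa of its second derivative are going to depend on r. *)
Lemma colsum_monotone : 0 < c2 -> exists2 C, 0 < C & forall r s p q kappa (df ddf : R -> R),
  1 <= r -> c1 <= s <= c2 -> p <= q -> q - p <= L -> 0 < kappa ->
  (forall y, p < y < q -> is_derive y 1 phi (df y)) ->
  (forall y, p < y < q -> is_derive y 1 df (ddf y)) ->
  (forall y, p < y < q -> kappa <= c * ddf y) ->
  lipschitz_on phi B p q ->
  monotonic_on `]p, q[%classic ddf ->
  `|colsum r s p q| <= C * (r `^ (2 / 3) + Num.sqrt (r / kappa)).
Proof.
move=> c20.
pose C := 1 + 500 * ((L / c1 + 1) + 2 * c2 ^+ 2 * B + (Num.sqrt (c1 ^+ 3))^-1 + 1).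
have sc : 0 < Num.sqrt (c1 ^+ 3) by rewrite sqrtr_gt0 exprn_gt0.
have Lc : 0 <= L / c1 by rewrite divr_ge0 // ltW.
have cB : 0 <= 2 * c2 ^+ 2 * B by rewrite !mulr_ge0 // ?exprn_ge0 // ltW.
have sci : 0 < (Num.sqrt (c1 ^+ 3))^-1 by rewrite invr_gt0.
exists C; first by rewrite /C; lra.
move=> r s p q kappa df ddf r1 /andP[cs sc2] pq pqL k0 hd hdd hk hB hm.
have r0 : 0 < r by lra.
have s0 : 0 < s by exact: lt_le_trans cs.
have e0 : 0 < s / r by rewrite divr_gt0.
have A0 : 0 < r * s by rewrite mulr_gt0.
have [rho [rho0 rho1 rho_r rho_2 rho_3]] := cube_root_inv r1.
have T1 := powR23_ge1 r1; set T := r `^ (2 / 3) in rho_r rho_2 T1 *.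
have hm' : {in `]p, q[ &, {homo ddf : x y / x <= y}} \/
  {in `]p, q[ &, {homo ddf : x y /~ x <= y}}.
  by case: hm => h; [left|right] => x y hx hy; apply: h; rewrite inE.
have := @sawtooth_arc_monotone R phi df ddf p q c kappa B (r * s) (s / r) sigma tau
  _ _ cphi hd hdd hc k0 hk hB A0 e0 (piece_points e0) rho B0 hm' rho0 rho1.
move/le_trans; apply.
have hN := @column_bound r s p q c1 L sigma c10 cs r1 pq pqL.
rewrite subSS; set N : R := (_ - _)%:R in hN *.
have q0 : 0 < Num.sqrt rho by rewrite sqrtr_gt0.
have t1 : N * rho <= (L / c1 + 1) * T.
  by rewrite -rho_r mulrA ler_pM2r.
have t2 : 2 * (r * s) * B * (s / r) / rho ^+ 2 <= 2 * c2 ^+ 2 * B * T.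
  rewrite rho_2; apply: ler_wpM2r; first lra.
  have -> : 2 * (r * s) * B * (s / r) = 2 * s ^+ 2 * B by field; rewrite gt_eqF.
  by apply: ler_wpM2r => //; rewrite ler_pM2l // ler_pXn2r ?nnegrE ?(ltW s0) ?(ltW c20).
have t3 : (Num.sqrt (r * s * (s / r) ^+ 2 * kappa))^-1 <=
    (Num.sqrt (c1 ^+ 3))^-1 * Num.sqrt (r / kappa).
  have -> : r * s * (s / r) ^+ 2 * kappa = s ^+ 3 * (r / kappa)^-1.
    by field; rewrite !gt_eqF.
  have rk : 0 < Num.sqrt (r / kappa) by rewrite sqrtr_gt0 divr_gt0.
  rewrite sqrtrM ?exprn_ge0 ?(ltW s0) // sqrtrV ?divr_ge0 ?(ltW r0) ?(ltW k0) //.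
  rewrite invfM invrK ler_pM2r // lef_pV2 ?posrE //; last first.
    by rewrite sqrtr_gt0 exprn_gt0.
  by apply: ler_wsqrtr; rewrite ler_pXn2r ?nnegrE ?(ltW s0) ?(ltW c10).
have t4 : (rho * Num.sqrt rho)^-1 <= T.
  rewrite -rho_2 lef_pV2 ?posrE ?mulr_gt0 ?exprn_gt0 // expr2 ler_pM2l //.
  rewrite -[leLHS](sqr_sqrtr (ltW rho0)) expr2 -[leRHS]mulr1 ler_pM2l //.
  by rewrite -sqrtr1 ler_wsqrtr.
have rk : 0 <= Num.sqrt (r / kappa) by exact: sqrtr_ge0.
rewrite /C; move: t1 t2 t3 t4 T1 rk.
set t1 := N * rho; set t2 := _ / rho ^+ 2; set t3 := (Num.sqrt (_ * kappa))^-1.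
set t4 := (rho * _)^-1; set Q := Num.sqrt (r / kappa).
set U := L / c1 + 1 in Lc *; set V := 2 * c2 ^+ 2 * B in cB *; set W := (Num.sqrt (c1 ^+ 3))^-1 in sci *.
have U0 : 0 <= U by rewrite /U; lra.
move=> t1h t2h t3h t4h T1 Q0.
apply: (@le_trans _ _ (T + 500 * (U * T + V * T + W * Q + T))); first by lra.
have : 0 <= U * Q by rewrite mulr_ge0.
have : 0 <= V * Q by rewrite mulr_ge0.
have : 0 <= W * T by rewrite mulr_ge0 ?(ltW sci) //; lra.
lra.
Qed.

(** For an arc that does not change with r; the constant may depend on kappa. *)
Lemma colsum_bounded p q kappa (df ddf : R -> R) : 0 < c2 ->
  p <= q -> q - p <= L -> 0 < kappa ->
  (forall y, p < y < q -> is_derive y 1 phi (df y)) ->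
  (forall y, p < y < q -> is_derive y 1 df (ddf y)) ->
  (forall y, p < y < q -> kappa <= c * ddf y) ->
  lipschitz_on phi B p q ->
  exists2 C, 0 < C & forall r s, 1 <= r -> c1 <= s <= c2 ->
    `|colsum r s p q| <= C * r `^ (2 / 3).
Proof.
move=> c20 pq pqL k0 hd hdd hk hB.
pose k := Num.min 1 kappa; pose c0 := Num.min 1 c1.
have kp : 0 < k by rewrite lt_min ltr01.
have k1 : k <= 1 by rewrite ge_min lexx.
have c0p : 0 < c0 by rewrite lt_min ltr01.
have c01 : c0 <= 1 by rewrite ge_min lexx.
have c0c1 : c0 <= c1 by rewrite ge_min lexx orbT.
have sk : 0 < Num.sqrt k by rewrite sqrtr_gt0.
pose C := 1 + ((L / c1 + 1) + 108 * c2 ^+ 2 * B / (Num.sqrt k * c0 ^+ 2)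
  + 81 / (Num.sqrt k * c0 ^+ 2)).
have Lc : 0 <= L / c1 by rewrite divr_ge0 // ltW.
have sc0 : 0 < Num.sqrt k * c0 ^+ 2 by rewrite mulr_gt0 // exprn_gt0.
have cB : 0 <= 108 * c2 ^+ 2 * B / (Num.sqrt k * c0 ^+ 2).
  by rewrite divr_ge0 ?(ltW sc0) // mulr_ge0 // mulr_ge0 ?ler0n // exprn_ge0 // ltW.
have c81 : 0 <= 81 / (Num.sqrt k * c0 ^+ 2) by rewrite divr_ge0 ?ler0n // ltW.
exists C; first by rewrite /C; lra.
move=> r s r1 /andP[cs sc2].
have r0 : 0 < r by lra.
have s0 : 0 < s by exact: lt_le_trans cs.
have e0 : 0 < s / r by rewrite divr_gt0.
have A0 : 0 < r * s by rewrite mulr_gt0.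
have [rho [rho0 rho1 rho_r rho_2 rho_3]] := cube_root_inv r1.
have T1 := powR23_ge1 r1; set T := r `^ (2 / 3) in rho_r rho_2 T1 *.
pose w := c0 * rho.
have w0 : 0 < w by rewrite mulr_gt0.
have w1 : w <= 1 by apply: mulr_ile1 => //; exact: ltW.
have hk' y : p < y < q -> k <= c * ddf y.
  by move=> hy; apply: le_trans (hk y hy); rewrite ge_min lexx orbT.
have w3 : w ^+ 3 <= r * s * (s / r) ^+ 2.
  have -> : r * s * (s / r) ^+ 2 = s ^+ 3 * r^-1 by field; rewrite gt_eqF.
  rewrite exprMn rho_3 ler_pM2r ?invr_gt0 // ler_pXn2r ?nnegrE ?(ltW s0) ?(ltW c0p) //.
  exact: le_trans cs.
have := @sawtooth_arc_bounded R phi df ddf p q c k B (r * s) (s / r) sigma tau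
  _ _ cphi hd hdd hc kp hk' hB A0 e0 (piece_points e0) w B0 w0 w1 k1 w3.
move/le_trans; apply.
have hN := @column_bound r s p q c1 L sigma c10 cs r1 pq pqL.
rewrite subSS; set N : R := (_ - _)%:R in hN *.
have N0 : 0 <= N by exact: ler0n.
have q0 : 0 < Num.sqrt w by rewrite sqrtr_gt0.
have t1 : N * w <= (L / c1 + 1) * T.
  rewrite -rho_r mulrA; apply: ler_pM => //; first exact: ltW.
  by rewrite /w ler_piMl // ltW.
have wi : (w ^+ 2)^-1 = (c0 ^+ 2)^-1 * T.
  by rewrite /w exprMn invfM rho_2.
have key Y : Y / (Num.sqrt k * w ^+ 2) = Y / (Num.sqrt k * c0 ^+ 2) * T.
  by rewrite [(Num.sqrt k * w ^+ 2)^-1]invfM wi [in RHS]invfM !mulrA.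
have t2 : 108 * (r * s) * B * (s / r) / (Num.sqrt k * w ^+ 2) <=
    108 * c2 ^+ 2 * B / (Num.sqrt k * c0 ^+ 2) * T.
  rewrite key; apply: ler_wpM2r; first lra.
  apply: ler_wpM2r; first by rewrite invr_ge0 ltW.
  have -> : 108 * (r * s) * B * (s / r) = 108 * s ^+ 2 * B by field; rewrite gt_eqF.
  apply: ler_wpM2r => //; rewrite ler_pM2l ?ltr0n //.
  by rewrite ler_pXn2r ?nnegrE ?(ltW s0) ?(ltW c20).
have t4 : 81 / (Num.sqrt k * (w * Num.sqrt w)) <= 81 / (Num.sqrt k * c0 ^+ 2) * T.
  rewrite -key ler_pM2l ?ltr0n // lef_pV2 ?posrE ?mulr_gt0 ?exprn_gt0 //.
  rewrite ler_pM2l // expr2 ler_pM2l //.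
  rewrite -[leLHS](sqr_sqrtr (ltW w0)) expr2 -[leRHS]mulr1 ler_pM2l //.
  by rewrite -sqrtr1 ler_wsqrtr.
rewrite /C [leRHS]mulrDl mul1r; apply: lerD => //.
by rewrite [leRHS]mulrDl [X in _ <= X + _]mulrDl; apply: lerD => //; apply: lerD.
Qed.

End pieces.
End columns.

(** * Orders of growth *)

Section asymptotics.
Context {R : realType}.
Implicit Types (r x y : R).

Lemma isO_infty (h k : R -> R) : isO +oo_R h k ->
  exists K R0 : R, 0 < K /\ forall r, R0 <= r -> `|h r| <= K * `|k r|.
Proof.
move=> /eqOP hO.
have [K K0 [M [_ hM]]] := pinfty_ex_gt0 hO.
exists K, (M + 1); split=> // r Mr; apply: hM.
by rewrite (lt_le_trans _ Mr) // ltrDl.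
Qed.

Lemma infty_isO (h k : R -> R) (K R0 : R) :
  (forall r, R0 <= r -> `|h r| <= K * `|k r|) -> isO +oo_R h k.
Proof.
move=> hK; apply/eqOP; exists K; split; first exact: num_real.
move=> K' KK'; exists R0; split; first exact: num_real.
move=> r Rr; apply: (le_trans (hK r (ltW Rr))).
by rewrite ler_wpM2r // ltW.
Qed.

Lemma isO_right (h k : R -> R) : isO 0^'+ h k ->
  exists K d : R, [/\ 0 < K, 0 < d & forall x, 0 < x -> x < d -> `|h x| <= K * `|k x|].
Proof.
move=> /eqOP hO.
have [K K0] := pinfty_ex_gt0 hO.
rewrite /= => /nbhs_ballP[d /= d0 hd].
exists K, d; split=> // x x0 xd; apply: hd => //.
by rewrite /ball /= sub0r normrN gtr0_norm.
Qed.

Lemma powR_small (a eps : R) : 0 < a -> 0 < eps ->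
  exists2 R0 : R, 1 <= R0 & forall r, R0 <= r -> r `^ (- a) <= eps.
Proof.
move=> a0 e0; pose q := (eps^-1) `^ (a^-1).
exists (Num.max 1 q); first by rewrite le_max lexx.
move=> r; rewrite ge_max => /andP[r1 qr].
have r0 : 0 < r by lra.
rewrite powRN -[leRHS]invrK lef_pV2 ?posrE ?powR_gt0 ?invr_gt0 //.
have -> : eps^-1 = q `^ a.
  by rewrite /q -powRrM mulVf ?gt_eqF // powRr1 // invr_ge0 ltW.
by apply: (ge0_ler_powR (ltW a0)) => //; rewrite nnegrE ?powR_ge0 ?(ltW r0).
Qed.

Lemma powR_mono r x y : 1 <= r -> x <= y -> r `^ x <= r `^ y.
Proof. by move=> r1 xy; apply: ler_powR. Qed.

Lemma powR_mulr r x : 0 < r -> r * r `^ x = r `^ (1 + x).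
Proof.
move=> r0; rewrite powRD ?powRr1 ?(ltW r0) //.
by rewrite (gt_eqF r0) implybT.
Qed.

Lemma sqrt_powR_mulr r (a K : R) : 0 < r -> 0 <= K ->
  Num.sqrt (r * (K * r `^ (1 - 4 * a))) = Num.sqrt K * r `^ (1 - 2 * a).
Proof.
move=> r0 K0; rewrite mulrCA powR_mulr // sqrtrM //; congr (_ * _).
have -> : 1 + (1 - 4 * a) = (1 - 2 * a) * 2%:R by ring.
by rewrite powRrM powR_mulrn ?powR_ge0 // sqrtr_sqr ger0_norm // powR_ge0.
Qed.

Lemma sqrt_le_powR r x : 1 <= r -> 2^-1 <= x -> Num.sqrt r <= r `^ x.
Proof. by move=> r1 x2; rewrite -powR12_sqrt; [exact: powR_mono|lra]. Qed.

Lemma sqrtD_le (x y : R) : 0 <= x -> 0 <= y -> Num.sqrt (x + y) <= Num.sqrt x + Num.sqrt y.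
Proof.
move=> x0 y0.
have sx := sqrtr_ge0 x; have sy := sqrtr_ge0 y.
rewrite -(ler_pXn2r (_ : (0 < 2)%N)) ?nnegrE ?sqrtr_ge0 ?addr_ge0 //.
rewrite sqr_sqrtr ?addr_ge0 // sqrrD !sqr_sqrtr //.
have : 0 <= Num.sqrt x * Num.sqrt y by rewrite mulr_ge0.
lra.
Qed.

(** The smallest value of the second derivative on a monotone arc is attained at
    an end: k1 at the fixed end, k2 at the end that moves with r.  The exponent
    1 - 4 a of 1 / k2 is chosen so that sqrt (r / k2) has order r^(1 - 2 a). *)
Lemma flat_kappa_bound (C k1 K a e : R) : 0 < C -> 0 < k1 -> 0 < K ->
  2 / 3 <= e -> 1 - 2 * a <= e ->
  exists2 C', 0 < C' & forall r k2, 1 <= r -> 0 < k2 -> k2^-1 <= K * r `^ (1 - 4 * a) ->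
    C * (r `^ (2 / 3) + Num.sqrt (r / Num.min k1 k2)) <= C' * r `^ e.
Proof.
move=> C0 k10 K0 e1 e2.
have s1 : 0 < Num.sqrt k1^-1 by rewrite sqrtr_gt0 invr_gt0.
have sK : 0 < Num.sqrt K by rewrite sqrtr_gt0.
exists (C * (1 + Num.sqrt k1^-1 + Num.sqrt K)); first by rewrite mulr_gt0 //; lra.
move=> r k2 r1 k20 hk2.
have r0 : 0 < r by lra.
rewrite -mulrA ler_pM2l //.
have h1 : r / Num.min k1 k2 <= r * k1^-1 + r / k2.
  rewrite -mulrDr ler_pM2l //.
  have p1 : 0 < k1^-1 by rewrite invr_gt0.
  have p2 : 0 < k2^-1 by rewrite invr_gt0.
  by rewrite /Num.min; case: ifP => _; lra.
have h2 : Num.sqrt (r / Num.min k1 k2) <= Num.sqrt (r * k1^-1) + Num.sqrt (r / k2).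
  apply: (le_trans (ler_wsqrtr h1)); apply: sqrtD_le.
    by rewrite mulr_ge0 ?invr_ge0 ?(ltW r0) ?(ltW k10).
  by rewrite divr_ge0 ?(ltW r0) ?(ltW k20).
have h3 : Num.sqrt (r * k1^-1) <= Num.sqrt k1^-1 * r `^ e.
  rewrite mulrC sqrtrM ?invr_ge0 ?(ltW k10) // ler_pM2l //.
  by apply: sqrt_le_powR => //; lra.
have h4 : Num.sqrt (r / k2) <= Num.sqrt K * r `^ e.
  apply: (@le_trans _ _ (Num.sqrt (r * (K * r `^ (1 - 4 * a))))).
    by apply: ler_wsqrtr; rewrite ler_pM2l.
  by rewrite sqrt_powR_mulr ?(ltW K0) // ler_pM2l //; apply: powR_mono.
have h5 : r `^ (2 / 3) <= r `^ e by apply: powR_mono.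
lra.
Qed.

End asymptotics.

(** * Sawtooth sums on a concave or convex side *)

Section sides.
Context {R : realType}.
Implicit Types (r s x y : R).

Lemma monotonic_on_sub (A B : set R) (h : R -> R) :
  A `<=` B -> monotonic_on B h -> monotonic_on A h.
Proof.
move=> AB [H|H]; [left|right] => x y; rewrite !inE => hx hy; apply: H;
  by rewrite inE; exact: AB.
Qed.

(** Of the two ends of a monotone arc, one has the least curvature. *)
Lemma monotonic_min (u v x1 x2 y : R) (h : R -> R) (c : R) : (c = 1 \/ c = -1) ->
  monotonic_on `]u, v[%classic h -> u < x1 -> x1 <= y -> y <= x2 -> x2 < v ->
  Num.min (c * h x1) (c * h x2) <= c * h y.
Proof.
move=> hc hm ux1 x1y yx2 x2v.
have i z : x1 <= z -> z <= x2 -> z \in (`]u, v[%classic : set R).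
  by move=> h1 h2; rewrite inE /= in_itv /= (lt_le_trans ux1) // (le_lt_trans h2).
have i1 : x1 \in (`]u, v[%classic : set R) by apply: i => //; exact: le_trans yx2.
have i2 : x2 \in (`]u, v[%classic : set R) by apply: i => //; exact: le_trans x1y _.
have iy := i y x1y yx2.
rewrite ge_min; apply/orP.
case: hm => H.
  have h1 : h x1 <= h y by apply: H.
  have h2 : h y <= h x2 by apply: H.
  by case: hc => ->; rewrite ?mul1r ?mulN1r ?lerN2; auto.
have h1 : h y <= h x1 by apply: H.
have h2 : h x2 <= h y by apply: H.
by case: hc => ->; rewrite ?mul1r ?mulN1r ?lerN2; auto.
Qed.

Lemma C2_on_derive (D : set R) (f : R -> R) (y : R) : C2_on D f -> nbhs y D ->
  is_derive y 1 f (deriv_on D f y) /\ is_derive y 1 (deriv_on D f) (deriv2_on D f y).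
Proof. by move=> [h1 h2 _] hy; split; exact: is_derive_diff_quotient. Qed.

Lemma positive_min (a b : R) (h : R -> R) : a <= b -> {within `[a, b], continuous h} ->
  (forall x, a <= x <= b -> 0 < h x) ->
  exists2 k, 0 < k & forall x, a <= x <= b -> k <= h x.
Proof.
move=> ab ch hp; have [c cab hmin] := EVT_min ab ch.
exists (h c); first by apply: hp; rewrite in_itv /= in cab.
by move=> x hx; apply: hmin; rewrite in_itv.
Qed.

Section curve.
Variables (L : R) (f g : R -> R) (sigma tau c1 c2 alpha B e a1 a2 : R).
Hypotheses (L0 : 0 < L) (hc : decreasing_curve L f g).
Hypotheses (c10 : 0 < c1) (c20 : 0 < c2) (B0 : 0 <= B).
Hypotheses (al0 : 0 < alpha) (alL : alpha < L).
Hypotheses (a10 : 0 < a1) (e1 : 2 / 3 <= e) (e2 : 1 - 2 * a1 <= e) (e3 : 1 - 2 * a2 <= e).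

Local Notation phi := (clampf L f).

Let phi_derive (d y : R) : 0 < y < L -> is_derive y 1 f d -> is_derive y 1 phi d.
Proof.
move=> /andP[y0 yL]; apply: near_eq_is_derive.
have : \forall t \near y, t \in `]0, L[%R.
  by apply: near_in_itvoo; rewrite in_itv /= y0 yL.
apply: filterS => t; rewrite in_itv /= => /andP[t0 tL].
by rewrite clampf_id // ?ltW.
Qed.

Let opposite_continuous (D : set R) (h : R -> R) :
  {within D, continuous h} -> {within D, continuous (fun x => - h x)}.
Proof. by move=> ch x; apply: cvgN; exact: ch. Qed.

(* The cut-off delta r eventually falls below any m; the columns within delta r of
   the singular end number about r delta r = O(r^(1 - 2 a1)). *)
Let cutoff (delta : R -> R) (m : R) : 0 < m -> (forall r, 0 < r -> 0 < delta r) ->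
  isO +oo_R delta (fun r => r `^ (- 2 * a1)) ->
  exists K R0 : R, [/\ 0 < K, 1 <= R0 & forall r, R0 <= r ->
    0 < delta r < m /\ delta r * r <= K * r `^ e].
Proof.
move=> m0 d0 /isO_infty[K [R1 [K0 hK]]].
have [R2 R21 hR2] := @powR_small R (2 * a1) (m / (2 * K)) (mulr_gt0 (ltr0n _ 2) a10) ltac:(by rewrite divr_gt0 ?mulr_gt0).
exists K, (Num.max R1 R2); split=> //; first by rewrite le_max R21 orbT.
move=> r; rewrite ge_max => /andP[r1 r2].
have rr : 1 <= r by exact: le_trans r2.
have r0 : 0 < r by lra.
have dr := d0 r r0; have := hK r r1; have := hR2 r r2.
rewrite (ger0_norm (powR_ge0 _ _)) (gtr0_norm dr) mulNr => h1 h2; split.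
  rewrite dr /=; apply: (le_lt_trans h2).
  apply: (@le_lt_trans _ _ (K * (m / (2 * K)))); first by rewrite ler_pM2l.
  have -> : K * (m / (2 * K)) = m / 2 by field; rewrite gt_eqF.
  lra.
apply: (@le_trans _ _ (K * r `^ (- (2 * a1)) * r)); first by rewrite ler_pM2r.
rewrite -mulrA ler_pM2l // mulrC powR_mulr //; exact: powR_mono.
Qed.

(** Three ranges of columns: up to delta r, where the second derivative may
    degenerate and terms are bounded trivially; from delta r to a fixed m inside
    the first monotone piece, where the curvature is at least that at one of the
    two ends; from m to alpha, where it is bounded below by compactness. *)
Lemma concave_colsum : lipschitz_on phi B 0 alpha -> concave_side alpha f a1 a2 ->
  exists C R0 : R, [/\ 0 < C, 1 <= R0 & forall r s, R0 <= r -> c1 <= s <= c2 ->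
    `|colsum phi sigma tau r s 0 alpha| <= C * r `^ e].
Proof.
have al0' := al0; have alL' := alL; have e1' := e1.
move=> hB [hC2 hsign [p [[hp hlast] hm]] [delta [d0 dO kO]]].
set D : set R := `]0, alpha]%classic in hC2 hsign kO hm.
set df := deriv_on D f in hsign; set ddf := deriv2_on D f in hsign kO hm.
have cphi : continuous phi := clampf_continuous L0 hc.
have nD y : 0 < y -> y < alpha -> nbhs y D.
  move=> y0 ya; have : \forall t \near y, t \in `]0, alpha[%R.
    by apply: near_in_itvoo; rewrite in_itv /= y0 ya.
  by apply: filterS => t; rewrite /D /= !in_itv /= => /andP[-> /ltW].
have hd y : 0 < y < alpha -> is_derive y 1 phi (df y).
  move=> /andP[y0 ya]; apply: phi_derive; first by rewrite y0 (lt_trans ya).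
  by have [] := C2_on_derive hC2 (nD y y0 ya).
have hdd y : 0 < y < alpha -> is_derive y 1 df (ddf y).
  by move=> /andP[y0 ya]; have [] := C2_on_derive hC2 (nD y y0 ya).
have neg y : 0 < y <= alpha -> 0 < -1 * ddf y.
  by move=> hy; have [] := hsign y; [rewrite /D /= in_itv|rewrite mulN1r oppr_gt0].
have [b [b0 ba hmb]] : exists b, [/\ 0 < b, b <= alpha & monotonic_on `]0, b[%classic ddf].
  case: p hp hlast hm => [|b p] /=.
    by move=> _ /eqP e0; move: al0; rewrite -e0 ltxx.
  move=> /andP[b0 pb] /eqP lb /(_ 0%N isT) /= hmb; exists b; split=> //.
  by rewrite -lb; move: pb; rewrite (path_sortedE lt_trans) => /andP[/allP hall _];
    case: p hall {lb hmb} => //= x p' hall; apply/ltW/hall; exact: mem_last.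
pose m := b / 2.
have m0 : 0 < m by rewrite divr_gt0.
have mb : m < b by rewrite /m; lra.
have ma : m < alpha by lra.
have [K [R1 [K0 R11 hR1]]] := cutoff m0 d0 dO.
have [K' [R2 [K'0 hR2]]] := isO_infty kO.
have [C1 C10 hC1] := @colsum_monotone R phi (-1) c1 c2 B L sigma tau cphi
  (or_intror erefl) c10 B0 (ltW L0) c20.
have k10 := neg m ltac:(lra).
have [C2 C20 hC2'] := flat_kappa_bound C10 k10 K'0 e1 e3.
have [k2 k20 hk2] : exists2 k, 0 < k & forall x, m <= x <= alpha -> k <= -1 * ddf x.
  apply: positive_min; first exact: ltW.
    have -> : (fun x => -1 * ddf x) = (fun x => - ddf x) by apply/funext => x; rewrite mulN1r.
    apply: opposite_continuous; case: hC2 => _ _ c2D.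
    apply: continuous_subspaceW c2D => x; rewrite /D /= !in_itv /= => /andP[mx ->].
    by rewrite (lt_le_trans m0).
  by move=> x /andP[mx xa]; apply: neg; rewrite xa (lt_le_trans m0).
have [C3 C30 hC3] := @colsum_bounded R phi (-1) c1 c2 B L sigma tau cphi (or_intror erefl)
  c10 B0 (ltW L0) m alpha k2 df ddf c20 (ltW ma) ltac:(lra) k20
  (fun y hy => hd y ltac:(lra)) (fun y hy => hdd y ltac:(lra))
  (fun y hy => hk2 y ltac:(lra)) (lipschitz_on_sub (ltW m0) (lexx _) hB).
exists (K / c1 + 1 + C2 + C3), (Num.max R1 R2); split.
- have : 0 < K / c1 by rewrite divr_gt0.
  lra.
- by rewrite le_max R11.
move=> r s; rewrite ge_max => /andP[rR1 rR2] sc.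
have r1 : 1 <= r by exact: le_trans rR1.
have r0 : 0 < r by lra.
have s0 : 0 < s by case/andP: sc => cs _; exact: lt_le_trans cs.
have [/andP[dr0 drm] drK] := hR1 r rR1.
rewrite (colsum_cat _ _ _ r0 s0 (ltW dr0) (ltW (lt_trans drm ma))).
rewrite (colsum_cat _ _ _ r0 s0 (ltW drm) (ltW ma)).
have pe : 1 <= r `^ e by rewrite -[leLHS](powRr0 r); apply: powR_mono => //; lra.
have t1 : `|colsum phi sigma tau r s 0 (delta r)| <= (K / c1 + 1) * r `^ e.
  case/andP: sc => cs _.
  apply: (le_trans (@colsum_trivial R phi c1 sigma tau c10 r s 0 (delta r) r0 cs (ltW dr0))).
  rewrite subr0 mulrDl mul1r; apply: lerD => //.
  by rewrite [leRHS]mulrAC ler_pM2r ?invr_gt0.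
have t2 : `|colsum phi sigma tau r s (delta r) m| <= C2 * r `^ e.
  have kd0 := neg (delta r) ltac:(lra).
  apply: le_trans (hC2' r (-1 * ddf (delta r)) r1 kd0 _); last first.
    have := hR2 r rR2; rewrite (ger0_norm (powR_ge0 _ _)) normfV.
    by rewrite mulN1r -normrN ger0_norm // -mulN1r ltW.
  apply: (hC1 r s (delta r) m _ df ddf) => //.
  - exact: ltW.
  - lra.
  - by rewrite lt_min k10.
  - by move=> y hy; apply: hd; lra.
  - by move=> y hy; apply: hdd; lra.
  - move=> y /andP[dy ym]; rewrite minC.
    by apply: (monotonic_min (or_intror erefl) hmb) => //; exact: ltW.
  - by apply: lipschitz_on_sub hB; exact: ltW.
  - apply: monotonic_on_sub hmb => x; rewrite /= !in_itv /= => /andP[dx xm].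
    by rewrite (lt_trans dr0) // (lt_trans xm).
have t3 : `|colsum phi sigma tau r s m alpha| <= C3 * r `^ e.
  apply: (le_trans (hC3 r s r1 sc)); rewrite ler_pM2l //; exact: powR_mono.
have h1 := ler_normD (colsum phi sigma tau r s 0 (delta r))
  (colsum phi sigma tau r s (delta r) m + colsum phi sigma tau r s m alpha).
have h2 := ler_normD (colsum phi sigma tau r s (delta r) m) (colsum phi sigma tau r s m alpha).
lra.
Qed.

(** The same three ranges, from the right: the degenerate end is now L, where the
    convex curve meets the axis. *)
Lemma convex_colsum (a3 : R) : lipschitz_on phi B alpha L -> convex_side L alpha f a1 a2 a3 ->
  exists C R0 : R, [/\ 0 < C, 1 <= R0 & forall r s, R0 <= r -> c1 <= s <= c2 ->
    `|colsum phi sigma tau r s alpha L| <= C * r `^ e].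
Proof.
have al0' := al0; have alL' := alL; have e1' := e1.
move=> hB [hC2 hsign [p [[hp hlast] hm]] [delta [d0 dO kO]] _].
set D : set R := `[alpha, L[%classic in hC2 hsign kO hm.
set df := deriv_on D f in hsign; set ddf := deriv2_on D f in hsign kO hm.
have cphi : continuous phi := clampf_continuous L0 hc.
have nD y : alpha < y -> y < L -> nbhs y D.
  move=> y0 ya; have : \forall t \near y, t \in `]alpha, L[%R.
    by apply: near_in_itvoo; rewrite in_itv /= y0 ya.
  by apply: filterS => t; rewrite /D /= !in_itv /= => /andP[/ltW -> ->].
have hd y : alpha < y < L -> is_derive y 1 phi (df y).
  move=> /andP[y0 ya]; apply: phi_derive; first by rewrite ya (lt_trans al0').
  by have [] := C2_on_derive hC2 (nD y y0 ya).
have hdd y : alpha < y < L -> is_derive y 1 df (ddf y).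
  by move=> /andP[y0 ya]; have [] := C2_on_derive hC2 (nD y y0 ya).
have pos y : alpha <= y < L -> 0 < 1 * ddf y.
  by move=> hy; have [] := hsign y; [rewrite /D /= in_itv|rewrite mul1r].
have [b [ba bL hmb]] : exists b, [/\ alpha <= b, b < L & monotonic_on `]b, L[%classic ddf].
  case/lastP: p hp hlast hm => [|p b].
    by move=> _ /eqP /= e0; move: alL'; rewrite -e0 ltxx.
  rewrite last_rcons => hp /eqP bL; rewrite bL in hp *.
  move=> /(_ (size p)); rewrite size_rcons => /(_ (leqnn _)).
  rewrite -rcons_cons !nth_rcons /= ltnS leqnn ltnn eqxx.
  have -> : nth L (alpha :: p) (size p) = last alpha p.
    by rewrite (last_nth L).
  move: hp; rewrite rcons_path => /andP[hp lL] hmb.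
  exists (last alpha p); split=> //.
  move: hp; rewrite (path_sortedE lt_trans) => /andP[/allP hall _].
  by case: p hall {lL hmb} => //= x p' hall; apply/ltW/hall; exact: mem_last.
pose m := (b + L) / 2.
have m0 : 0 < L - m by rewrite /m; lra.
have mb : b < m by rewrite /m; lra.
have ma : alpha < m by lra.
have mL : m < L by lra.
have [K [R1 [K0 R11 hR1]]] := cutoff m0 d0 dO.
have [K' [R2 [K'0 hR2]]] := isO_infty kO.
have [C1 C10 hC1] := @colsum_monotone R phi 1 c1 c2 B L sigma tau cphi
  (or_introl erefl) c10 B0 (ltW L0) c20.
have k10 := pos m ltac:(lra).
have [C2 C20 hC2'] := flat_kappa_bound C10 k10 K'0 e1 e3.
have [k2 k20 hk2] : exists2 k, 0 < k & forall x, alpha <= x <= m -> k <= 1 * ddf x.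
  apply: positive_min; first exact: ltW.
    have -> : (fun x => 1 * ddf x) = ddf by apply/funext => x; rewrite mul1r.
    case: hC2 => _ _ c2D.
    apply: continuous_subspaceW c2D => x; rewrite /D /= !in_itv /= => /andP[-> mx].
    by rewrite (le_lt_trans mx).
  by move=> x /andP[mx xa]; apply: pos; rewrite mx (le_lt_trans xa).
have [C3 C30 hC3] := @colsum_bounded R phi 1 c1 c2 B L sigma tau cphi (or_introl erefl)
  c10 B0 (ltW L0) alpha m k2 df ddf c20 (ltW ma) ltac:(lra) k20
  (fun y hy => hd y ltac:(lra)) (fun y hy => hdd y ltac:(lra))
  (fun y hy => hk2 y ltac:(lra)) (lipschitz_on_sub (lexx _) (ltW mL) hB).
exists (K / c1 + 1 + C2 + C3), (Num.max R1 R2); split.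
- have : 0 < K / c1 by rewrite divr_gt0.
  lra.
- by rewrite le_max R11.
move=> r s; rewrite ge_max => /andP[rR1 rR2] sc.
have r1 : 1 <= r by exact: le_trans rR1.
have r0 : 0 < r by lra.
have s0 : 0 < s by case/andP: sc => cs _; exact: lt_le_trans cs.
have [/andP[dr0 drm] drK] := hR1 r rR1.
pose q := L - delta r.
have mq : m < q by rewrite /q; lra.
have qL : q < L by rewrite /q; lra.
rewrite (colsum_cat _ _ _ r0 s0 (ltW ma) (ltW mL)).
rewrite (colsum_cat _ _ _ r0 s0 (ltW mq) (ltW qL)).
have pe : 1 <= r `^ e by rewrite -[leLHS](powRr0 r); apply: powR_mono => //; lra.
have t1 : `|colsum phi sigma tau r s q L| <= (K / c1 + 1) * r `^ e.
  case/andP: sc => cs _.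
  apply: (le_trans (@colsum_trivial R phi c1 sigma tau c10 r s q L r0 cs (ltW qL))).
  rewrite (_ : L - q = delta r); last by rewrite /q; ring.
  rewrite mulrDl mul1r; apply: lerD => //.
  by rewrite [leRHS]mulrAC ler_pM2r ?invr_gt0.
have t2 : `|colsum phi sigma tau r s m q| <= C2 * r `^ e.
  have kd0 := pos q ltac:(lra).
  apply: le_trans (hC2' r (1 * ddf q) r1 kd0 _); last first.
    have := hR2 r rR2; rewrite (ger0_norm (powR_ge0 _ _)) normfV.
    by rewrite mul1r -/q ger0_norm // ltW // -[ddf q]mul1r.
  apply: (hC1 r s m q _ df ddf) => //.
  - exact: ltW.
  - lra.
  - by rewrite lt_min k10.
  - by move=> y hy; apply: hd; lra.
  - by move=> y hy; apply: hdd; lra.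
  - move=> y /andP[dy ym].
    by apply: (monotonic_min (or_introl erefl) hmb) => //; exact: ltW.
  - by apply: lipschitz_on_sub hB; exact: ltW.
  - apply: monotonic_on_sub hmb => x; rewrite /= !in_itv /= => /andP[dx xm].
    by rewrite (lt_trans mb) // (lt_trans xm).
have t3 : `|colsum phi sigma tau r s alpha m| <= C3 * r `^ e.
  apply: (le_trans (hC3 r s r1 sc)); rewrite ler_pM2l //; exact: powR_mono.
have h1 := ler_normD (colsum phi sigma tau r s alpha m)
  (colsum phi sigma tau r s m q + colsum phi sigma tau r s q L).
have h2 := ler_normD (colsum phi sigma tau r s m q) (colsum phi sigma tau r s q L).
lra.
Qed.

End curve.
End sides.

(** * Lattice points above one side of the curve *)

Section side_counts.
Context {R : realType}.
Implicit Types (r s x y : R).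

Definition column_height (phi : R -> R) (sigma tau r s : R) (j : nat) : nat :=
  Num.truncn (r * s * phi ((j%:R + sigma) * (s / r)) - tau).

Lemma truncn_sawtooth y : 0 <= y -> (Num.truncn y)%:R = y - 2^-1 - sawtooth y.
Proof.
move=> y0; rewrite /sawtooth.
have -> : (Num.truncn y)%:R = (Num.floor y)%:~R :> R.
  rewrite truncn_floor y0; move: (floor_ge0 y); rewrite y0.
  by case: (Num.floor y).
ring.
Qed.

(** The truncation is 0 on negative numbers, where the floor is not. *)
Lemma truncn_lt0_defect (y t : R) : y < 0 -> - y <= t ->
  `|(Num.truncn y)%:R - (y - 2^-1 - sawtooth y)| <= t + 1.
Proof.
move=> y0 yt.
have -> : Num.truncn y = 0%N by apply/truncn0Pn; rewrite -ltNge (lt_trans y0).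
have [m [u [e /andP[u0 u1] fm sw]]] := floor_frac y.
by rewrite sw ler_norml; apply/andP; split; lra.
Qed.

Lemma sum_gt_indicator (c a b : nat) : (\sum_(a <= j < b.+1) (c < j) <= b - c)%N.
Proof.
have [ab|ba] := leqP a b; last by rewrite big_geq.
apply: (@leq_trans (\sum_(0 <= j < b.+1) (c < j))%N).
  by rewrite [leqRHS](big_cat_nat (n := a)) //= ?leq_addl // ltnW.
elim: b {ab} => [|b IH]; first by rewrite big_nat1.
rewrite big_nat_recr //=; case: (ltnP c b.+1) => h /=; move: IH h; clear; lia.
Qed.

Local Notation M sigma alpha r s := (column_index sigma (s / r) alpha).
Local Notation node sigma alpha r s := (((M sigma alpha r s)%:R + 2^-1 + sigma) * (s / r)).

Lemma index_arg_ge0 (sigma x c r s : R) : 0 < x -> 0 < s -> s <= c -> 0 < r ->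
  c * (1 + `|sigma|) / x <= r -> 0 <= x / (s / r) - sigma.
Proof.
move=> x0 s0 sc r0; rewrite ler_pdivrMr // => h.
rewrite subr_ge0 ler_pdivlMr ?divr_gt0 // mulrA ler_pdivrMr //.
have h1 : sigma * s <= `|sigma| * c.
  apply: (@le_trans _ _ (`|sigma| * s)); first by rewrite ler_pM2r // ler_norm.
  exact: ler_wpM2l.
lra.
Qed.

(** A sum of heights is r s times a sum of values of phi, that is r^2 times a
    Riemann sum of step s / r, whose quadratic errors become bounded. *)
Lemma scaled_error (r s c B x : R) : 0 < r -> 0 < s -> s <= c -> 0 <= B ->
  `|x| <= B * (s / r) ^+ 2 -> `|r ^+ 2 * x| <= B * c ^+ 2.
Proof.
move=> r0 s0 sc B0 hx; have r20 : 0 <= r ^+ 2 by exact: sqr_ge0.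
rewrite normrM (ger0_norm r20); apply: (le_trans (ler_wpM2l r20 hx)).
have -> : r ^+ 2 * (B * (s / r) ^+ 2) = B * s ^+ 2 by field; rewrite gt_eqF.
by apply: ler_wpM2l => //; rewrite ler_pXn2r ?nnegrE ?(ltW s0) // (le_trans (ltW s0)).
Qed.

(** The midpoint rule ends half a step beyond the last column, at a node within half
    a step of x. *)
Lemma node_near (sigma eta : R) x : 0 < eta -> 0 < x -> 0 <= x / eta - sigma ->
  `|((column_index sigma eta x)%:R + 2^-1 + sigma) * eta - x| <= eta / 2.
Proof.
move=> h0 x0 u0; have /andP[t1 t2] := truncn_itv u0.
rewrite -/(column_index sigma eta x) in t1 t2; rewrite -(natr1 (column_index _ _ _)) in t2.
move: t1 t2; set k : R := (column_index sigma eta x)%:R => t1 t2.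
have -> : (k + 2^-1 + sigma) * eta - x = (k + 2^-1 + sigma - x / eta) * eta.
  by field; rewrite gt_eqF.
rewrite normrM (gtr0_norm h0) mulrC ler_pM2l //.
by rewrite ler_norml; apply/andP; split; lra.
Qed.

Lemma powR_exponent_ge1 r (e : R) : 2 / 3 <= e -> 1 <= r -> 1 <= r `^ e.
Proof. by move=> e0 r1; rewrite -[leLHS](powRr0 r); apply: powR_mono => //; lra. Qed.

(** The midpoint rule integrates from node to node; the first order Taylor expansion
    of the primitive moves the ends of integration to p and q.  All errors are
    quadratic in the step. *)
Lemma column_riemann (phi F : R -> R) (c sigma c2 B u v p q r s K : R) :
  (forall x, -1 < x -> is_derive x 1 F (phi x)) -> c = 1 \/ c = -1 ->
  convex_on (fun x => c * phi x) u v -> lipschitz_on phi B u v -> 0 <= B -> -1 < u ->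
  0 < r -> 0 < s -> s <= c2 -> p <= q -> u <= p -> q <= v ->
  u <= node sigma p r s -> node sigma q r s <= v ->
  `|node sigma p r s - p| <= K * (s / r) -> `|node sigma q r s - q| <= K * (s / r) ->
  `|r * s * (\sum_((M sigma p r s).+1 <= j < (M sigma q r s).+1) phi ((j%:R + sigma) * (s / r)))
    - (r ^+ 2 * (F q - F p) + r ^+ 2 * (node sigma q r s - q) * phi q
       - r ^+ 2 * (node sigma p r s - p) * phi p)| <= B * c2 ^+ 2 * (1 + 2 * K ^+ 2).
Proof.
move=> dF hc hconv hB B0 u1 r0 s0 sc pq up qv unp nqv np nq.
have h0 : 0 < s / r by rewrite divr_gt0.
have mm : (M sigma p r s <= M sigma q r s)%N by exact: column_index_mono.
have ndE x : ((M sigma x r s).+1%:R - 2^-1 + sigma) * (s / r) = node sigma x r s.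
  by rewrite -(natr1 (M sigma x r s)); congr (_ * _); lra.
have npq : node sigma p r s <= node sigma q r s by rewrite ler_pM2r // !lerD2r ler_nat.
have := midpoint_sum dF hc hconv hB B0 u1 h0 (mm : ((M sigma p r s).+1 <= (M sigma q r s).+1)%N).
move=> /(_ sigma); rewrite !ndE => /(_ unp nqv) hmid.
have Tp := primitive_taylor dF hB B0 u1 up (le_trans pq qv) unp (le_trans npq nqv).
have Tq := primitive_taylor dF hB B0 u1 (le_trans up pq) qv (le_trans unp npq) nqv.
have sq d : `|d| <= K * (s / r) -> B * d ^+ 2 <= B * K ^+ 2 * (s / r) ^+ 2.
  move=> hd; rewrite -mulrA -exprMn; apply: ler_wpM2l => //.
  by rewrite -real_normK ?num_real // ler_pXn2r ?nnegrE // (le_trans _ hd).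
have BK : 0 <= B * K ^+ 2 by rewrite mulr_ge0 // sqr_ge0.
have e1 := scaled_error r0 s0 sc B0 hmid.
have e2 := scaled_error r0 s0 sc BK (le_trans Tp (sq _ np)).
have e3 := scaled_error r0 s0 sc BK (le_trans Tq (sq _ nq)).
have er : r * s = r ^+ 2 * (s / r) by field; rewrite gt_eqF.
rewrite er; move: e1 e2 e3; move: (node sigma p r s) (node sigma q r s) => x y.
set S := \sum_(_ <= j < _) _ => e1 e2 e3.
rewrite (_ : _ - _ = r ^+ 2 * (s / r * S - (F y - F x)) + r ^+ 2 * (F y - F q - (y - q) * phi q)
   - r ^+ 2 * (F x - F p - (x - p) * phi p)); last by ring.
move: e1 e2 e3; rewrite !ler_norml => /andP[? ?] /andP[? ?] /andP[? ?].
by apply/andP; split; lra.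
Qed.

(** The defect is the effect of truncating at 0 instead of rounding down. *)
Definition height_defect (phi : R -> R) (sigma tau r s : R) (j : nat) : R :=
  let y := r * s * phi ((j%:R + sigma) * (s / r)) - tau in
  (column_height phi sigma tau r s j)%:R - (y - 2^-1 - sawtooth y).

Lemma sum_column_height (phi : R -> R) (sigma tau r s p q : R) : 0 < r -> 0 < s -> p <= q ->
  \sum_((M sigma p r s).+1 <= j < (M sigma q r s).+1) (column_height phi sigma tau r s j)%:R
  = r * s * (\sum_((M sigma p r s).+1 <= j < (M sigma q r s).+1) phi ((j%:R + sigma) * (s / r)))
    - ((M sigma q r s)%:R - (M sigma p r s)%:R) * (tau + 2^-1)
    - colsum phi sigma tau r s p q
    + \sum_((M sigma p r s).+1 <= j < (M sigma q r s).+1) height_defect phi sigma tau r s j.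
Proof.
move=> r0 s0 pq; have mm : (M sigma p r s <= M sigma q r s)%N.
  by apply: column_index_mono => //; rewrite divr_gt0.
rewrite /colsum mulr_sumr -natrB // -[X in _ - X - _](_ :
  \sum_((M sigma p r s).+1 <= j < (M sigma q r s).+1) (tau + 2^-1) = _); last first.
  by rewrite sumr_const_nat subSS mulr_natl.
rewrite -!sumrB -big_split /=; apply: eq_big_nat => j _.
by rewrite /height_defect; ring.
Qed.

Lemma column_index0 (sigma eta : R) : - 2^-1 < sigma -> column_index sigma eta 0 = 0%N.
Proof.
move=> sg; rewrite /column_index mul0r sub0r.
by apply/truncn0Pn; rewrite -ltNge; lra.
Qed.

(** Main terms: the Riemann sum ends at the node, not at alpha, which produces the
    term in node - alpha; it starts at (1/2 + sigma) s / r, where the curve is near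
    its maximum L, which produces r s L (sigma + 1/2); and each of the M columns
    loses tau + 1/2 in the truncation.  Below alpha the curve is high, so the
    truncated numbers are positive for large r. *)
Lemma concave_side_count (phi F : R -> R) (sigma tau c1 c2 alpha B e L alpha' : R) :
  (forall x, -1 < x -> is_derive x 1 F (phi x)) ->
  0 < c1 -> 0 < c2 -> 0 <= B -> 0 < alpha -> - 2^-1 < sigma -> 2 / 3 <= e ->
  alpha < alpha' -> 0 < phi alpha -> phi 0 = L ->
  convex_on (fun x => -1 * phi x) 0 alpha' -> lipschitz_on phi B 0 alpha' ->
  (forall x y, x <= y -> phi y <= phi x) ->
  (exists C R0 : R, [/\ 0 < C, 1 <= R0 & forall r s, R0 <= r -> c1 <= s <= c2 ->
    `|colsum phi sigma tau r s 0 alpha| <= C * r `^ e]) ->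
  exists C R0 : R, [/\ 0 < C, 1 <= R0 & forall r s, R0 <= r -> c1 <= s <= c2 ->
    `|\sum_(1 <= j < (M sigma alpha r s).+1) (column_height phi sigma tau r s j)%:R
      - (r ^+ 2 * (F alpha - F 0) - r * s * L * (sigma + 2^-1)
         + r ^+ 2 * (node sigma alpha r s - alpha) * phi alpha - (M sigma alpha r s)%:R * (tau + 2^-1))|
      <= C * r `^ e].
Proof.
move=> dF c10 c20 B0 al0 sg e0 aa' ph0 phi0 hconv hB hmono [C1 [R1 [C10 R11 hC1]]].
pose W := B * c2 ^+ 2 * (1 + 2 * (1 + `|sigma|) ^+ 2).
have W0 : 0 <= W.
  exact: (mulr_ge0 (mulr_ge0 B0 (sqr_ge0 _)) (addr_ge0 ler01 (mulr_ge0 (ler0n _ 2) (sqr_ge0 _)))).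
pose C := C1 + W.
pose R2 := Num.max (c2 / (2 * (alpha' - alpha))) (`|tau| / (c1 * phi alpha)).
pose R3 := c2 * (1 + `|sigma|) / alpha.
exists C, (Num.max R1 (Num.max R2 R3)); split.
- by rewrite ltr_pwDl.
- by rewrite le_max R11.
move=> r s; rewrite !ge_max => /andP[rR1 /andP[/andP[rR2 rR2'] rR3]] hs.
have /andP[cs sc] := hs.
have r1 : 1 <= r by exact: le_trans rR1.
have r0 : 0 < r by lra.
have s0 : 0 < s by exact: lt_le_trans cs.
set eta := s / r; have h0 : 0 < eta by rewrite divr_gt0.
have eta_small : eta / 2 <= alpha' - alpha.
  rewrite /eta mulrAC ler_pdivrMr // .
  rewrite ler_pdivrMr ?mulr_gt0 ?subr_gt0 // in rR2.
  lra.
have u0 : 0 <= alpha / eta - sigma by exact: index_arg_ge0 sc r0 rR3.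
have near := node_near h0 al0 u0.
have /ler_normlP[nd1 nd2] := near.
have M0 : M sigma 0 r s = 0%N by exact: column_index0.
have n0 : node sigma 0 r s = (2^-1 + sigma) * eta by rewrite M0 add0r.
have sg0 : 0 < 2^-1 + sigma by move: sg; clear; lra.
have [K1 K2] : 2^-1 + sigma <= 1 + `|sigma| /\ 2^-1 <= 1 + `|sigma|.
  by move: (ler_norm sigma) (normr_ge0 sigma); clear; split; lra.
have := @column_riemann phi F (-1) sigma c2 B 0 alpha' 0 alpha r s (1 + `|sigma|) dF
  (or_intror erefl) hconv hB B0 (ltrN10 _) r0 s0 sc (ltW al0) (lexx 0) (ltW aa').
rewrite n0 subr0 normrM (gtr0_norm sg0) (gtr0_norm h0) => hR.
have {hR}hR := hR (mulr_ge0 (ltW sg0) (ltW h0)) ltac:(rewrite -/eta; lra) (ler_wpM2r (ltW h0) K1)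
  (le_trans near (_ : eta / 2 <= (1 + `|sigma|) * eta)).
have {hR}hR := hR ltac:(by rewrite mulrC ler_pM2r).
have hH := @sum_column_height phi sigma tau r s 0 alpha r0 s0 (ltW al0).
rewrite M0 subr0 in hH; rewrite M0 in hR.
have hz : \sum_(1 <= j < (M sigma alpha r s).+1) height_defect phi sigma tau r s j = 0.
  rewrite big_nat_cond big1 // => j /andP[/andP[j1 jm] _]; rewrite /height_defect /column_height truncn_sawtooth ?subrr //.
  have ha : phi alpha <= phi ((j%:R + sigma) * eta) by apply: hmono; rewrite -column_indexP.
  rewrite ler_pdivrMr ?mulr_gt0 // in rR2'.
  have h1 : r * (c1 * phi alpha) <= r * s * phi ((j%:R + sigma) * (s / r)).
    rewrite -/eta -mulrA ler_pM2l //; apply: ler_pM => //; exact: ltW.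
  by rewrite subr_ge0; move: (ler_norm tau) h1 rR2'; clear; lra.
rewrite hH hz addr0.
have hcs := hC1 r s rR1 hs; have pe := powR_exponent_ge1 e0 r1.
have er : r ^+ 2 * ((2^-1 + sigma) * eta) * phi 0 = r * s * L * (sigma + 2^-1).
  by rewrite phi0 /eta; field; rewrite gt_eqF.
rewrite er in hR.
have cc := ler_peMr W0 pe.
move: hR hcs cc; rewrite /C -/W /eta; clear.
set X1 := r * s * _; set X2 := colsum _ _ _ _ _ _ _.
rewrite !ler_norml => /andP[? ?] /andP[? ?] ?.
by apply/andP; split; lra.
Qed.

(** Now the sum runs to the end L of the curve, where phi vanishes together with its
    first order contribution.  The truncated numbers may be negative there: this
    happens in the columns where the height is at most w, hence, by
    duality, beyond the abscissa gam (w / (r s)), which is L up to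
    O(r^(- 2 b3)) by the behaviour of the inverse function near 0. *)
Lemma convex_side_count (phi F gam : R -> R) (sigma tau c1 c2 alpha B e L b3 : R) :
  (forall x, -1 < x -> is_derive x 1 F (phi x)) ->
  0 < c1 -> 0 < c2 -> 0 <= B -> 0 < alpha -> - 2^-1 < sigma -> 2 / 3 <= e ->
  alpha < L -> phi L = 0 ->
  convex_on phi 0 (L + 1) -> lipschitz_on phi B (alpha / 2) (L + 1) ->
  (forall x, 0 <= phi x) ->
  (forall x y, 0 < x -> 0 < y -> (y <= phi x) = (x <= gam y)) ->
  0 < b3 -> 1 - 2 * b3 <= e ->
  (exists K d : R, [/\ 0 < K, 0 < d & forall y, 0 < y -> y < d -> `|gam y - L| <= K * y `^ (2 * b3)]) ->
  (forall y, gam y <= L) ->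
  (exists C R0 : R, [/\ 0 < C, 1 <= R0 & forall r s, R0 <= r -> c1 <= s <= c2 ->
    `|colsum phi sigma tau r s alpha L| <= C * r `^ e]) ->
  exists C R0 : R, [/\ 0 < C, 1 <= R0 & forall r s, R0 <= r -> c1 <= s <= c2 ->
    `|\sum_((M sigma alpha r s).+1 <= j < (column_index sigma (s / r) L).+1)
        (column_height phi sigma tau r s j)%:R
      - (r ^+ 2 * (F L - F alpha) - r ^+ 2 * (node sigma alpha r s - alpha) * phi alpha
         - (r * L / s - (M sigma alpha r s)%:R) * (tau + 2^-1))|
      <= C * r `^ e].
Proof.
move=> dF c10 c20 B0 al0 sg e0 aL phiL hconv hB phi0 hdual b30 b3e [K [d [K0 d0 hg]]] gamL [C1 [R1 [C10 R11 hC1]]].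
have L0 : 0 < L by lra.
have a2 : 0 <= alpha / 2 by lra.
have am1 : -1 < alpha / 2 by lra.
pose w := `|tau| + 1; have w0 : 0 < w by rewrite /w ltr_pwDr.
pose K2 := K * (w / c1) `^ (2 * b3) / c1.
have K20 : 0 <= K2 by rewrite !mulr_ge0 ?invr_ge0 ?powR_ge0 // ltW.
pose D := (1 + `|sigma|) * `|tau + 2^-1|.
have D0 : 0 <= D by rewrite mulr_ge0 // addr_ge0.
pose W := B * c2 ^+ 2 * (1 + 2 * 2^-1 ^+ 2).
have W0 : 0 <= W.
  exact: (mulr_ge0 (mulr_ge0 B0 (sqr_ge0 _)) (addr_ge0 ler01 (mulr_ge0 (ler0n _ 2) (sqr_ge0 _)))).
pose C := C1 + W + D + w * (K2 + 1).
pose R2 := Num.max (c2 / alpha) (Num.max c2 (c2 * (1 + `|sigma|) / alpha)).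
pose R3 := 2 * w / (c1 * d).
have wK : 0 <= w * (K2 + 1) by rewrite mulr_ge0 ?(ltW w0) // addr_ge0.
exists C, (Num.max R1 (Num.max R2 R3)); split.
- by rewrite /C; lra.
- by rewrite le_max R11.
move=> r s; rewrite !ge_max => /andP[rR1 /andP[/andP[rR2 /andP[rc2 rR2']] rR3]] hs.
have /andP[cs sc] := hs.
have r1 : 1 <= r by exact: le_trans rR1.
have r0 : 0 < r by lra.
have s0 : 0 < s by exact: lt_le_trans cs.
set eta := s / r; have h0 : 0 < eta by rewrite divr_gt0.
have eta_small : eta <= alpha.
  by rewrite /eta ler_pdivrMr //; rewrite ler_pdivrMr // in rR2; lra.
have eta1 : eta <= 1 by rewrite /eta ler_pdivrMr // mul1r; lra.
have ua : 0 <= alpha / eta - sigma by exact: index_arg_ge0 sc r0 rR2'.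
have uL : 0 <= L / eta - sigma.
  apply: (le_trans ua); rewrite lerD2r ler_pM2r ?invr_gt0 //; exact: ltW.
have neara := node_near h0 al0 ua.
have nearL := node_near h0 L0 uL.
have mJ : (column_index sigma eta alpha <= column_index sigma eta L)%N.
  by apply: column_index_mono => //; exact: ltW.
have /andP[J1 J2] := truncn_itv uL; rewrite -/(column_index sigma eta L) in J1 J2.
have /ler_normlP[nd1 nd2] := neara.
have /ler_normlP[nL1 nL2] := nearL.
have hconv' : convex_on (fun x => 1 * phi x) (alpha / 2) (L + 1).
  move=> x y z ux xy yz zv; rewrite !mul1r; apply: hconv => //.
  by rewrite (le_trans a2).
have hR := @column_riemann phi F 1 sigma c2 B (alpha / 2) (L + 1) alpha L r s 2^-1 dF
  (or_introl erefl) hconv' hB B0 am1 r0 s0 sc (ltW aL) ltac:(move: al0; clear; lra)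
  ltac:(clear; lra).
have {hR}hR := hR
  ltac:(rewrite -/eta; move: nd1 nd2 eta_small aL al0; clear; lra)
  ltac:(rewrite -/eta; move: nL1 nL2 eta1 h0; clear; lra)
  ltac:(by rewrite [leRHS]mulrC) ltac:(by rewrite [leRHS]mulrC).
rewrite phiL mulr0 addr0 -/eta in hR.
rewrite (@sum_column_height phi sigma tau r s alpha L r0 s0 (ltW aL)) -/eta.
set m := column_index sigma eta alpha in neara mJ hR *.
set J := column_index sigma eta L in nearL mJ J1 J2 hR *.
pose Y j := r * s * phi ((j%:R + sigma) * eta) - tau.
have hdef : `|\sum_(m.+1 <= j < J.+1) height_defect phi sigma tau r s j| <= w * (K2 + 1) * r `^ e.
  pose y0 := w / (r * s).
  have rs0 : 0 < r * s by rewrite mulr_gt0.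
  have y00 : 0 < y0 by rewrite divr_gt0.
  have y0d : y0 < d.
    rewrite /y0 ltr_pdivrMr //; rewrite ler_pdivrMr ?mulr_gt0 // in rR3.
    have h1 : r * (c1 * d) <= d * (r * s).
      have -> : d * (r * s) = r * (s * d) by ring.
      by rewrite ler_pM2l // ler_pM2r.
    by move: h1 rR3 w0; clear; lra.
  have := hg y0 y00 y0d; set x0 := gam y0 => hx0.
  have x0L : x0 <= L by exact: gamL.
  have hdj j : (m.+1 <= j)%N -> (j < J.+1)%N ->
      `|height_defect phi sigma tau r s j| <= w * (column_index sigma eta x0 < j)%N%:R.
    move=> mj jJ; have j0 : (0 < j)%N by apply: leq_ltn_trans mj.
    rewrite /height_defect /column_height -/eta -/(Y j).
    have [Y0|Y0] := leP 0 (Y j).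
      rewrite truncn_sawtooth // subrr normr0 mulr_ge0 ?(ltW w0) //.
    have -> : (column_index sigma eta x0 < j)%N.
      rewrite ltnNge column_indexP //.
      have xj0 : 0 < (j%:R + sigma) * eta.
        rewrite mulr_gt0 //; have : 1 <= j%:R :> R by rewrite ler1n.
        by move: sg; clear; lra.
      rewrite -hdual // -ltNge /y0 ltr_pdivlMr // mulrC.
      rewrite /Y in Y0; rewrite /w; move: (ler_norm tau) Y0; clear; lra.
    rewrite mulr1 /w; apply: truncn_lt0_defect => //.
    have : 0 <= r * s * phi ((j%:R + sigma) * eta) by rewrite mulr_ge0 // ltW.
    rewrite /Y; move: (ler_norm tau); clear; lra.
  apply: (le_trans (ler_norm_sum _ _ _)).
  apply: (@le_trans _ _ (\sum_(m.+1 <= j < J.+1) w * (column_index sigma eta x0 < j)%N%:R)).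
    by apply: ler_sum_nat => j /andP[mj jJ]; exact: hdj.
  rewrite -mulr_sumr -mulrA ler_pM2l // -natr_sum.
  apply: (@le_trans _ _ (J - column_index sigma eta x0)%:R).
    by rewrite ler_nat; exact: sum_gt_indicator.
  apply: (le_trans (column_count sigma h0 x0L)).
  have pe := powR_exponent_ge1 e0 r1; rewrite [leRHS]mulrDl mul1r; apply: lerD => //.
  have hL : L - x0 <= K * ((w / c1) `^ (2 * b3) * r `^ (- (2 * b3))).
    have -> : L - x0 = `|x0 - L| by rewrite distrC ger0_norm // subr_ge0.
    apply: (le_trans hx0); rewrite ler_pM2l // powRN.
    have -> : (w / c1) `^ (2 * b3) * (r `^ (2 * b3))^-1 = (w / c1 / r) `^ (2 * b3).
      rewrite [in RHS]powRM ?invr_ge0 ?(ltW r0) ?divr_ge0 ?(ltW w0) ?(ltW c10) //.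
      congr (_ * _).
      by rewrite -[in RHS](powR_inv1 (ltW r0)) -powRrM mulN1r powRN.
    apply: ge0_ler_powR; rewrite ?nnegrE ?divr_ge0 ?mulr_ge0 ?(ltW w0) ?(ltW c10) ?(ltW r0) ?(ltW s0) ?(ltW b30) //.
    rewrite /y0 -mulrA -invfM ler_pM2l // lef_pV2 ?posrE ?mulr_gt0 //.
    by rewrite mulrC ler_pM2l.
  have -> : (L - x0) / eta = (L - x0) * (r / s) by rewrite /eta invf_div.
  have rs : r / s <= r / c1 by rewrite ler_pM2l // lef_pV2.
  apply: (@le_trans _ _ (K * ((w / c1) `^ (2 * b3) * r `^ (- (2 * b3))) * (r / c1))).
    apply: ler_pM => //; first by rewrite subr_ge0.
    by rewrite divr_ge0 ?(ltW r0) ?(ltW s0).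
  have -> : K * ((w / c1) `^ (2 * b3) * r `^ (- (2 * b3))) * (r / c1)
     = K2 * (r * r `^ (- (2 * b3))) by rewrite /K2; ring.
  by rewrite powR_mulr //; apply: ler_wpM2l => //; apply: powR_mono.
have hcs := hC1 r s rR1 hs; have pe := powR_exponent_ge1 e0 r1.
have LE : r * L / s = L / eta by rewrite /eta invf_div mulrA [r * L]mulrC.
rewrite LE.
have b4 : `|(L / eta - J%:R) * (tau + 2^-1)| <= D.
  rewrite normrM /D; apply: ler_wpM2r => //.
  rewrite -(natr1 J) in J2; have := ler_norm sigma; have := ler_norm (- sigma).
  rewrite normrN => hs1 hs2; rewrite ler_norml.
  by move: J1 J2 hs1 hs2; clear; move=> *; apply/andP; split; lra.
have cc := ler_peMr (addr_ge0 W0 D0) pe.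
move: hR b4 hcs hdef cc; rewrite /C -/W; clear.
set X1 := r * s * _; set X2 := colsum _ _ _ _ _ _ _; set X3 := \sum_(_ <= j < _) _.
rewrite !ler_norml => /andP[? ?] /andP[? ?] /andP[? ?] /andP[? ?] ?.
by apply/andP; split; lra.
Qed.

End side_counts.

(** * Splitting the count at a point of the curve *)

Section assembly.
Context {R : realType}.
Implicit Types (r s x y : R).

Lemma truncn_ge_pos (k : nat) (u : R) : (0 < k)%N -> (k <= Num.truncn u)%N = (k%:R <= u).
Proof.
move=> k0; have := @column_indexP R 0 1 u k ltr01 k0.
by rewrite /column_index divr1 subr0 addr0 mulr1.
Qed.

(** Summing over a subdivision of mesh w bounds the increment of Phi by w times the
    total variation of the monotone function phi. *)
Lemma constant_of_quadratic (Phi phi : R -> R) (a b : R) : a <= b ->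
  (forall x y, a <= x -> x <= y -> y <= b -> `|Phi y - Phi x| <= (y - x) * (phi x - phi y)) ->
  Phi a = Phi b.
Proof.
move=> ab h; apply/eqP; rewrite -subr_eq0 -normr_eq0 distrC.
rewrite eq_le normr_ge0 andbT; apply/ler_addgt0Pl => eps e0; rewrite addr0.
pose D := (b - a) * (phi a - phi b).
have D0 : 0 <= D by apply: le_trans (h a b (lexx _) ab (lexx _)).
pose n := (Num.truncn (D / eps)).+1.
have n0 : 0 < n%:R :> R by rewrite ltr0n.
have hn : D <= n%:R * eps by rewrite -ler_pdivrMr // ltW // /n truncnS_gt.
pose w := (b - a) / n%:R; have w0 : 0 <= w by rewrite divr_ge0 // subr_ge0.
have nw : n%:R * w = b - a by rewrite mulrC divfK // gt_eqF.
have key k : (k <= n)%N -> `|Phi (a + k%:R * w) - Phi a| <= w * (phi a - phi (a + k%:R * w)).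
  elim: k => [|k IH] kn; first by rewrite mul0r addr0 !subrr normr0 mulr0.
  have := IH (ltnW kn); have := h (a + k%:R * w) (a + k.+1%:R * w).
  have k0 : 0 <= k%:R * w by rewrite mulr_ge0.
  have kb : k.+1%:R * w <= b - a by rewrite -nw ler_wpM2r // ler_nat.
  have ks : a + k.+1%:R * w = a + k%:R * w + w by rewrite -natr1; ring.
  rewrite lerDl => /(_ k0); rewrite {1}ks lerDl => /(_ w0); rewrite -lerBrDl => /(_ kb).
  rewrite (_ : a + k.+1%:R * w - (a + k%:R * w) = w); last by rewrite ks; ring.
  have := ler_distD (Phi (a + k%:R * w)) (Phi (a + k.+1%:R * w)) (Phi a); lra.
have := key n (leqnn _); rewrite nw (_ : a + (b - a) = b); last by ring.
move=> /le_trans; apply.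
rewrite (_ : w * (phi a - phi b) = D / n%:R); last by rewrite /w /D; ring.
by rewrite ler_pdivrMr // mulrC.
Qed.

(** Integration by parts for a monotone function and its inverse, where neither is
    differentiable: the increments of the left hand side are bounded by the area
    of a rectangle with sides y - x and phi x - phi y. *)
Lemma legendre_area (phi gam F G : R -> R) (L : R) :
  (forall x, -1 < x -> is_derive x 1 F (phi x)) ->
  (forall x, -1 < x -> is_derive x 1 G (gam x)) ->
  (forall x y, x <= y -> phi y <= phi x) -> (forall x y, x <= y -> gam y <= gam x) ->
  (forall x, 0 <= x <= L -> gam (phi x) = x) -> (forall x, 0 <= phi x) ->
  forall x y, 0 <= x -> x <= y -> y <= L ->
  F x + G (phi x) - x * phi x = F y + G (phi y) - y * phi y.
Proof.
move=> dF dG mphi mgam gphi phi0 a b a0 ab bL.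
apply: (@constant_of_quadratic (fun x => F x + G (phi x) - x * phi x) phi a b ab).
move=> x y ax xy yb.
have x0 : 0 <= x by exact: le_trans ax.
have [t /andP[t1 t2] e1] := primitive_mvt dF (lt_le_trans (ltrN10 _) x0) xy.
have [u /andP[u1 u2] e2] := primitive_mvt dG (lt_le_trans (ltrN10 _) (phi0 y)) (mphi _ _ xy).
have := mphi _ _ t1; have := mphi _ _ t2.
have := mgam _ _ u1; have := mgam _ _ u2.
rewrite !gphi; [|lra|lra].
move=> gx gy py px.
have -> : F y + G (phi y) - y * phi y - (F x + G (phi x) - x * phi x) =
  phi t * (y - x) - gam u * (phi x - phi y) - y * phi y + x * phi x.
  by rewrite -e1 -e2; ring.
have pxy := mphi _ _ xy.
have h1 : phi t * (y - x) <= phi x * (y - x) by rewrite ler_wpM2r // subr_ge0.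
have h2 : phi y * (y - x) <= phi t * (y - x) by rewrite ler_wpM2r // subr_ge0.
have h3 : x * (phi x - phi y) <= gam u * (phi x - phi y) by rewrite ler_wpM2r // subr_ge0.
have h4 : gam u * (phi x - phi y) <= y * (phi x - phi y) by rewrite ler_wpM2r // subr_ge0.
by rewrite ler_norml; apply/andP; split; lra.
Qed.

Section heights.
Variables (L : R) (f g : R -> R) (sigma tau r s : R).
Hypotheses (L0 : 0 < L) (hc : decreasing_curve L f g).
Hypotheses (sg : - 2^-1 < sigma) (ta : - 2^-1 < tau) (r0 : 0 < r) (s0 : 0 < s).

Local Notation phi := (clampf L f).
Local Notation gam := (clampf L g).
Local Notation n := (column_height phi sigma tau r s).
Local Notation m := (column_height gam tau sigma r s^-1).

Let shift_gt0 (t : R) (j : nat) : - 2^-1 < t -> (0 < j)%N -> 0 < j%:R + t.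
Proof.
move=> t0 j0; have : 1 <= j%:R :> R by rewrite ler1n.
lra.
Qed.

Let eta0 : 0 < s / r. Proof. by rewrite divr_gt0. Qed.
Let eta0' : 0 < s^-1 / r. Proof. by rewrite divr_gt0 ?invr_gt0. Qed.

(** In coordinates scaled by r and s, column j has the abscissa (j + sigma) s / r and
    row k the ordinate (k + tau) / (s r). *)
Lemma column_heightP j k : (0 < j)%N -> (0 < k)%N ->
  (k <= n j)%N = ((k%:R + tau) * (s^-1 / r) <= phi ((j%:R + sigma) * (s / r))).
Proof.
move=> j0 k0; rewrite /column_height truncn_ge_pos // lerBrDr.
have -> : (k%:R + tau) * (s^-1 / r) = (k%:R + tau) / (r * s) by rewrite invfM mulrC [r^-1 * _]mulrC mulrC.
by rewrite ler_pdivrMr ?mulr_gt0 // mulrC.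
Qed.

End heights.

Section duality.
Variables (L : R) (f g : R -> R) (sigma tau r s : R).
Hypotheses (L0 : 0 < L) (hc : decreasing_curve L f g).
Hypotheses (sg : - 2^-1 < sigma) (ta : - 2^-1 < tau) (r0 : 0 < r) (s0 : 0 < s).

Local Notation phi := (clampf L f).
Local Notation gam := (clampf L g).
Local Notation n := (column_height phi sigma tau r s).
Local Notation m := (column_height gam tau sigma r s^-1).

Let shift_gt0 (t : R) (j : nat) : - 2^-1 < t -> (0 < j)%N -> 0 < j%:R + t.
Proof.
move=> t0 j0; have : 1 <= j%:R :> R by rewrite ler1n.
lra.
Qed.

Let eta0 : 0 < s / r. Proof. by rewrite divr_gt0. Qed.
Let eta0' : 0 < s^-1 / r. Proof. by rewrite divr_gt0 ?invr_gt0. Qed.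

Lemma column_height_dual j k : (0 < j)%N -> (0 < k)%N -> (k <= n j)%N = (j <= m k)%N.
Proof.
move=> j0 k0; rewrite column_heightP // (@column_heightP L g tau sigma r s^-1) ?invr_gt0 //.
rewrite invrK; apply: (clampf_dual L0 hc); apply: mulr_gt0 => //; exact: shift_gt0.
Qed.

Lemma column_height_le j : (n j <= column_index tau (s^-1 / r) L)%N.
Proof.
rewrite /column_height /column_index; apply: le_truncn; rewrite lerD2r.
have -> : L / (s^-1 / r) = r * s * L by field; rewrite !gt_eqF.
by rewrite ler_pM2l ?mulr_gt0 //; have /andP[] := clampf_range L0 hc ((j%:R + sigma) * (s / r)).
Qed.

Lemma column_height_out j : (column_index sigma (s / r) L < j)%N -> n j = 0%N.
Proof.
move=> Jj; have j0 : (0 < j)%N by apply: leq_ltn_trans Jj.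
rewrite ltnNge column_indexP // -ltNge in Jj.
rewrite /column_height (clampf_geL L0 hc (ltW Jj)) mulr0 sub0r.
by apply/truncn0Pn; rewrite -ltNge; have ta' := ta; lra.
Qed.

Lemma lattice_count_sum : lattice_count L f sigma tau r s =
  (\sum_(1 <= j < (column_index sigma (s / r) L).+1) n j)%N.
Proof.
apply: card_under_graph; last by move=> j; exact: column_height_out.
move=> [j k]; rewrite /lattice_points /=; split.
  move=> [j0 k0 h1 h2]; split=> //.
  rewrite /column_height truncn_ge_pos // lerBrDr mulrA.
  rewrite clampf_id // ; apply/andP; split => //.
  rewrite divr_ge0 ?(ltW r0) // mulr_ge0 ?(ltW s0) // ltW //; exact: shift_gt0.
move=> [j0 k0 kn].
have jJ : (j <= column_index sigma (s / r) L)%N.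
  rewrite leqNgt; apply/negP => /column_height_out nj; move: kn; rewrite nj; lia.
rewrite column_indexP // mulrA in jJ.
split=> //.
move: kn; rewrite /column_height truncn_ge_pos // lerBrDr mulrA.
rewrite clampf_id //; apply/andP; split => //.
by rewrite divr_ge0 ?(ltW r0) // mulr_ge0 ?(ltW s0) // ltW //; exact: shift_gt0.
Qed.

Lemma height_beyond al j : 0 < al -> al < L -> (column_index sigma (s / r) al < j)%N ->
  (n j <= column_index tau (s^-1 / r) (phi al))%N.
Proof.
move=> al0 alL Mj; have j0 : (0 < j)%N by apply: leq_ltn_trans Mj.
rewrite leqNgt; apply/negP => Kn.
rewrite ltnNge column_indexP // -ltNge in Mj.
rewrite column_heightP // in Kn.
have := le_trans Kn (clampf_nonincr L0 hc (ltW Mj)).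
by rewrite -column_indexP // ltnn.
Qed.

Lemma height_before al j : 0 < al -> al < L -> (0 < j)%N -> (j <= column_index sigma (s / r) al)%N ->
  (column_index tau (s^-1 / r) (phi al) <= n j)%N.
Proof.
move=> al0 alL j0 jM; case K : (column_index _ _ _) => [//|k].
rewrite column_heightP //; rewrite column_indexP // in jM.
apply: le_trans (clampf_nonincr L0 hc jM).
by rewrite -column_indexP // K.
Qed.

End duality.

Section splitting.
Variables (L : R) (f g : R -> R) (sigma tau r s al : R).
Hypotheses (L0 : 0 < L) (hc : decreasing_curve L f g).
Hypotheses (sg : - 2^-1 < sigma) (ta : - 2^-1 < tau) (r0 : 0 < r) (s0 : 0 < s).
Hypotheses (al0 : 0 < al) (alL : al < L).

Local Notation phi := (clampf L f).
Local Notation gam := (clampf L g).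
Local Notation n := (column_height phi sigma tau r s).
Local Notation m := (column_height gam tau sigma r s^-1).
Local Notation M := (column_index sigma (s / r) al).
Local Notation K := (column_index tau (s^-1 / r) (phi al)).
Local Notation J := (column_index sigma (s / r) L).
Local Notation J' := (column_index tau (s^-1 / r) L).

Let eta0 : 0 < s / r. Proof. by rewrite divr_gt0. Qed.
Let eta0' : 0 < s^-1 / r. Proof. by rewrite divr_gt0 ?invr_gt0. Qed.
Let si0 : 0 < s^-1. Proof. by rewrite invr_gt0. Qed.

Let MJ : (M <= J)%N. Proof. by apply: column_index_mono => //; exact: ltW. Qed.
Let KJ : (K <= J')%N.
Proof. by apply: column_index_mono => //; have /andP[] := clampf_range L0 hc al. Qed.

(** The first M columns contain the whole rectangle of M by K points, and above it
    the points counted by the rows beyond K. *)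
Lemma count_convex_split : (lattice_count L f sigma tau r s)%:R =
  (M%:R * K%:R + \sum_(M.+1 <= j < J.+1) (n j)%:R + \sum_(K.+1 <= k < J'.+1) (m k)%:R) :> R.
Proof.
rewrite (lattice_count_sum L0 hc sg ta r0 s0) (big_cat_nat (n := M.+1)) //=.
have hs := decreasing_curve_sym hc.
have dual j k : (0 < j)%N -> (0 < k)%N -> (k <= m j)%N = (j <= n k)%N.
  by move=> j0 k0; rewrite (column_height_dual L0 hc sg ta).
have hK k : (K < k)%N -> (m k <= M)%N.
  move=> Kk; have k0 : (0 < k)%N by apply: leq_ltn_trans Kk.
  rewrite leqNgt; apply/negP; rewrite -(column_height_dual L0 hc sg ta) // => kn.
  have nK : (n M.+1 <= K)%N by exact: (height_beyond tau L0 hc r0 s0 al0 alL (ltnSn M)).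
  by have := leq_trans kn nK; rewrite leqNgt Kk.
have -> : (\sum_(1 <= j < M.+1) n j = M * K + \sum_(K.+1 <= k < J'.+1) m k)%N.
  rewrite (@dual_tail_sum m n K M J' dual hK) //; last first.
    by move=> j j0; apply: (column_height_le sigma tau L0 hc).
  have -> : (M * K = \sum_(1 <= j < M.+1) K)%N by rewrite sum_nat_const_nat subSS subn0.
  rewrite -big_split /=; apply: eq_big_nat => j /andP[j0 jM].
  by rewrite subnKC //; apply: (height_before tau L0 hc).
by rewrite !natrD natrM !natr_sum addrAC.
Qed.

(** Points lie in the first M columns or in the first K rows, and the rectangle of M
    by K points is counted twice.  Subtracting it keeps both sums on the side of
    the curve where the derivatives are controlled. *)
Lemma count_concave_split : (lattice_count L f sigma tau r s)%:R =
  (\sum_(1 <= j < M.+1) (n j)%:R + \sum_(1 <= k < K.+1) (m k)%:R - M%:R * K%:R) :> R.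
Proof.
rewrite (lattice_count_sum L0 hc sg ta r0 s0) (big_cat_nat (n := M.+1)) //=.
have dual j k : (0 < j)%N -> (0 < k)%N -> (k <= n j)%N = (j <= m k)%N.
  by move=> j0 k0; rewrite (column_height_dual L0 hc sg ta).
rewrite (@dual_tail_sum n m M K J dual) //; first last.
- move=> k k0; have := @column_height_le L g f tau sigma r s^-1 L0 (decreasing_curve_sym hc) r0 si0 k.
  by rewrite invrK.
- by move=> j Mj; apply: (height_beyond tau L0 hc).
have -> : M%:R * K%:R = \sum_(1 <= k < K.+1) M%:R :> R.
  by rewrite sumr_const_nat subSS subn0 -[RHS]mulr_natr.
rewrite natrD !natr_sum -addrA -sumrB; congr (_ + _).
apply: eq_big_nat => k /andP[k0 kK]; rewrite natrB //.
case e : M => [//|M']; rewrite -dual //.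
apply: (leq_trans (kK : (k <= K)%N)).
by rewrite -e; apply: (height_before tau L0 hc) => //; rewrite e.
Qed.

End splitting.
End assembly.

(** * Convexity of the curve and of its inverse *)

Section transfer.
Context {R : realType}.
Implicit Types (r s x y : R).

Section prolongation.
Variables (L : R) (f g : R -> R).
Hypotheses (L0 : 0 < L) (hc : decreasing_curve L f g).
Local Notation phi := (clampf L f).
Local Notation gam := (clampf L g).

Lemma clampfK x : 0 <= x <= L -> gam (phi x) = x.
Proof.
move=> hx; rewrite [clampf L f x]clampf_id //; case: hc => -[fin _ _] _ _ fg _.
have : f x \in `[0, L]%R by apply: fin; rewrite /= in_itv.
rewrite in_itv /= => h; rewrite clampf_id //; apply: fg.
by rewrite in_itv.
Qed.

Lemma concave_clampf : concave_curve L f -> convex_on (fun x => -1 * phi x) 0 L.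
Proof.
move=> /convex_function_on h x y z x0 xy yz zL.
have := h x y z x0 xy yz zL.
by rewrite !clampf_id ?mulN1r //; apply/andP; split; lra.
Qed.

Lemma convex_clampf : convex_curve L f -> convex_on phi 0 L.
Proof.
move=> /convex_function_on h x y z x0 xy yz zL.
have := h x y z x0 xy yz zL.
by rewrite !clampf_id //; apply/andP; split; lra.
Qed.

(** A convex curve decreases to 0 at L, so that prolonging it by 0 keeps it convex. *)
Lemma convex_clampf_extend V : convex_on phi 0 L -> convex_on phi 0 V.
Proof.
move=> h x y z x0 xy yz _.
have phi0 t : 0 <= phi t by have /andP[] := clampf_range L0 hc t.
have [zL|Lz] := leP z L; first exact: h.
rewrite (clampf_geL L0 hc (ltW Lz)) mulr0 addr0.
have [Ly|yL] := leP L y.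
  rewrite (clampf_geL L0 hc Ly) mulr0 mulr_ge0 // subr_ge0 //.
have := h x y L x0 xy (ltW yL) (lexx L).
rewrite (clampf_geL L0 hc (lexx L)) mulr0 addr0.
have := clampf_nonincr L0 hc xy => pm h1.
have : (z - L) * phi y <= (z - L) * phi x by rewrite ler_pM2l // subr_gt0.
lra.
Qed.

End prolongation.

Section inverse.
Variables (L : R) (f g : R -> R).
Hypotheses (L0 : 0 < L) (hc : decreasing_curve L f g).
Local Notation phi := (clampf L f).
Local Notation gam := (clampf L g).

Let hs := decreasing_curve_sym hc.

(* The mean w of the two values of gam lies between them, and the chord of phi over
   gam z and gam x passes through (w, y). *)
Let inverse_average x y z : 0 <= x -> x <= y -> y <= z -> z <= L -> x < z ->
  exists w, [/\ 0 <= w, w <= L, (z - x) * w = (z - y) * gam x + (y - x) * gam z,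
   gam z <= w <= gam x & (gam x - gam z) * y = (gam x - w) * z + (w - gam z) * x].
Proof.
move=> x0 xy yz zL xz.
have xz0 : 0 < z - x by rewrite subr_gt0.
have gm : gam z <= gam x by apply: (clampf_nonincr L0 hs); exact: ltW.
have /andP[gz0 gzL] := clampf_range L0 hs z.
have /andP[gx0 gxL] := clampf_range L0 hs x.
pose w := ((z - y) * gam x + (y - x) * gam z) / (z - x).
have wE : (z - x) * w = (z - y) * gam x + (y - x) * gam z.
  by rewrite /w mulrC divfK // gt_eqF.
have w1 : gam z <= w.
  rewrite -(ler_pM2l xz0) wE.
  have : 0 <= (z - y) * (gam x - gam z) by rewrite mulr_ge0 ?subr_ge0.
  lra.
have w2 : w <= gam x.
  rewrite -(ler_pM2l xz0) wE.
  have : 0 <= (y - x) * (gam x - gam z) by rewrite mulr_ge0 ?subr_ge0.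
  lra.
exists w; split => //; [exact: le_trans w1|exact: le_trans gxL|by rewrite w1|].
apply: (mulfI (_ : z - x != 0)); first by rewrite gt_eqF.
transitivity ((gam x * (z - x) - ((z - x) * w)) * z + ((z - x) * w - gam z * (z - x)) * x).
  by rewrite wE; ring.
ring.
Qed.

Lemma concave_inverse : convex_on (fun x => -1 * phi x) 0 L ->
  convex_on (fun x => -1 * gam x) 0 L.
Proof.
move=> h x y z x0 xy yz zL.
have [e|ne] := eqVneq x z.
  have -> : y = x by apply/eqP; rewrite eq_le xy andbT e.
  lra.
have xz : x < z by rewrite lt_neqAle ne (le_trans xy).
have [w [w0 wL wE /andP[w1 w2] yE]] := inverse_average x0 xy yz zL xz.
have /andP[gz0 gzL] := clampf_range L0 hs z.
have /andP[gx0 gxL] := clampf_range L0 hs x.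
have := h (gam z) w (gam x) gz0 w1 w2 gxL.
have pg t : 0 <= t <= L -> phi (gam t) = t by exact: (clampfK hs).
rewrite !pg; [|lra|lra]; move=> hw.
have xz0 : 0 < z - x by rewrite subr_gt0.
suff : w <= gam y by move=> wy; have := ler_wpM2l (ltW xz0) wy; rewrite wE; lra.
have [gg|gg] := leP (gam x) (gam z).
  have ge : gam x = gam z by apply/eqP; rewrite eq_le gg (clampf_nonincr L0 hs (ltW xz)).
  have : phi (gam x) = phi (gam z) by rewrite ge.
  by rewrite !pg; [move=> e; move: ne; rewrite e eqxx|lra|lra].
have yw : y <= phi w.
  rewrite -(ler_pM2l (_ : 0 < gam x - gam z)) ?subr_gt0 // yE; lra.
rewrite -[leLHS](clampfK hc (_ : 0 <= w <= L)) ?w0 //.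
exact: (clampf_nonincr L0 hs).
Qed.

Lemma convex_inverse : convex_on phi 0 L -> convex_on gam 0 L.
Proof.
move=> h x y z x0 xy yz zL.
have [e|ne] := eqVneq x z.
  have -> : y = x by apply/eqP; rewrite eq_le xy andbT e.
  lra.
have xz : x < z by rewrite lt_neqAle ne (le_trans xy).
have [w [w0 wL wE /andP[w1 w2] yE]] := inverse_average x0 xy yz zL xz.
have /andP[gz0 gzL] := clampf_range L0 hs z.
have /andP[gx0 gxL] := clampf_range L0 hs x.
have := h (gam z) w (gam x) gz0 w1 w2 gxL.
have pg t : 0 <= t <= L -> phi (gam t) = t by exact: (clampfK hs).
rewrite !pg; [|lra|lra]; move=> hw.
have xz0 : 0 < z - x by rewrite subr_gt0.
suff : gam y <= w by move=> wy; have := ler_wpM2l (ltW xz0) wy; rewrite wE; lra.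
have [gg|gg] := leP (gam x) (gam z).
  have ge : gam x = gam z by apply/eqP; rewrite eq_le gg (clampf_nonincr L0 hs (ltW xz)).
  have : phi (gam x) = phi (gam z) by rewrite ge.
  by rewrite !pg; [move=> e; move: ne; rewrite e eqxx|lra|lra].
have yw : phi w <= y.
  rewrite -(ler_pM2l (_ : 0 < gam x - gam z)) ?subr_gt0 // yE; lra.
rewrite -[leRHS](clampfK hc (_ : 0 <= w <= L)) ?w0 //.
exact: (clampf_nonincr L0 hs).
Qed.

(** A concave decreasing curve is steepest at its end, where the slope of a chord up
    to L is at most L / (L - v). *)
Lemma concave_lipschitz v : v < L -> convex_on (fun x => -1 * phi x) 0 L ->
  lipschitz_on phi (L / (L - v)) 0 v.
Proof.
move=> vL h x y x0 xy yv.
have vL0 : 0 < L - v by rewrite subr_gt0.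
have := h x y L x0 xy ltac:(lra) (lexx _).
rewrite (clampf_geL L0 hc (lexx L)) => h1.
have pm := clampf_nonincr L0 hc xy.
have /andP[_ pL] := clampf_range L0 hc y.
rewrite distrC ger0_norm ?subr_ge0 // mulrAC ler_pdivlMr //.
have h2 : (y - x) * phi y <= (y - x) * L by rewrite ler_wpM2l // subr_ge0.
have h3 : (phi x - phi y) * (L - v) <= (phi x - phi y) * (L - y).
  by rewrite ler_wpM2l ?subr_ge0 // lerD2l lerN2.
lra.
Qed.

(** A convex decreasing curve is steepest at its beginning. *)
Lemma convex_lipschitz u V : 0 < u -> convex_on phi 0 V ->
  lipschitz_on phi (L / u) u V.
Proof.
move=> u0 h x y ux xy yV.
have x0 : 0 <= x by lra.
have := h 0 x y (lexx _) x0 xy yV; rewrite (clampf_le0 L0 hc (lexx 0)) !subr0 => h1.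
have pm := clampf_nonincr L0 hc xy.
have /andP[p0 _] := clampf_range L0 hc x.
rewrite distrC ger0_norm ?subr_ge0 // mulrAC ler_pdivlMr //.
have h3 : (phi x - phi y) * u <= (phi x - phi y) * x.
  by rewrite ler_wpM2l ?subr_ge0.
have h4 : 0 <= (y - x) * phi x by rewrite mulr_ge0 ?subr_ge0.
lra.
Qed.

Lemma area_primitive (F : R -> R) :
  (forall a b, -1 < a -> a < b ->
      (\int[lebesgue_measure]_(x in `[a, b]) phi x)%R = F b - F a) ->
  area L f = F L - F 0.
Proof.
move=> hF; rewrite -hF // /area /Rintegral; congr fine.
apply: eq_integral => x; rewrite inE /= in_itv /= => hx.
by rewrite clampf_id.
Qed.

End inverse.
End transfer.

(** * Two-term asymptotics of the count *)

Section asymptotic.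
Context {R : realType}.
Implicit Types (r s x y : R).

(** The two sides end at nodes close to the corner (al, be), not at the corner; the
    first order effects cancel against the rectangle of M by K points, and the
    product of the two deviations remains. *)
Lemma corner_error (sigma tau al be r s : R) : 0 < al -> 0 < be -> 0 < s -> 0 < r ->
  0 <= al / (s / r) - sigma -> 0 <= be / (s^-1 / r) - tau ->
  `|r ^+ 2 * (((column_index sigma (s / r) al)%:R + 2^-1 + sigma) * (s / r) - al)
     * (((column_index tau (s^-1 / r) be)%:R + 2^-1 + tau) * (s^-1 / r) - be)| <= 1.
Proof.
move=> al0 be0 s0 r0 h1 h2.
have e1 : 0 < s / r by rewrite divr_gt0.
have e2 : 0 < s^-1 / r by rewrite divr_gt0 ?invr_gt0.
have n1 := node_near e1 al0 h1; have n2 := node_near e2 be0 h2.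
rewrite normrM [X in X * _ <= _]normrM (ger0_norm (sqr_ge0 r)).
apply: (@le_trans _ _ (r ^+ 2 * (s / r / 2) * (s^-1 / r / 2))).
  apply: ler_pM => //; first by rewrite mulr_ge0 // sqr_ge0.
  by apply: ler_wpM2l => //; exact: sqr_ge0.
have -> : r ^+ 2 * (s / r / 2) * (s^-1 / r / 2) = 4^-1 by field; rewrite !gt_eqF.
lra.
Qed.

Lemma powR_const_le (K e r : R) : 2 / 3 <= e -> 1 <= r -> 0 <= K -> K <= K * r `^ e.
Proof. by move=> e0 r1 K0; rewrite ler_peMr // powR_exponent_ge1. Qed.

(** Half a point per unit length of the two axes, corrected by the shifts; this is
    what the stretch factor can influence. *)
Definition second_term (L sigma tau r s : R) : R :=
  r * L * (s * (sigma + 2^-1) + s^-1 * (tau + 2^-1)).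

Section cases.
Variables (L : R) (f g : R -> R) (sigma tau a1 a2 a3 b1 b2 b3 c1 c2 al be e : R).
Hypotheses (L0 : 0 < L) (hc : decreasing_curve L f g).
Hypotheses (sg : - 2^-1 < sigma) (ta : - 2^-1 < tau).
Hypotheses (a10 : 0 < a1) (b10 : 0 < b1) (e0 : 2 / 3 <= e)
  (ea1 : 1 - 2 * a1 <= e) (ea2 : 1 - 2 * a2 <= e)
  (eb1 : 1 - 2 * b1 <= e) (eb2 : 1 - 2 * b2 <= e).
Hypotheses (c10 : 0 < c1) (c20 : 0 < c2).
Hypotheses (al0 : 0 < al) (alL : al < L) (beE : be = f al).

Local Notation phi := (clampf L f).
Local Notation gam := (clampf L g).
Let hs := decreasing_curve_sym hc.

Let beE' : phi al = be.
Proof. by rewrite clampf_id ?beE // ?ltW // ltW. Qed.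

Let be0 : 0 < be.
Proof. by rewrite -beE'; exact: (clampf_gt0 L0 hc). Qed.

Let beL : be < L.
Proof.
have := clampf_decr hc (lexx 0) al0 (ltW alL).
by rewrite beE' (clampf_le0 L0 hc (lexx 0)).
Qed.

Let gbe : gam be = al.
Proof. by rewrite -beE'; apply: (clampfK hc); rewrite !ltW. Qed.

Let ci10 : 0 < c1^-1. Proof. by rewrite invr_gt0. Qed.
Let ci20 : 0 < c2^-1. Proof. by rewrite invr_gt0. Qed.

Let ci_range s : c1 <= s <= c2 -> c2^-1 <= s^-1 <= c1^-1.
Proof.
move=> /andP[h1 h2]; have s0 : 0 < s by exact: lt_le_trans h1.
by rewrite !lef_pV2 ?h1 ?h2.
Qed.

Let primitives : exists F G : R -> R, [/\
  forall x, -1 < x -> is_derive x 1 F (phi x),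
  forall x, -1 < x -> is_derive x 1 G (gam x) &
  [/\ F L = area L f + F 0, G L = area L f + G 0 &
    F al = area L f + al * be + F 0 - (G be - G 0)]].
Proof.
have [F [dF iF]] := continuous_primitive (clampf_continuous L0 hc).
have [G [dG iG]] := continuous_primitive (clampf_continuous L0 hs).
exists F, G; split=> //.
have aF := area_primitive L0 iF.
have pm x y : x <= y -> phi y <= phi x by exact: (clampf_nonincr L0 hc).
have gm x y : x <= y -> gam y <= gam x by exact: (clampf_nonincr L0 hs).
have gp x : 0 <= x <= L -> gam (phi x) = x by exact: (clampfK hc).
have p0 x : 0 <= phi x by have /andP[] := clampf_range L0 hc x.
have h1 := legendre_area dF dG pm gm gp p0 (lexx 0) (ltW L0) (lexx L).
have h2 := legendre_area dF dG pm gm gp p0 (lexx 0) (ltW al0) (ltW alL).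
rewrite (clampf_le0 L0 hc (lexx 0)) (clampf_geL L0 hc (lexx L)) in h1.
rewrite (clampf_le0 L0 hc (lexx 0)) beE' in h2.
split; lra.
Qed.

(** The sides are those of f with factor s and of g with factor 1 / s; the integration
    by parts formula turns the two partial areas into the total area plus al be,
    which the rectangle of M by K points absorbs. *)
Lemma concave_asymptotic : convex_on (fun x => -1 * phi x) 0 L ->
  concave_side al f a1 a2 -> concave_side be g b1 b2 ->
  exists C R0 : R, [/\ 0 < C, 1 <= R0 & forall r s, R0 <= r -> c1 <= s <= c2 ->
    `|(lattice_count L f sigma tau r s)%:R
      - (r ^+ 2 * area L f - second_term L sigma tau r s)| <= C * r `^ e].
Proof.
move=> hconv hf hg; have hconvg := concave_inverse L0 hc hconv.
have [F [G [dF dG [FL GL Fal]]]] := primitives.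
pose al' := (al + L) / 2; pose be' := (be + L) / 2.
have alal' : al < al' by rewrite /al'; have := alL; lra.
have al'L : al' < L by rewrite /al'; have := alL; lra.
have bebe' : be < be' by rewrite /be'; have := beL; lra.
have be'L : be' < L by rewrite /be'; have := beL; lra.
have hB := concave_lipschitz L0 hc al'L hconv.
have hBg := concave_lipschitz L0 hs be'L hconvg.
set B := L / (L - al') in hB; set B' := L / (L - be') in hBg.
have B0 : 0 <= B by rewrite divr_ge0 ?subr_ge0 ?ltW.
have B'0 : 0 <= B' by rewrite divr_ge0 ?subr_ge0 ?ltW.
have cs1 := @concave_colsum R L f g sigma tau c1 c2 al B e a1 a2 L0 hc c10 c20 B0 al0 alL
  a10 e0 ea1 ea2 (lipschitz_on_sub (lexx 0) (ltW alal') hB) hf.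
have cs2 := @concave_colsum R L g f tau sigma c2^-1 c1^-1 be B' e b1 b2 L0 hs ci20 ci10 B'0 be0 beL
  b10 e0 eb1 eb2 (lipschitz_on_sub (lexx 0) (ltW bebe') hBg) hg.
have ph0 : 0 < phi al by rewrite beE'.
have gh0 : 0 < gam be by rewrite gbe.
have pm x y : x <= y -> phi y <= phi x by exact: (clampf_nonincr L0 hc).
have gm x y : x <= y -> gam y <= gam x by exact: (clampf_nonincr L0 hs).
have [C1 [R1 [C10 R11 h1]]] := concave_side_count dF c10 c20 B0 al0 sg e0 alal' ph0
  (clampf_le0 L0 hc (lexx 0)) (convex_on_sub (lexx 0) (ltW al'L) hconv) hB pm cs1.
have [C2 [R2 [C20 R21 h2]]] := concave_side_count dG ci20 ci10 B'0 be0 ta e0 bebe' gh0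
  (clampf_le0 L0 hs (lexx 0)) (convex_on_sub (lexx 0) (ltW be'L) hconvg) hBg gm cs2.
pose D := 1 + `|(sigma + 2^-1) * (tau + 2^-1)|.
have D0 : 0 <= D by rewrite addr_ge0.
exists (C1 + C2 + D), (Num.max (Num.max R1 R2)
  (Num.max (c2 * (1 + `|sigma|) / al) (c1^-1 * (1 + `|tau|) / be))); split.
- by rewrite ltr_wpDr // addr_gt0.
- by rewrite !le_max R11.
move=> r s; rewrite !ge_max => /andP[/andP[rR1 rR2] /andP[rR3 rR4]] hs12.
have /andP[cs sc] := hs12; have /andP[cs' sc'] := ci_range hs12.
have r1 : 1 <= r by exact: le_trans rR1.
have r0 : 0 < r by exact: lt_le_trans r1.
have s0 : 0 < s by exact: lt_le_trans cs.
have si0 : 0 < s^-1 by rewrite invr_gt0.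
have hr1 := h1 r s rR1 hs12; have hr2 := h2 r s^-1 rR2 (ci_range hs12).
rewrite beE' gbe in hr1 hr2.
have hcorner := corner_error al0 be0 s0 r0 (index_arg_ge0 al0 s0 sc r0 rR3)
  (index_arg_ge0 be0 si0 sc' r0 rR4).
have hD := powR_const_le e0 r1 D0.
have := @count_concave_split R L f g sigma tau r s al L0 hc sg ta r0 s0 al0 alL.
rewrite beE' => ->.
move: hr1 hr2 hcorner.
set S1 := \sum_(1 <= j < _) _; set S2 := \sum_(1 <= j < _) _.
set m := (column_index sigma _ _)%:R; set k := (column_index tau _ _)%:R.
set T1 := r ^+ 2 * (F al - F 0) - _ + _ - _.
set T2 := r ^+ 2 * (G be - G 0) - _ + _ - _.
set E := r ^+ 2 * _ * _ => hr1 hr2 hcorner.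
have key : S1 + S2 - m * k - (r ^+ 2 * area L f - second_term L sigma tau r s)
  = (S1 - T1) + (S2 - T2) - E + (sigma + 2^-1) * (tau + 2^-1).
  rewrite /T1 /T2 /E /second_term Fal; field.
  by rewrite !gt_eqF.
rewrite key {key}; have hst := ler_norm ((sigma + 2^-1) * (tau + 2^-1)).
have hst' := ler_norm (- ((sigma + 2^-1) * (tau + 2^-1))); rewrite normrN in hst'.
move: hr1 hr2 hcorner hD hst hst'; rewrite /D.
move: (S1 - T1) (S2 - T2) E ((sigma + 2^-1) * (tau + 2^-1)) (r `^ e).
move=> X1 X2 X3 X4 P; rewrite !ler_norml => /andP[? ?] /andP[? ?] /andP[? ?] ? ? ?.
by apply/andP; split; lra.
Qed.

Lemma convex_asymptotic : convex_on phi 0 L -> 0 < a3 -> 0 < b3 ->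
  1 - 2 * a3 <= e -> 1 - 2 * b3 <= e ->
  convex_side L al f a1 a2 a3 -> convex_side L be g b1 b2 b3 ->
  exists C R0 : R, [/\ 0 < C, 1 <= R0 & forall r s, R0 <= r -> c1 <= s <= c2 ->
    `|(lattice_count L f sigma tau r s)%:R
      - (r ^+ 2 * area L f - second_term L sigma tau r s)| <= C * r `^ e].
Proof.
move=> hconv a30 b30 ea3 eb3 hf hg; have hconvg := convex_inverse L0 hc hconv.
have [F [G [dF dG [FL GL Fal]]]] := primitives.
have hcx : convex_on phi 0 (L + 1) by exact: (convex_clampf_extend L0 hc).
have hcxg : convex_on gam 0 (L + 1) by exact: (convex_clampf_extend L0 hs).
have al20 : 0 < al / 2 by rewrite divr_gt0.
have be20 : 0 < be / 2 by rewrite divr_gt0.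
have hB := convex_lipschitz L0 hc al20 hcx.
have hBg := convex_lipschitz L0 hs be20 hcxg.
set B := L / (al / 2) in hB; set B' := L / (be / 2) in hBg.
have B0 : 0 <= B by rewrite divr_ge0 ?ltW.
have B'0 : 0 <= B' by rewrite divr_ge0 ?ltW.
have L1 : L <= L + 1 by rewrite lerDl.
have al2 : al / 2 <= al by have := al0; lra.
have be2 : be / 2 <= be by have := be0; lra.
have cs1 := @convex_colsum R L f g sigma tau c1 c2 al B e a1 a2 L0 hc c10 c20 B0 al0 alL
  a10 e0 ea1 ea2 a3 (lipschitz_on_sub al2 L1 hB) hf.
have cs2 := @convex_colsum R L g f tau sigma c2^-1 c1^-1 be B' e b1 b2 L0 hs ci20 ci10 B'0 be0 beL
  b10 e0 eb1 eb2 b3 (lipschitz_on_sub be2 L1 hBg) hg.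
have phi0 x : 0 <= phi x by have /andP[] := clampf_range L0 hc x.
have gam0 x : 0 <= gam x by have /andP[] := clampf_range L0 hs x.
have phiL x : phi x <= L by have /andP[] := clampf_range L0 hc x.
have gamL x : gam x <= L by have /andP[] := clampf_range L0 hs x.
have near0 (h : R -> R) (c : R) : isO 0^'+ (fun x => h x - L) (fun x => x `^ (2 * c)) ->
    exists K d : R, [/\ 0 < K, 0 < d & forall y, 0 < y -> y < d -> `|clampf L h y - L| <= K * y `^ (2 * c)].
  move=> /isO_right[K [d [K0 d0 hK]]]; exists K, (Num.min d L); split=> //.
    by rewrite lt_min d0.
  move=> y y0; rewrite lt_min => /andP[yd yL].
  rewrite clampf_id ?(ltW y0) ?(ltW yL) //; have := hK y y0 yd.
  by rewrite (ger0_norm (powR_ge0 _ _)).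
have nf : isO 0^'+ (fun x => f x - L) (fun x => x `^ (2 * a3)) by case: hf.
have ng : isO 0^'+ (fun x => g x - L) (fun x => x `^ (2 * b3)) by case: hg.
have [C1 [R1 [C10 R11 h1]]] := convex_side_count dF c10 c20 B0 al0 sg e0 alL
  (clampf_geL L0 hc (lexx L)) hcx hB phi0 (fun x y => @clampf_dual R L f g L0 hc x y)
  b30 eb3 (near0 g b3 ng) gamL cs1.
have [C2 [R2 [C20 R21 h2]]] := convex_side_count dG ci20 ci10 B'0 be0 ta e0 beL
  (clampf_geL L0 hs (lexx L)) hcxg hBg gam0 (fun x y => @clampf_dual R L g f L0 hs x y)
  a30 ea3 (near0 f a3 nf) phiL cs2.
pose D := 1 + `|(sigma + 2^-1) * (tau + 2^-1)|.
have D0 : 0 <= D by rewrite addr_ge0.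
exists (C1 + C2 + D), (Num.max (Num.max R1 R2)
  (Num.max (c2 * (1 + `|sigma|) / al) (c1^-1 * (1 + `|tau|) / be))); split.
- by rewrite ltr_wpDr // addr_gt0.
- by rewrite !le_max R11.
move=> r s; rewrite !ge_max => /andP[/andP[rR1 rR2] /andP[rR3 rR4]] hs12.
have /andP[cs sc] := hs12; have /andP[cs' sc'] := ci_range hs12.
have r1 : 1 <= r by exact: le_trans rR1.
have r0 : 0 < r by exact: lt_le_trans r1.
have s0 : 0 < s by exact: lt_le_trans cs.
have si0 : 0 < s^-1 by rewrite invr_gt0.
have hr1 := h1 r s rR1 hs12; have hr2 := h2 r s^-1 rR2 (ci_range hs12).
rewrite beE' gbe in hr1 hr2.
have hcorner := corner_error al0 be0 s0 r0 (index_arg_ge0 al0 s0 sc r0 rR3)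
  (index_arg_ge0 be0 si0 sc' r0 rR4).
have hD := powR_const_le e0 r1 D0.
have := @count_convex_split R L f g sigma tau r s al L0 hc sg ta r0 s0 al0 alL.
rewrite beE' => ->.
move: hr1 hr2 hcorner.
set S1 := \sum_(_ <= j < _) _; set S2 := \sum_(_ <= j < _) _.
set m := (column_index sigma _ _)%:R; set k := (column_index tau _ _)%:R.
set T1 := r ^+ 2 * (F L - F al) - _ - _.
set T2 := r ^+ 2 * (G L - G be) - _ - _.
set E := r ^+ 2 * _ * _ => hr1 hr2 hcorner.
have key : m * k + S1 + S2 - (r ^+ 2 * area L f - second_term L sigma tau r s)
  = (S1 - T1) + (S2 - T2) + E - (sigma + 2^-1) * (tau + 2^-1).
  rewrite /T1 /T2 /E /second_term FL GL Fal; field.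
  by rewrite !gt_eqF.
rewrite key {key}; have hst := ler_norm ((sigma + 2^-1) * (tau + 2^-1)).
have hst' := ler_norm (- ((sigma + 2^-1) * (tau + 2^-1))); rewrite normrN in hst'.
move: hr1 hr2 hcorner hD hst hst'; rewrite /D.
move: (S1 - T1) (S2 - T2) E ((sigma + 2^-1) * (tau + 2^-1)) (r `^ e).
move=> X1 X2 X3 X4 P; rewrite !ler_norml => /andP[? ?] /andP[? ?] /andP[? ?] ? ? ?.
by apply/andP; split; lra.
Qed.

End cases.
End asymptotic.

(** * Upper bounds away from the optimum *)

Section upper.
Context {R : realType}.
Implicit Types (r s x y eta : R).

Lemma neg_part_bounds x : - 2^-1 < x ->
  [/\ 0 <= neg_part x, neg_part x < 2^-1 & - neg_part x <= x].
Proof.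
move=> x2; rewrite /neg_part; case: ifP => [x0|/negbT]; first by split; lra.
by rewrite -ltNge => x0; rewrite ltr0_norm //; split; lra.
Qed.

Section curve.
Variables (L : R) (f g F : R -> R) (sigma : R).
Hypotheses (L0 : 0 < L) (hc : decreasing_curve L f g).
Hypothesis sg : - 2^-1 < sigma.
Local Notation phi := (clampf L f).
Hypothesis dF : forall x, -1 < x -> is_derive x 1 F (phi x).

Let phi0 x : 0 <= phi x. Proof. by have /andP[] := clampf_range L0 hc x. Qed.
Let phiL x : phi x <= L. Proof. by have /andP[] := clampf_range L0 hc x. Qed.

Local Notation X eta j := ((j%:R + sigma) * eta).

Let X_gt0 eta (j : nat) : 0 < eta -> (0 < j)%N -> 0 < X eta j.
Proof.
move=> h0 j0; rewrite mulr_gt0 //; have : 1 <= j%:R :> R by rewrite ler1n.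
have sg' := sg; lra.
Qed.

Lemma primitive_mono x y : -1 < x -> x <= y -> F x <= F y.
Proof.
move=> x1 xy; have [t _ e] := primitive_mvt dF x1 xy.
by rewrite -subr_ge0 e mulr_ge0 // subr_ge0.
Qed.

Lemma primitive_max x : 0 <= x -> F x <= F L.
Proof.
move=> x0; have x1 : -1 < x by lra.
have L1 : -1 < L by have := L0; lra.
have [xL|Lx] := leP x L; first exact: primitive_mono.
have [t /andP[t1 _] e] := primitive_mvt dF L1 (ltW Lx).
by rewrite -subr_le0 e (clampf_geL L0 hc t1) mul0r.
Qed.

Lemma area_gt0 : 0 < F L - F 0.
Proof.
have L0' := L0.
have [t /andP[t1 t2] e] := @primitive_mvt R phi F dF 0 (L / 2) ltac:(lra) ltac:(lra).
have := primitive_mono (_ : -1 < L / 2) (_ : L / 2 <= L).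
have : 0 < phi t * (L / 2 - 0).
  by rewrite subr0 mulr_gt0 ?divr_gt0 // (clampf_gt0 L0 hc) //; lra.
rewrite -e => h1 h2; have := h2 ltac:(lra) ltac:(lra); lra.
Qed.


Local Notation sm := (neg_part sigma).

(** The chord of a concave graph lies below it; in terms of the symmetric second
    difference, the trapezoid is the midpoint rectangle with the largest defect. *)
Lemma trapezoid_le x y : convex_on (fun x => -1 * phi x) 0 L -> 0 <= x -> x <= y -> y <= L ->
  (y - x) / 2 * (phi x + phi y) <= F y - F x.
Proof.
move=> hconv x0 xy yL.
have [->|ne] := eqVneq x y; first by rewrite !subrr !mul0r.
have {}xy : x < y by rewrite lt_neqAle ne.
pose m := (x + y) / 2; pose w := (y - x) / 2.
have w0 : 0 < w by rewrite /w; lra.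
have mx : m - w = x by rewrite /m /w; field.
have my : m + w = y by rewrite /m /w; field.
have H := @midpoint_cell R phi F dF m w (phi x + phi y - 2 * phi m) 0 w0 ltac:(lra).
have {H} := H (fun t t0 tw => ltac:(have := @convex_on_sym R _ 0 L m t w hconv t0 tw
    ltac:(lra) ltac:(lra); rewrite mx my; lra)).
rewrite mx my => /andP[h _]; move: h; rewrite -/w; lra.
Qed.

(** Inscribed trapezoids fill the region under a concave curve up to the last column
    X J; their sum exceeds the Riemann sum by
    eta / 2 ((1 + sigma) L + sigma phi (X 1) - phi (X J)).  The first two
    terms are at least (1 - 2 sm) L; the last node satisfies X J > L - eta and
    X J >= (1 - sm) eta, hence lies to the right of the point at which the
    hypothesis of the concave case evaluates f. *)
Lemma concave_riemann : convex_on (fun x => -1 * phi x) 0 L ->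
  forall eta, 0 < eta -> (0 < column_index sigma eta L)%N ->
  eta * (\sum_(1 <= j < (column_index sigma eta L).+1) phi (X eta j))
    <= F L - F 0 - ((1 - 2 * sm) * L - phi ((1 - sm) / (2 - sm) * L)) / 2 * eta.
Proof.
move=> hconv eta h0; case Je : (column_index _ _ _) => [//|J] _.
have XS j : X eta j.+1 = X eta j + eta by rewrite -(natr1 j); ring.
have XJ : X eta J.+1 <= L by rewrite -column_indexP // Je.
have XJ1 : L < X eta J.+1 + eta by rewrite -XS ltNge -column_indexP // Je ltnn.
have Xle j : (j <= J.+1)%N -> X eta j <= L.
  move=> jJ; apply: le_trans XJ; rewrite ler_pM2r // lerD2r ler_nat //.
have base j : (j <= J)%N ->
    X eta 1%N / 2 * (L + phi (X eta 1%N)) + eta * (\sum_(1 <= i < j.+2) phi (X eta i))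
     - eta / 2 * (phi (X eta 1%N) + phi (X eta j.+1)) <= F (X eta j.+1) - F 0.
  elim: j => [|j IH] jJ.
    have := trapezoid_le hconv (lexx 0) (ltW (X_gt0 h0 (ltn0Sn 0))) (Xle 1%N ltac:(lia)).
    by rewrite (clampf_le0 L0 hc (lexx 0)) big_nat1; lra.
  have h1 := IH (ltnW jJ).
  rewrite big_nat_recr //=.
  have := trapezoid_le hconv (ltW (X_gt0 h0 (ltn0Sn j))) (_ : _ <= X eta j.+2) (Xle j.+2 ltac:(lia)).
  rewrite {1}(XS j.+1) lerDl (ltW h0) => /(_ isT).
  rewrite {1}(XS j.+1) => h2; move: h1 h2; lra.
have := base J (leqnn J).
have [s0 s1 s2] := neg_part_bounds sg.
have FJ : F (X eta J.+1) <= F L by apply: primitive_max; exact: ltW (X_gt0 _ _).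
have X1 : X eta 1%N = (1 + sigma) * eta by [].
have X1J : X eta 1%N <= X eta J.+1 by rewrite ler_pM2r // lerD2r ler_nat.
have pJ : phi (X eta J.+1) <= phi ((1 - sm) / (2 - sm) * L).
  apply: (clampf_nonincr L0 hc).
  rewrite mulrAC ler_pdivrMr; last by lra.
  have : (1 - sm) * (L - eta) <= (1 - sm) * X eta J.+1 by rewrite ler_wpM2l; lra.
  have : (1 - sm) * eta <= X eta 1%N by rewrite X1 ler_wpM2r; [|lra|lra].
  by move: X1J; lra.
have p1 := phiL (X eta 1%N); have p1' := phi0 (X eta 1%N).
have key : (1 - 2 * sm) * L <= (1 + sigma) * L + sigma * phi (X eta 1%N).
  have L0' := L0.
  have := ler_wpM2r (ltW L0) s2; have := ler_wpM2r p1' s2.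
  have : sm * phi (X eta 1%N) <= sm * L by rewrite ler_wpM2l.
  by lra.
have : eta * ((1 - 2 * sm) * L - phi ((1 - sm) / (2 - sm) * L))
   <= eta * ((1 + sigma) * L + sigma * phi (X eta 1%N) - phi (X eta J.+1)).
  by rewrite ler_wpM2l ?(ltW h0) //; lra.
by rewrite X1 in FJ *; move: FJ; lra.
Qed.

(** For a convex curve the cells of width eta centred at the nodes contain more area
    than the rectangles; they start at (1/2 + sigma) eta, and the area to the
    left of this point is lost. *)
Lemma convex_riemann : convex_on phi 0 L ->
  forall eta, 0 < eta -> (0 < column_index sigma eta L)%N ->
  eta * (\sum_(1 <= j < (column_index sigma eta L).+1) phi (X eta j))
    <= F L - F 0 - (2^-1 + sigma) * phi ((2^-1 + sigma) / (1 + sigma) * L) * eta.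
Proof.
move=> hconv eta h0 J0; set J := column_index _ _ _ in J0 *.
have sg' := sg; have sg1 : 0 < 2^-1 + sigma by lra.
have hco V : convex_on phi 0 V by exact: (convex_clampf_extend L0 hc).
have cell (j : nat) : (0 < j)%N ->
    eta * phi (X eta j) <= F (X eta j + eta / 2) - F (X eta j - eta / 2).
  move=> j0; have j1 : 1 <= j%:R :> R by rewrite ler1n.
  have x2 : 0 <= X eta j - eta / 2.
    rewrite subr_ge0 mulrC [leRHS]mulrC mulrC ler_pM2l //; lra.
  have H := @midpoint_cell R phi F dF (X eta j) (eta / 2) 0 (2 * L) ltac:(lra) ltac:(lra).
  have {H} := H (fun t t0 tw => ltac:(
    have := @convex_on_sym R phi 0 (X eta j + eta / 2) (X eta j) t (eta / 2) (hco _) t0 tw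
      ltac:(lra) (lexx _); have := phiL (X eta j + t); have := phiL (X eta j - t);
    have := phi0 (X eta j); lra)).
  by move=> /andP[+ _]; lra.
have tel (k : nat) : eta * (\sum_(1 <= j < k.+1) phi (X eta j)) <=
    F ((k%:R + sigma) * eta + eta / 2) - F ((2^-1 + sigma) * eta).
  elim: k => [|k IH].
    by rewrite big_nil mulr0 (_ : _ + eta / 2 = (2^-1 + sigma) * eta) ?subrr //; ring.
  rewrite big_nat_recr //= mulrDr; have := cell k.+1 isT.
  rewrite (_ : X eta k.+1 - eta / 2 = X eta k + eta / 2); last by rewrite -(natr1 k); field.
  by move: IH; lra.
have x00 : 0 <= (2^-1 + sigma) * eta by rewrite mulr_ge0 ?ltW.
have XJ0 := X_gt0 h0 J0.
have := tel J; have := @primitive_max (X eta J + eta / 2) ltac:(lra).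
have [t /andP[_ t2] e] := @primitive_mvt R phi F dF 0 _ (ltrN10 R) x00.
have X1L : (1 + sigma) * eta <= L by have := @column_indexP R sigma eta L 1 h0 isT; rewrite J0.
have pt : phi ((2^-1 + sigma) / (1 + sigma) * L) <= phi t.
  apply: (clampf_nonincr L0 hc); apply: (le_trans t2).
rewrite mulrAC ler_pdivlMr; last by lra.
by rewrite -mulrA ler_pM2l // mulrC.
have := ler_wpM2l x00 pt.
move: e; rewrite subr0; lra.
Qed.

Variable tau : R.
Hypothesis ta : - 2^-1 < tau.

(** A deficit c0 eta in the Riemann sum, with eta = s / r, becomes a loss proportional
    to r s in the count. *)
Lemma count_le_riemann (c0 : R) :
  (forall eta, 0 < eta -> (0 < column_index sigma eta L)%N ->
   eta * (\sum_(1 <= j < (column_index sigma eta L).+1) phi (X eta j)) <= F L - F 0 - c0 * eta) ->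
  forall r s, 0 < r -> 0 < s -> lattice_count L f sigma tau r s = 0%N \/
    (lattice_count L f sigma tau r s)%:R
      <= r ^+ 2 * (F L - F 0) - c0 * (r * s) + `|tau| * (r * L / s + 1).
Proof.
move=> hR r s r0 s0; rewrite (lattice_count_sum L0 hc sg ta r0 s0).
have h0 : 0 < s / r by rewrite divr_gt0.
set J := column_index sigma (s / r) L; have [J0|J0] := posnP J.
  by left; rewrite J0 big_geq.
right; have rs0 : 0 < r * s by rewrite mulr_gt0.
have step j : (column_height phi sigma tau r s j)%:R <= r * s * phi (X (s / r) j) + `|tau|.
  rewrite /column_height; have := ler_norm (- tau); rewrite normrN => tn.
  have p0 : 0 <= r * s * phi (X (s / r) j) by rewrite mulr_ge0 ?(ltW rs0).
  have [u0|u0] := leP 0 (r * s * phi (X (s / r) j) - tau).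
    by have /andP[+ _] := truncn_itv u0; lra.
  have -> : Num.truncn (r * s * phi (X (s / r) j) - tau) = 0%N.
    by apply/truncn0Pn; rewrite -ltNge (lt_trans u0).
  by rewrite addr_ge0.
have JL : J%:R <= r * L / s + 1.
  have := @column_indexP R sigma (s / r) L J h0 J0; rewrite leqnn => /esym.
  rewrite mulrA ler_pdivrMr // -ler_pdivlMr // [L * r]mulrC; have sg' := sg; lra.
rewrite natr_sum.
apply: (@le_trans _ _ (\sum_(1 <= j < J.+1) (r * s * phi (X (s / r) j) + `|tau|))).
  by apply: ler_sum => j _; exact: step.
rewrite big_split /= sumr_const_nat subSS subn0 -mulr_sumr.
have := hR _ h0 J0; rewrite -(ler_pM2l (exprn_gt0 2 r0)) => h1.
have e1 : r ^+ 2 * (s / r * (\sum_(1 <= j < J.+1) phi (X (s / r) j))) =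
   r * s * (\sum_(1 <= j < J.+1) phi (X (s / r) j)) by field; rewrite gt_eqF.
have e2 : r ^+ 2 * (F L - F 0 - c0 * (s / r)) = r ^+ 2 * (F L - F 0) - c0 * (r * s).
  by field; rewrite gt_eqF.
rewrite e1 e2 in h1; apply: lerD => //.
have := ler_wpM2l (normr_ge0 tau) JL.
by rewrite mulr_natr.
Qed.

End curve.

Section dual.
Variables (L : R) (f g : R -> R) (sigma tau : R).
Hypotheses (L0 : 0 < L) (hc : decreasing_curve L f g).
Hypotheses (sg : - 2^-1 < sigma) (ta : - 2^-1 < tau).

Lemma lattice_count_dual r s : 0 < r -> 0 < s ->
  lattice_count L f sigma tau r s = lattice_count L g tau sigma r s^-1.
Proof.
move=> r0 s0; have s0' : 0 < s^-1 by rewrite invr_gt0.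
have hs := decreasing_curve_sym hc.
rewrite (lattice_count_sum L0 hc sg ta r0 s0) (lattice_count_sum L0 hs ta sg r0 s0').
rewrite (@dual_tail_sum _ (column_height (clampf L g) tau sigma r s^-1) 0
  (column_index tau (s^-1 / r) L)) //.
- by apply: eq_bigr => k _; rewrite subn0.
- by move=> j k j0 k0; rewrite (column_height_dual L0 hc sg ta).
- by move=> j _; exact: (column_height_le sigma tau L0 hc).
- by move=> k _; have := column_height_le tau sigma L0 hs r0 s0' k; rewrite invrK.
Qed.

Lemma area_dual : area L f = area L g.
Proof.
have hs := decreasing_curve_sym hc.
have [F [dF iF]] := continuous_primitive (clampf_continuous L0 hc).
have [G [dG iG]] := continuous_primitive (clampf_continuous L0 hs).
rewrite (area_primitive L0 iF) (area_primitive L0 iG).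
have pm x y : x <= y -> clampf L f y <= clampf L f x by exact: (clampf_nonincr L0 hc).
have gm x y : x <= y -> clampf L g y <= clampf L g x by exact: (clampf_nonincr L0 hs).
have gp x : 0 <= x <= L -> clampf L g (clampf L f x) = x by exact: (clampfK hc).
have p0 x : 0 <= clampf L f x by have /andP[] := clampf_range L0 hc x.
have h1 := legendre_area dF dG pm gm gp p0 (lexx 0) (ltW L0) (lexx L).
rewrite (clampf_le0 L0 hc (lexx 0)) (clampf_geL L0 hc (lexx L)) in h1.
lra.
Qed.

End dual.

Section bounds.
Variables (L : R) (f g : R -> R) (sigma tau : R).
Hypotheses (L0 : 0 < L) (hc : decreasing_curve L f g).
Hypotheses (sg : - 2^-1 < sigma) (ta : - 2^-1 < tau).

Lemma area_pos : 0 < area L f.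
Proof.
have [F [dF iF]] := continuous_primitive (clampf_continuous L0 hc).
rewrite (area_primitive L0 iF); exact: (area_gt0 L0 hc dF).
Qed.

Lemma concave_count_upper : convex_on (fun x => -1 * clampf L f x) 0 L ->
  f ((1 - neg_part sigma) / (2 - neg_part sigma) * L) < (1 - 2 * neg_part sigma) * L ->
  exists2 c0, 0 < c0 & forall r s, 0 < r -> 0 < s ->
    lattice_count L f sigma tau r s = 0%N \/
    (lattice_count L f sigma tau r s)%:R
      <= r ^+ 2 * area L f - c0 * (r * s) + `|tau| * (r * L / s + 1).
Proof.
move=> hconv hx.
have [F [dF iF]] := continuous_primitive (clampf_continuous L0 hc).
set sm := neg_part sigma in hx *.
have [s0 s1 _] := neg_part_bounds sg; rewrite -/sm in s0 s1.
exists (((1 - 2 * sm) * L - clampf L f ((1 - sm) / (2 - sm) * L)) / 2).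
  rewrite divr_gt0 // subr_gt0 clampf_id //; apply/andP; split.
    by rewrite mulr_ge0 ?divr_ge0 ?(ltW L0) //; lra.
  by rewrite mulrAC ler_pdivrMr; [have L0' := L0; nra|lra].
move=> r s r0 s0'; rewrite (area_primitive L0 iF).
exact: (count_le_riemann L0 hc sg ta (concave_riemann L0 hc sg dF hconv)).
Qed.

Lemma convex_count_upper : convex_on (clampf L f) 0 L ->
  exists2 c0, 0 < c0 & forall r s, 0 < r -> 0 < s ->
    lattice_count L f sigma tau r s = 0%N \/
    (lattice_count L f sigma tau r s)%:R
      <= r ^+ 2 * area L f - c0 * (r * s) + `|tau| * (r * L / s + 1).
Proof.
move=> hconv.
have [F [dF iF]] := continuous_primitive (clampf_continuous L0 hc).
have sg' := sg; have sg1 : 0 < 2^-1 + sigma by lra.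
exists ((2^-1 + sigma) * clampf L f ((2^-1 + sigma) / (1 + sigma) * L)).
  rewrite mulr_gt0 //; apply: (clampf_gt0 L0 hc).
  by rewrite mulrAC ltr_pdivrMr; [have L0' := L0; nra|lra].
move=> r s r0 s0'; rewrite (area_primitive L0 iF).
exact: (count_le_riemann L0 hc sg ta (convex_riemann L0 hc sg dF hconv)).
Qed.

End bounds.
End upper.

(** * The optimal stretch factor *)

Section optimum.
Context {R : realType}.
Implicit Types (r s : R).

Definition maximizes (N : R -> nat) s := 0 < s /\ forall s', 0 < s' -> (N s' <= N s)%N.

Lemma maximizer_exists (N : R -> nat) (B : R) : (forall s, 0 < s -> (N s)%:R <= B) ->
  exists s, maximizes N s.
Proof.
move=> hB; pose P (k : nat) := `[< exists2 s, 0 < s & N s = k >].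
have exP : exists k, P k by exists (N 1); apply/asboolP; exists 1.
have ubP k : P k -> (k <= Num.truncn B)%N.
  move=> /asboolP[s s0 <-]; rewrite truncn_ge_nat ?hB //.
  by apply: le_trans (hB s s0).
case: (ex_maxnP exP ubP) => k /asboolP[s s0 <-] hk.
by exists s; split=> // s' s'0; apply: hk; apply/asboolP; exists s'.
Qed.

Lemma maximizer_dual (N N' : R -> nat) s : (forall t, 0 < t -> N' t = N t^-1) ->
  maximizes N s -> maximizes N' s^-1.
Proof.
move=> hN [s0 hs]; split; first by rewrite invr_gt0.
by move=> s' s'0; rewrite !hN ?invr_gt0 // invrK; apply: hs; rewrite invr_gt0.
Qed.

Lemma max_sup (N : R -> nat) s : maximizes N s ->
  sup [set (N t)%:R | t in [set t : R | 0 < t]] = (N s)%:R :> R.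
Proof.
move=> [s0 hs]; apply/eqP; rewrite eq_le; apply/andP; split.
  apply: ge_sup; first by exists (N s)%:R, s.
  by move=> _ [t t0 <-]; rewrite ler_nat; apply: hs.
apply: ub_le_sup; last by exists s.
by exists (N s)%:R => _ [t t0 <-]; rewrite ler_nat; apply: hs.
Qed.

(** The alternative N = 0 covers the stretch factors for which the first column
    is already beyond the curve. *)
Definition linear_decay (N : R -> R -> nat) (A L T c0 : R) :=
  forall r s, 0 < r -> 0 < s -> N r s = 0%N \/
    (N r s)%:R <= r ^+ 2 * A - c0 * (r * s) + T * (r * L / s + 1).

Lemma linear_decay_ge1 N A L T c0 r s : 0 <= A -> 0 <= T -> 0 <= L -> 0 <= c0 ->
  linear_decay N A L T c0 -> 0 < r -> 1 <= s ->
  (N r s)%:R <= r ^+ 2 * A + T * (r * L + 1).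
Proof.
move=> A0 T0 L0 c00 hN r0 s1; have s0 : 0 < s by exact: lt_le_trans s1.
have p1 : 0 <= r ^+ 2 * A by rewrite mulr_ge0 // sqr_ge0.
have p2 : 0 <= r * L by rewrite mulr_ge0 // ltW.
have [->|h] := hN r s r0 s0.
  by rewrite addr_ge0 // mulr_ge0 // addr_ge0.
have p3 : 0 <= c0 * (r * s) by rewrite mulr_ge0 // mulr_ge0 // ltW.
apply: (le_trans h); apply: lerD; first by lra.
by rewrite ler_wpM2l // lerD2r ler_pdivrMr // ler_peMr.
Qed.

(** A large stretch factor loses a multiple of r s against the value at s = 1, which
    is only O(r) below the leading term. *)
Lemma maximizer_le N A L T c0 K R1 : 0 < A -> 0 <= T -> 0 <= L -> 0 < c0 -> 0 <= K ->
  linear_decay N A L T c0 ->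
  (forall r, R1 <= r -> r ^+ 2 * A - K * r <= (N r 1)%:R) ->
  exists m R0, [/\ 0 < m, 1 <= R0 & forall r s, R0 <= r -> maximizes (N r) s -> s <= m].
Proof.
move=> A0 T0 L0 c00 K0 hN h1.
pose m := (K + T * (L + 1)) / c0.
have m0 : 0 <= m by rewrite divr_ge0 ?(ltW c00) // addr_ge0 // mulr_ge0 // addr_ge0.
exists (1 + m), (1 + `|R1| + (K + 1) / A); split.
- by rewrite ltr_wpDr.
- by rewrite -addrA lerDl addr_ge0 // divr_ge0 ?(ltW A0) // addr_ge0.
move=> r s hr [s0 hs].
have K1A : 0 <= (K + 1) / A by rewrite divr_ge0 ?(ltW A0) // addr_ge0.
have rR : R1 <= r by have := ler_norm R1; have := hr; lra.
have r1 : 1 <= r by have := normr_ge0 R1; lra.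
have r0 : 0 < r by lra.
have rA : K + 1 <= r * A by rewrite -ler_pdivrMr //; have := normr_ge0 R1; lra.
have [s1|/ltW s1] := leP s 1; first by lra.
have N1 := h1 r rR.
have Ns : (N r 1)%:R <= (N r s)%:R :> R by rewrite ler_nat hs.
have N0 : 0 < (N r 1)%:R :> R.
  apply: lt_le_trans N1; rewrite subr_gt0 expr2 -mulrA mulrC ltr_pM2l //; lra.
have [e|h] := hN r s r0 s0; first by move: Ns; rewrite e; lra.
have t1 : T * (r * L / s + 1) <= T * (r * L + r).
  rewrite ler_wpM2l //; apply: lerD => //.
  by rewrite ler_pdivrMr // ler_peMr // mulr_ge0 // ltW.
have : c0 * s * r <= (K + T * (L + 1)) * r by move: t1 h Ns N1; clear; lra.
rewrite ler_pM2r // => h2.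
suff : s <= m by move: m0; clear; lra.
by rewrite /m ler_pdivlMr // mulrC.
Qed.

(** The part of the second term that depends on s, with its minimum split off. *)
Lemma quadratic_gap (a b s : R) : 0 < a -> 0 < b -> 0 < s ->
  s * a + s^-1 * b = 2 * Num.sqrt (a * b) + a * (s - Num.sqrt (b / a)) ^+ 2 / s.
Proof.
move=> a0 b0 s0.
have -> : Num.sqrt (a * b) = a * Num.sqrt (b / a).
  rewrite -[X in _ = X * _](ger0_norm (ltW a0)) -sqrtr_sqr -sqrtrM ?sqr_ge0 //.
  by congr Num.sqrt; field; rewrite gt_eqF.
have e : Num.sqrt (b / a) ^+ 2 = b / a by rewrite sqr_sqrtr // divr_ge0 // ltW.
have -> : (s - Num.sqrt (b / a)) ^+ 2 = s ^+ 2 - 2 * s * Num.sqrt (b / a) + b / a.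
  by rewrite sqrrB e -mulr_natl; ring.
by field; rewrite !gt_eqF.
Qed.

Section main.
(* N' counts for the inverse curve: small stretch factors of N are large ones
   of N'. *)
Variables (N N' : R -> R -> nat) (A L T T' c0 c0' a b E : R).
Hypotheses (A0 : 0 < A) (L0 : 0 < L) (T0 : 0 <= T) (T0' : 0 <= T')
  (c00 : 0 < c0) (c00' : 0 < c0') (a0 : 0 < a) (b0 : 0 < b) (E0 : 0 < E).
Hypothesis dual : forall r s, 0 < r -> 0 < s -> N r s = N' r s^-1.
Hypotheses (U : linear_decay N A L T c0) (U' : linear_decay N' A L T' c0').
Hypothesis As : forall c1 c2 : R, 0 < c1 -> 0 < c2 ->
  exists C R0 : R, [/\ 0 < C, 1 <= R0 & forall r s, R0 <= r -> c1 <= s <= c2 ->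
    `|(N r s)%:R - (r ^+ 2 * A - r * L * (s * a + s^-1 * b))| <= C * r `^ (1 - 2 * E)].

Lemma optimum_exists r : 0 < r -> exists s, maximizes (N r) s.
Proof.
move=> r0.
have p2 : 0 <= r * L by rewrite mulr_ge0 // ltW.
apply: (@maximizer_exists (N r) (r ^+ 2 * A + (T + T') * (r * L + 1))) => s s0.
have [s1|/ltW s1] := leP 1 s.
  apply: (le_trans (linear_decay_ge1 (ltW A0) T0 (ltW L0) (ltW c00) U r0 s1)).
  by rewrite lerD2l ler_wpM2r ?lerDl // addr_ge0.
have si1 : 1 <= s^-1 by rewrite invf_ge1.
rewrite dual //.
apply: (le_trans (linear_decay_ge1 (ltW A0) T0' (ltW L0) (ltW c00') U' r0 si1)).
by rewrite lerD2l ler_wpM2r ?lerDr // addr_ge0.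
Qed.

Lemma count_at_one : exists K R1, [/\ 0 <= K, 1 <= R1 & forall r, R1 <= r ->
  r ^+ 2 * A - K * r <= (N r 1)%:R].
Proof.
have [C [R0 [C0 R01 h]]] := As ltr01 ltr01.
exists (L * (a + b) + C), R0; split=> //.
  by rewrite addr_ge0 ?(ltW C0) // mulr_ge0 ?addr_ge0 // ltW.
move=> r hr; have := h r 1 hr; rewrite lexx invr1 !mul1r => /(_ isT).
have r1 : 1 <= r by exact: le_trans hr.
have := powR_mono r1 (_ : 1 - 2 * E <= 1); rewrite powRr1; last by lra.
rewrite gerBl; have E0' := E0 => /(_ ltac:(lra)) hp.
have := ler_wpM2l (ltW C0) hp.
by rewrite ler_norml => h1 /andP[h2 _]; lra.
Qed.

Lemma optimum_confined : exists c1 c2 R0, [/\ 0 < c1, 0 < c2, 1 <= R0 &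
  forall r s, R0 <= r -> maximizes (N r) s -> c1 <= s <= c2].
Proof.
have [K [R1 [K0 R11 h1]]] := count_at_one.
have h1' r : R1 <= r -> r ^+ 2 * A - K * r <= (N' r 1)%:R.
  move=> hr; have := h1 r hr; rewrite dual ?invr1 //.
  by apply: lt_le_trans hr; exact: lt_le_trans R11.
have [m [R2 [m0 R21 hm]]] := maximizer_le A0 T0 (ltW L0) c00 K0 U h1.
have [m' [R3 [m0' R31 hm']]] := maximizer_le A0 T0' (ltW L0) c00' K0 U' h1'.
exists m'^-1, m, (R2 + R3); split=> //; [by rewrite invr_gt0|by lra|].
move=> r s hr hs; have r0 : 0 < r by lra.
rewrite (hm r s) //; last by lra.
have s0 := hs.1; rewrite andbT -[s]invrK lef_pV2 ?posrE ?invr_gt0 //.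
apply: (hm' r); first by lra.
by apply: maximizer_dual hs => t t0; rewrite (dual r0) ?invrK // invr_gt0.
Qed.

(** Comparing a maximizer s with t, the minimizer of the second term: the gap
    r L a (s - t)^2 / s is at most the two error terms.  As s is confined to a
    compact interval, this bounds (s - t)^2 by r^(- 2 E). *)
Lemma optimum_rate : exists C R0, [/\ 0 < C, 1 <= R0 &
  forall r s, R0 <= r -> maximizes (N r) s ->
    `|s - Num.sqrt (b / a)| <= C * r `^ (- E) /\
    `|(N r s)%:R - (r ^+ 2 * A - 2 * r * L * Num.sqrt (a * b))| <= C * r `^ (1 - 2 * E)].
Proof.
have [c1 [c2 [R1 [c10 c20 R11 hc]]]] := optimum_confined.
(* an interval containing t and all maximizers for large r *)
set t := Num.sqrt (b / a); have t0 : 0 < t by rewrite sqrtr_gt0 divr_gt0.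
pose d1 := (c1^-1 + t^-1)^-1; pose d2 := c2 + t.
have d10 : 0 < d1 by rewrite invr_gt0 addr_gt0 ?invr_gt0.
have d20 : 0 < d2 by rewrite addr_gt0.
have dt : d1 <= t <= d2.
  rewrite /d1 /d2 lerDr (ltW c20) andbT -[leRHS]invrK lef_pV2 ?posrE ?invr_gt0 //.
    by rewrite lerDr invr_ge0 ltW.
  by rewrite addr_gt0 ?invr_gt0.
have dc1 : d1 <= c1.
  rewrite /d1 -[leRHS]invrK lef_pV2 ?posrE ?invr_gt0 //.
    by rewrite lerDl invr_ge0 ltW.
  by rewrite addr_gt0 ?invr_gt0.
have dc2 : c2 <= d2 by rewrite lerDl ltW.
have [C [R0 [C0 R01 hN]]] := As d10 d20.
pose K := 2 * C * d2 / (L * a).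
have K0 : 0 <= K by rewrite divr_ge0 ?mulr_ge0 ?ltW.
exists (C + Num.sqrt K), (R0 + R1); split.
- by rewrite ltr_wpDr // sqrtr_ge0.
- by lra.
move=> r s hr hs; have r0 : 0 < r by lra.
have /andP[sc1 sc2] := hc r s ltac:(lra) hs.
have s0 := hs.1.
have Nt := hN r t ltac:(lra) dt.
have Ns := hN r s ltac:(lra) ltac:(lra).
rewrite (quadratic_gap a0 b0 t0) -/t subrr expr0n mulr0 mul0r addr0 in Nt.
rewrite (quadratic_gap a0 b0 s0) -/t in Ns.
have Nst : (N r t)%:R <= (N r s)%:R :> R by rewrite ler_nat; apply: hs.2.
set P := r `^ (1 - 2 * E) in Nt Ns *; set Q := Num.sqrt (a * b) in Nt Ns *.
set W := a * (s - t) ^+ 2 / s in Ns.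
have W0 : 0 <= W by rewrite divr_ge0 ?(ltW s0) // mulr_ge0 ?sqr_ge0 // ltW.
have rLW : 0 <= r * L * W by rewrite mulr_ge0 // mulr_ge0 ?ltW.
have P0 : 0 <= P by exact: powR_ge0.
rewrite ler_norml in Nt; rewrite ler_norml in Ns.
move/andP: Nt => [n1 n2]; move/andP: Ns => [n3 n4].
split; last first.
  have : C * P <= (C + Num.sqrt K) * P by rewrite ler_wpM2r // lerDl sqrtr_ge0.
  by rewrite ler_norml => h; apply/andP; split; move: h n1 n2 n3 n4 rLW Nst; lra.
have hW : r * L * W <= 2 * C * P by move: n1 n4 Nst; lra.
have Pe : P = r * (r `^ (- E)) ^+ 2.
  by rewrite -powR_mulrn ?powR_ge0 // -powRrM powR_mulr //; congr (_ `^ _); ring.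
have hsq : (s - t) ^+ 2 <= K * (r `^ (- E)) ^+ 2.
  have k0 : 0 < r * L * a by rewrite !mulr_gt0.
  have e1 : r * L * a * (s - t) ^+ 2 = r * L * W * s by rewrite /W; field; rewrite gt_eqF.
  have e2 : r * L * a * (K * (r `^ (- E)) ^+ 2) = 2 * C * P * d2.
    by rewrite /K Pe; field; rewrite !gt_eqF.
  rewrite -(ler_pM2l k0) e1 e2; apply: ler_pM => //; [exact: ltW|lra].
have q0 : 0 <= r `^ (- E) by exact: powR_ge0.
apply: (@le_trans _ _ (Num.sqrt K * r `^ (- E))); last first.
  by rewrite ler_wpM2r // lerDr ltW.
rewrite -sqrtr_sqr -[X in _ * X](ger0_norm q0) -[X in _ * X]sqrtr_sqr -sqrtrM //.
exact: ler_wsqrtr.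
Qed.

End main.
End optimum.

(** * Conclusion *)

Lemma rateP (R : realType) (a1 a2 a3 b1 b2 b3 : R) :
  0 < a1 -> 0 < a2 -> 0 < a3 -> 0 < b1 -> 0 < b2 -> 0 < b3 ->
  let E := rate a1 a2 a3 b1 b2 b3 in
  [/\ 0 < E, E <= 6^-1, [/\ E <= a1, E <= a2 & E <= a3] & [/\ E <= b1, E <= b2 & E <= b3]].
Proof.
move=> ? ? ? ? ? ? E.
have E0 : 0 < E by rewrite /E /rate !big_cons big_nil !lt_min; do !(apply/andP; split=> //); rewrite invr_gt0.
have : E <= E by [].
rewrite {2}/E /rate !big_cons big_nil !le_min.
by move=> /and5P[e1 e2 e3 e4 /and3P[e5 e6 e7]]; do !split.
Qed.

(** What the concave and the convex case have in common: decay of the count at both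
    ends, and the asymptotics on compact sets of stretch factors. *)
Lemma optimum_asymptotics (R : realType) (L : R) (f g : R -> R)
    (sigma tau E c0 c0' : R) :
  0 < L -> decreasing_curve L f g -> - 2^-1 < sigma -> - 2^-1 < tau ->
  0 < E -> 0 < c0 -> 0 < c0' ->
  linear_decay (lattice_count L f sigma tau) (area L f) L `|tau| c0 ->
  linear_decay (lattice_count L g tau sigma) (area L g) L `|sigma| c0' ->
  (forall c1 c2 : R, 0 < c1 -> 0 < c2 -> exists C R0 : R, [/\ 0 < C, 1 <= R0 &
     forall r s, R0 <= r -> c1 <= s <= c2 ->
     `|(lattice_count L f sigma tau r s)%:R
       - (r ^+ 2 * area L f - second_term L sigma tau r s)| <= C * r `^ (1 - 2 * E)]) ->
  [/\ (forall r : R, 0 < r -> argmax_stretch L f sigma tau r !=set0),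
      (forall eps : R, 0 < eps -> \forall r \near +oo_R,
         forall s, argmax_stretch L f sigma tau r s ->
           `|s - s_star sigma tau| < eps),
      (exists C r0 : R, [/\ 0 < C, 0 < r0 &
         forall r s : R, r0 <= r -> argmax_stretch L f sigma tau r s ->
           `|s - s_star sigma tau| <= C * r `^ (- E)]) &
      isO +oo_R
        (fun r => max_lattice_count L f sigma tau r
           - (r ^+ 2 * area L f
              - 2 * r * L * Num.sqrt ((sigma + 2^-1) * (tau + 2^-1))))
        (fun r => r `^ (1 - 2 * E))].
Proof.
move=> L0 hc sg ta E0 c00 c00' U U' As.
have A0 := area_pos L0 hc.
have dual r s : 0 < r -> 0 < s ->
  lattice_count L f sigma tau r s = lattice_count L g tau sigma r s^-1.
  exact: (lattice_count_dual L0 hc sg ta).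
rewrite -(area_dual L0 hc) in U'.
have a0 : 0 < sigma + 2^-1 by lra.
have b0 : 0 < tau + 2^-1 by lra.
have ex := optimum_exists A0 L0 (normr_ge0 _) (normr_ge0 _) c00 c00' dual U U'.
have [C [R0 [C0 R01 hr]]] := optimum_rate A0 L0 (normr_ge0 _) (normr_ge0 _) c00 c00'
  a0 b0 E0 dual U U' As.
have R00 : 0 < R0 by lra.
split.
- by move=> r /ex[s hs]; exists s.
- move=> eps eps0.
  have [R1 R11 h1] := @powR_small R E (eps / (2 * C)) E0 ltac:(by rewrite divr_gt0 ?mulr_gt0).
  exists (R0 + R1); split; first exact: num_real.
  move=> r hrr s hs.
  have [h _] := hr r s ltac:(lra) hs.
  apply: (le_lt_trans h); apply: (@le_lt_trans _ _ (C * (eps / (2 * C)))).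
    by rewrite ler_wpM2l ?(ltW C0) // h1 //; lra.
  have -> : C * (eps / (2 * C)) = eps / 2 by field; rewrite gt_eqF.
  lra.
- by exists C, R0; split=> // r s rR hs; case: (hr r s rR hs).
apply: (@infty_isO R _ _ C R0) => r rR.
have r0 : 0 < r by lra.
have [s hs] := ex r r0.
have [_ h] := hr r s rR hs.
by rewrite /max_lattice_count (max_sup hs) (ger0_norm (powR_ge0 _ _)).
Qed.

Theorem theorem5 (R : realType) (L : R) (f g : R -> R)
    (sigma tau a1 a2 a3 b1 b2 b3 : R) :
  0 < L ->
  decreasing_curve L f g ->
  - 2^-1 < sigma -> - 2^-1 < tau ->
  0 < a1 -> 0 < a2 -> 0 < a3 -> 0 < b1 -> 0 < b2 -> 0 < b3 ->
  concave_case L f g sigma tau a1 a2 a3 b1 b2 b3 \/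
  convex_case L f g sigma tau a1 a2 a3 b1 b2 b3 ->
  let E := rate a1 a2 a3 b1 b2 b3 in
  [/\ (forall r : R, 0 < r -> argmax_stretch L f sigma tau r !=set0),
      (forall eps : R, 0 < eps -> \forall r \near +oo_R,
         forall s, argmax_stretch L f sigma tau r s ->
           `|s - s_star sigma tau| < eps),
      (exists C r0 : R, [/\ 0 < C, 0 < r0 &
         forall r s : R, r0 <= r -> argmax_stretch L f sigma tau r s ->
           `|s - s_star sigma tau| <= C * r `^ (- E)]) &
      isO +oo_R
        (fun r => max_lattice_count L f sigma tau r
           - (r ^+ 2 * area L f
              - 2 * r * L * Num.sqrt ((sigma + 2^-1) * (tau + 2^-1))))
        (fun r => r `^ (1 - 2 * E))].
Proof.
move=> L0 hc sg ta a10 a20 a30 b10 b20 b30 hcase E.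
have [E0 E1 [ea1 ea2 ea3] [eb1 eb2 eb3]] := rateP a10 a20 a30 b10 b20 b30.
rewrite -/E in E0 E1 ea1 ea2 ea3 eb1 eb2 eb3.
have hs := decreasing_curve_sym hc.
have alL al be : on_curve L f al be -> 0 < be -> al < L.
  move=> [/andP[_ alL] ->] be0; rewrite lt_neqAle alL andbT.
  by apply/eqP => e; move: be0; rewrite e (curve_atL L0 hc) ltxx.
case: hcase => [[hconv hmax [al [be [hon al0 be0 sf sg']]] _]
               |[hconv _ _ _ [al [be [hon al0 be0 sf sg']]]]].
- have hcl := concave_clampf hconv.
  have hclg := concave_inverse L0 hc hcl.
  have [sm0 _ _] := neg_part_bounds sg; have [tm0 _ _] := neg_part_bounds ta.
  have smL : 0 <= neg_part sigma * L by rewrite mulr_ge0 ?(ltW L0).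
  have tmL : 0 <= neg_part tau * L by rewrite mulr_ge0 ?(ltW L0).
  move: hmax; rewrite gt_max => /andP[m1 m2].
  have [c0 c00 U] := concave_count_upper L0 hc sg ta hcl ltac:(lra).
  have [c0' c00' U'] := concave_count_upper L0 hs ta sg hclg ltac:(lra).
  apply: (optimum_asymptotics L0 hc sg ta E0 c00 c00' U U') => c1 c2 c10 c20.
  by apply: (concave_asymptotic (a1 := a1) (a2 := a2) (b1 := b1) (b2 := b2) L0 hc sg ta _ _ _ _ _ _ _ _ _ al0 (alL _ _ hon be0) hon.2) => //; lra.
have hcl := convex_clampf hconv.
have hclg := convex_inverse L0 hc hcl.
have [c0 c00 U] := convex_count_upper L0 hc sg ta hcl.
have [c0' c00' U'] := convex_count_upper L0 hs ta sg hclg.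
apply: (optimum_asymptotics L0 hc sg ta E0 c00 c00' U U') => c1 c2 c10 c20.
by apply: (convex_asymptotic (a1 := a1) (a2 := a2) (a3 := a3) (b1 := b1) (b2 := b2) (b3 := b3) L0 hc sg ta _ _ _ _ _ _ _ _ _ al0 (alL _ _ hon be0) hon.2) => //; lra.
Qed.
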